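(* Let $\varphi:(M^3,g)\to(N^2,h)$ be a $C^\infty$ submersive semi-conformal map with dilation $\lambda$. Then $(M^3,g)$ is a Ricci soliton if and only if there are a function $f:M^3\to\mathbb R$, a horizontal vector field $X$ and a constant $A$ such that $$0=\left\{\lambda^2K^N+\Delta\ln\lambda+\mu(\ln\lambda)-f\,U(\ln\lambda)\right\}(g-\theta^2)-\tfrac14\|I\|^2g+\tfrac12\mathcal L_Xg+Ag-(\mu^\flat+d^{\mathcal V}\ln\lambda)^2-(d^{\mathcal V}\ln\lambda)^2+\left\{df+f\mu^\flat+2\,d(U(\ln\lambda))+d^*\Omega\right\}\odot\theta .$$
   Context: Ricci soliton: $-2\,\mathrm{Ricci}(g)=\mathcal L_Eg+2Ag$ for some vector field $E$ and constant $A$. A smooth submersion $\varphi:(M^3,g)\to(N^2,h)$ is semi-conformal with dilation $\lambda:M\to(0,\infty)$ if $\varphi^*h(X,Y)=\lambda^2g(X,Y)$ for all $X,Y\in\mathcal H$, where $\mathcal V=\ker d\varphi$ (vertical) and $\mathcal H=\mathcal V^\perp$ (horizontal); $\mathcal V,\mathcal H$ also denote the orthogonal projections. $U$ is a chosen unit vertical vector field (assumed to exist globally; otherwise work locally), $\theta=g(U,\cdot)$, $\Omega=d\theta$, with $d\theta(X,Y)=X\theta(Y)-Y\theta(X)-\theta([X,Y])$. $I(X,Y)=\mathcal V[X,Y]$ for $X,Y\in\mathcal H$, and $\|I\|^2=\sum_{a,b}|I(e_a,e_b)|^2$ over all pairs from an orthonormal frame $\{e_1,e_2\}$ of $\mathcal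 H$. $\mu=\nabla_UU$ is the mean curvature vector field of the fibres, $\mu^\flat=g(\mu,\cdot)$. $d^{\mathcal V}f=U(f)\theta$. $\omega\odot\eta=\frac12(\omega\otimes\eta+\eta\otimes\omega)$, $\omega^2=\omega\otimes\omega$. $\Delta=\mathrm{Tr}\nabla d$ on $(M,g)$; $d^*\Omega(X)=-\sum_i(\nabla_{e_i}\Omega)(e_i,X)$. $K^N$ is the Gauss curvature of $(N,h)$, evaluated at $\varphi(x)$. *)

(* Defs.v *)
From mathcomp Require Import all_boot all_order all_algebra.
From mathcomp Require Import all_classical all_reals all_analysis.

Set Implicit Arguments.
Unset Strict Implicit.
Unset Printing Implicit Defensive.

Import Order.TTheory GRing.Theory Num.Theory.
Import numFieldNormedType.Exports.

Local Open Scope classical_set_scope.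
Local Open Scope ring_scope.

(* All tensor calculus below is written in the charts of an atlas, but with
   functions defined on the manifold itself: a scalar is a map [T -> R], and
   [pderiv x y k f] is its [k]-th partial derivative in the chart [x] with
   inverse [y], again a map [T -> R]. Values outside the domain of the chart
   are meaningless and are never used. *)
Definition pderiv (R : realType) (n : nat) (T : Type)
    (x : T -> 'rV[R]_n) (y : 'rV[R]_n -> T) (k : 'I_n) (f : T -> R) : T -> R :=
  fun p => 'D_(delta_mx 0 k) (f \o y) (x p).

(* C^oo on the open set [D], contained in the domain of the chart: all
   iterated partial derivatives exist and are continuous at all points of [D]. *)
Definition smooth_coord (R : realType) (n : nat) (T : topologicalType)
    (x : T -> 'rV[R]_n) (y : 'rV[R]_n -> T) (D : set T) (f : T -> R) : Prop :=
  forall (w : seq 'I_n) (p : T), D p ->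
    let F := foldr (pderiv x y) f w in
    {for p, continuous F} /\
    forall k : 'I_n, derivable (F \o y) (x p) (delta_mx 0 k).

Record manifold (R : realType) (n : nat) := Manifold {
  carrier :> topologicalType;
  chart : Type;
  chart_dom : chart -> set carrier;
  chart_map : chart -> carrier -> 'rV[R]_n;
  chart_inv : chart -> 'rV[R]_n -> carrier;
  manifold_hausdorff : hausdorff_space carrier;
  manifold_second_countable : @second_countable carrier;
  chart_dom_open : forall i, open (chart_dom i);
  chart_dom_cover : forall p, exists i, chart_dom i p;
  chart_image_open : forall i, open (chart_map i @` chart_dom i);
  chart_mapK : forall i p, chart_dom i p -> chart_inv i (chart_map i p) = p;
  chart_map_continuous : forall i p, chart_dom i p ->
    {for p, continuous (chart_map i)};
  chart_inv_continuous : forall i v, (chart_map i @` chart_dom i) v ->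
    {for v, continuous (chart_inv i)};
  transition_smooth : forall i j k,
    smooth_coord (chart_map i) (chart_inv i) (chart_dom i `&` chart_dom j)
      (fun p => chart_map j p 0 k) }.

Arguments chart {R n} m.
Arguments chart_dom {R n m} i.
Arguments chart_map {R n m} i.
Arguments chart_inv {R n m} i.

Section Manifold.
Variables (R : realType) (n : nat) (M : manifold R n).
Implicit Types (i j : chart M) (p : M).

Definition pd i (k : 'I_n) (f : M -> R) : M -> R :=
  pderiv (chart_map i) (chart_inv i) k f.

Definition smooth_in i (D : set M) (f : M -> R) : Prop :=
  smooth_coord (chart_map i) (chart_inv i) (chart_dom i `&` D) f.

Definition smooth (f : M -> R) : Prop := forall i, smooth_in i setT f.

(* Jacobian of the change of coordinates from [i] to [j], acting on row
   vectors on the right. *)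
Definition transition i j p : 'M[R]_n :=
  \matrix_(a, b) pd i a (fun q => chart_map j q 0 b) p.

(* A vector field is given by its components in every chart, a metric by its
   Gram matrix in every chart. *)
Definition vector_field (X : chart M -> M -> 'rV[R]_n) : Prop :=
  (forall i k, smooth_in i setT (fun q => X i q 0 k)) /\
  (forall i j p, chart_dom i p -> chart_dom j p ->
     X j p = X i p *m transition i j p).

Definition inner (G : 'M[R]_n) (u v : 'rV[R]_n) : R := (u *m G *m v^T) 0 0.

Definition riemannian_metric (g : chart M -> M -> 'M[R]_n) : Prop :=
  [/\ forall i a b, smooth_in i setT (fun q => g i q a b),
      forall i j p, chart_dom i p -> chart_dom j p ->
        g i p = transition i j p *m g j p *m (transition i j p)^T,
      forall i p, chart_dom i p -> (g i p)^T = g i p &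
      forall i p u, chart_dom i p -> u != 0 -> 0 < inner (g i p) u u].

Section Chart.
Variables (g : chart M -> M -> 'M[R]_n) (i : chart M).
Implicit Types (X Y Z : M -> 'rV[R]_n) (f : M -> R) (u v y z : 'rV[R]_n).

Definition deriv_along X f : M -> R :=
  fun q => \sum_(k < n) X q 0 k * pd i k f q.

Definition bracket X Y : M -> 'rV[R]_n := fun q =>
  \row_b (deriv_along X (fun r => Y r 0 b) q
          - deriv_along Y (fun r => X r 0 b) q).

Definition christoffel (c a b : 'I_n) : M -> R := fun q =>
  2^-1 * \sum_(d < n) invmx (g i q) c d *
    (pd i a (fun r => g i r b d) q + pd i b (fun r => g i r a d) q
     - pd i d (fun r => g i r a b) q).

Definition nabla X Y : M -> 'rV[R]_n := fun q =>
  \row_c (deriv_along X (fun r => Y r 0 c) q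
          + \sum_(a < n) \sum_(b < n) christoffel c a b q * X q 0 a * Y q 0 b).

Definition riemann X Y Z : M -> 'rV[R]_n := fun q =>
  nabla X (nabla Y Z) q - nabla Y (nabla X Z) q - nabla (bracket X Y) Z q.

(* Pointwise values of tensors at tangent vectors [y], [z] are obtained by
   extending these to fields with constant components in the chart. *)

(* Trace of the endomorphism u |-> R(u, y) z; positive on round spheres. *)
Definition ricci p y z : R :=
  \sum_(a < n) riemann (cst (delta_mx 0 a)) (cst y) (cst z) p 0 a.

Definition lie_metric X p y z : R :=
  deriv_along X (fun q => inner (g i q) y z) p
  - inner (g i p) (bracket X (cst y) p) z
  - inner (g i p) y (bracket X (cst z) p).

Definition sectional p u v : R :=
  inner (g i p) (riemann (cst u) (cst v) (cst v) p) u /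
  (inner (g i p) u u * inner (g i p) v v - inner (g i p) u v ^+ 2).

Definition differential f p y : R := deriv_along (cst y) f p.

Definition extd (w : M -> 'rV[R]_n -> R) p y z : R :=
  deriv_along (cst y) (fun q => w q z) p
  - deriv_along (cst z) (fun q => w q y) p
  - w p (bracket (cst y) (cst z) p).

Definition nabla2form (W : M -> 'rV[R]_n -> 'rV[R]_n -> R) p u y z : R :=
  deriv_along (cst u) (fun q => W q y z) p
  - W p (nabla (cst u) (cst y) p) z
  - W p y (nabla (cst u) (cst z) p).

Definition orthonormal_at (m : nat) p (e : 'I_m -> 'rV[R]_n) : Prop :=
  forall a b, inner (g i p) (e a) (e b) = (a == b)%:R.

(* An arbitrarily chosen orthonormal basis of the tangent space at [p]; the
   traces below do not depend on the choice. *)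
Definition onb p : 'I_n -> 'rV[R]_n :=
  xget (fun=> 0) [set e | orthonormal_at p e].

Definition hessian f p y z : R :=
  deriv_along (cst y) (deriv_along (cst z) f) p
  - deriv_along (nabla (cst y) (cst z)) f p.

Definition laplacian f p : R := \sum_(k < n) hessian f p (onb p k) (onb p k).

Definition codiff (W : M -> 'rV[R]_n -> 'rV[R]_n -> R) p y : R :=
  - \sum_(k < n) nabla2form W p (onb p k) (onb p k) y.

End Chart.

Definition ricci_soliton (g : chart M -> M -> 'M[R]_n) : Prop :=
  exists (E : chart M -> M -> 'rV[R]_n) (A : R), vector_field E /\
    forall i p, chart_dom i p -> forall y z,
      - (2 * ricci g i p y z) =
      lie_metric g i (E i) p y z + 2 * A * inner (g i p) y z.

End Manifold.

Definition gauss_curvature (R : realType) (N : manifold R 2)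
    (h : chart N -> N -> 'M[R]_2) (j : chart N) (q : N) : R :=
  sectional h j q (delta_mx 0 ord0) (delta_mx 0 ord_max).

Section Map.
Variables (R : realType) (m n : nat) (M : manifold R m) (N : manifold R n).
Variables (g : chart M -> M -> 'M[R]_m) (h : chart N -> N -> 'M[R]_n).
Variable phi : M -> N.

Definition smooth_map : Prop :=
  continuous phi /\
  forall i (j : chart N) k,
    smooth_in i (phi @^-1` chart_dom j) (fun q => chart_map j (phi q) 0 k).

(* Matrix of the differential of [phi] at [p], acting on row vectors. *)
Definition dmap (i : chart M) (j : chart N) (p : M) : 'M[R]_(m, n) :=
  \matrix_(a, b) pd i a (fun q => chart_map j (phi q) 0 b) p.

Definition submersion : Prop :=
  smooth_map /\
  forall i j p, chart_dom i p -> chart_dom j (phi p) -> row_full (dmap i j p).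

Definition vertical (i : chart M) (p : M) (v : 'rV[R]_m) : Prop :=
  forall j, chart_dom j (phi p) -> v *m dmap i j p = 0.

Definition horizontal (i : chart M) (p : M) (u : 'rV[R]_m) : Prop :=
  forall v, vertical i p v -> inner (g i p) u v = 0.

Definition semi_conformal (lambda : M -> R) : Prop :=
  (forall p, 0 < lambda p) /\
  forall i j p, chart_dom i p -> chart_dom j (phi p) ->
    forall x y, horizontal i p x -> horizontal i p y ->
      inner (h j (phi p)) (x *m dmap i j p) (y *m dmap i j p) =
      lambda p ^+ 2 * inner (g i p) x y.

Definition vertical_field (X : chart M -> M -> 'rV[R]_m) : Prop :=
  vector_field X /\ forall i p, chart_dom i p -> vertical i p (X i p).

Definition horizontal_field (X : chart M -> M -> 'rV[R]_m) : Prop :=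
  vector_field X /\ forall i p, chart_dom i p -> horizontal i p (X i p).

Definition unit_field (X : chart M -> M -> 'rV[R]_m) : Prop :=
  forall i p, chart_dom i p -> inner (g i p) (X i p) (X i p) = 1.

(* [U] is meant to be a unit vertical field and the fibres to be
   one-dimensional, so that [U] spans the vertical spaces. *)
Section Fibres.
Variables (U : chart M -> M -> 'rV[R]_m) (i : chart M).

Definition theta (p : M) (y : 'rV[R]_m) : R := inner (g i p) (U i p) y.

Definition Omega : M -> 'rV[R]_m -> 'rV[R]_m -> R := extd i theta.

Definition vproj (p : M) (y : 'rV[R]_m) : 'rV[R]_m := theta p y *: U i p.
Definition hproj (p : M) (y : 'rV[R]_m) : 'rV[R]_m := y - vproj p y.

(* I(X, Y) = V[X, Y]; tangent vectors are extended to horizontal fields. *)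
Definition integrability (p : M) (y z : 'rV[R]_m) : 'rV[R]_m :=
  vproj p (bracket i (fun q => hproj q y) (fun q => hproj q z) p).

(* An arbitrarily chosen orthonormal basis of the horizontal space at [p],
   whose dimension is that of the target. *)
Definition honb (p : M) : 'I_n -> 'rV[R]_m :=
  xget (fun=> 0)
    [set e | orthonormal_at g i p e /\ forall a, horizontal i p (e a)].

Definition integrability_norm2 (p : M) : R :=
  \sum_(a < n) \sum_(b < n)
    let w := integrability p (honb p a) (honb p b) in inner (g i p) w w.

Definition mu : M -> 'rV[R]_m := nabla g i (U i) (U i).

Definition mu_flat (p : M) (y : 'rV[R]_m) : R := inner (g i p) (mu p) y.

Definition dvert (f : M -> R) (p : M) (y : 'rV[R]_m) : R :=
  deriv_along i (U i) f p * theta p y.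

End Fibres.
End Map.

Definition symprod (R : realType) (V : Type) (w e : V -> R) (y z : V) : R :=
  2^-1 * (w y * e z + e y * w z).
Definition tsquare (R : realType) (V : Type) (w : V -> R) (y z : V) : R :=
  w y * w z.

(* Main.v *)
Require Import Defs.
From HB Require Import structures.
From mathcomp Require Import all_boot all_order all_algebra.
From mathcomp Require Import all_classical all_reals all_analysis.
From mathcomp Require Import ring lra.

Set Implicit Arguments.
Unset Strict Implicit.
Unset Printing Implicit Defensive.

Import Order.TTheory GRing.Theory Num.Theory.
Import numFieldNormedType.Exports.

Local Open Scope classical_set_scope.
Local Open Scope ring_scope.

(* Write a vector field as E = X + f U - mu with X horizontal; then f = g(U, E),
   and X = E + mu - f U is a vector field because mu^flat = i_U d(theta). The
   theorem is the identity
     Ricci + L_E g / 2 + A g = right-hand side for (f, X, A),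
   which is local. Near a point, let f1, f2 be an orthonormal frame of the base
   and e1, e2 its horizontal lift rescaled by lambda. Then, with l = ln lambda
   and [f1, f2] = a f1 + b f2, fibrewise constancy of a and b yields
     [e1, e2] = (lambda a - e2(l)) e1 + (lambda b + e1(l)) e2 + 2v U,
     [U, ek] = U(l) ek - g(mu, ek) U,    |I|^2 = 8 v^2,
     K^N = f1(b) - f2(a) - a^2 - b^2,
   so that Koszul's formula and the Jacobi identity reduce both sides to
   polynomials in derivatives of lambda, a, b, v and the components of mu.
   Functions smooth on a chart domain form a commutative ring with commuting
   derivations, over which all these computations are purely algebraic. *)

(** * Calculus in several real variables *)

(** The notions are defined pointwise from chart expressions that mean something only on a chart
    domain, and tensors are evaluated by extending vectors with constant components. Each notion is
    shown once to be the evaluation of an expression over the ring of smooth functions; equality in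
    that ring is equality on the whole domain, so identities can be differentiated again. The ring
    has zero divisors, hence nothing is cancelled without an inverse at hand: [half], the inverse of
    [lam] and the roots in Gram-Schmidt are elements of the ring. Two regularity facts must be
    derived. Smoothness speaks only of iterated partial derivatives, so the chain rule and the
    symmetry of second derivatives are drawn from their continuity. And [lambda] comes as a bare
    positive function; its square is found as an entry of the product of J^T g^-1 J and h, with J
    the differential of [phi]. The field [mu] is written with the Christoffel symbols of one chart,
    so its transformation law needs a proof: exterior derivatives commute with coordinate changes,
    Christoffel symbols do not. *)

Section Calculus.
Variable R : realType.

(** Both difference quotients are the same function of [h], so no chain rule is involved. *)
Lemma is_derive_line (V W : normedModType R) (F : V -> W) (v e : V) (t : R) :
  derivable F (t *: e + v) e ->
  is_derive t (1 : R) (fun s : R => F (s *: e + v)) ('D_e F (t *: e + v)).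
Proof.
move=> dF.
have E : (fun h : R => h^-1 *: (F (h *: e + (t *: e + v)) - F (t *: e + v))) =
  (fun h : R => h^-1 *: (((fun s : R => F (s *: e + v)) \o shift t) (h *: 1)
             - F (t *: e + v))).
  by apply: funext => h /=; rewrite [h *: 1]mulr1 scalerDl addrA.
by apply: DeriveDef; [move: dF; rewrite /derivable /= E | rewrite /derive /= E].
Qed.

(** The bounds use absolute values so that increments of either sign, and zero, are covered at once;
    coordinates of a vector will serve as [h]. *)
Lemma mvt_line (V : normedModType R) (F : V -> R) (v e : V) (h : R) :
  (forall t, `|t| <= `|h| -> derivable F (t *: e + v) e) ->
  exists2 c, `|c| <= `|h| &
    F (h *: e + v) - F v = h * 'D_e F (c *: e + v).
Proof.
move=> dF; pose g (s : R) := F (s *: e + v).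
have dg t : `|t| <= `|h| -> is_derive t (1 : R) g ('D_e F (t *: e + v)).
  by move=> /dF /is_derive_line.
have [h0|h0|->] := ltgtP h 0.
- have bnd x : x \in `[h, 0] -> `|x| <= `|h|.
    rewrite in_itv /= => /andP[hx x0].
    by rewrite (ltr0_norm h0) (ler0_norm x0) lerN2.
  have [c cI E] := @MVT R g (fun t => 'D_e F (t *: e + v)) h 0 h0
    (fun x xI => dg x (bnd _ (subset_itv_oo_cc xI)))
    (derivable_within_continuous (fun x xI => @ex_derive _ _ _ _ _ _ _ (dg x (bnd _ xI)))).
  exists c; first exact/bnd/subset_itv_oo_cc.
  move: E; rewrite /g scale0r add0r sub0r => /eqP.
  by rewrite subr_eq => /eqP ->; ring.
- have bnd x : x \in `[0, h] -> `|x| <= `|h|.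
    rewrite in_itv /= => /andP[x0 hx].
    by rewrite (gtr0_norm h0) (ger0_norm x0).
  have [c cI E] := @MVT R g (fun t => 'D_e F (t *: e + v)) 0 h h0
    (fun x xI => dg x (bnd _ (subset_itv_oo_cc xI)))
    (derivable_within_continuous (fun x xI => @ex_derive _ _ _ _ _ _ _ (dg x (bnd _ xI)))).
  exists c; first exact/bnd/subset_itv_oo_cc.
  move: E; rewrite /g scale0r add0r subr0 => ->; ring.
- by exists 0; rewrite ?normr0// scale0r add0r subrr mul0r.
Qed.

End Calculus.

(** * Differentiability from continuous partial derivatives *)

Section Partial.
Variables (R : realType) (n : nat).
Implicit Types (F : 'rV[R]_n -> R) (u v : 'rV[R]_n).
Local Notation e_ k := (delta_mx 0 k : 'rV[R]_n).

Lemma coord_le_norm u k : `|u 0 k| <= `|u|.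
Proof.
rewrite [leRHS]/Num.Def.normr/= mx_normrE.
exact: (le_bigmax _ (fun i : 'I_1 * 'I_n => `|u i.1 i.2|) (ord0, k)).
Qed.

Lemma norm_le_coord u (c : R) : 0 <= c -> (forall k, `|u 0 k| <= c) -> `|u| <= c.
Proof.
move=> c0 uc; rewrite [leLHS]/Num.Def.normr/= mx_normrE.
by apply: bigmax_le => // -[i k] _ /=; rewrite ord1.
Qed.

(** The vectors [truncate k u] are the corners of a path from 0 to [u] that changes one coordinate
    at a time. *)
Definition truncate (k : nat) u : 'rV[R]_n :=
  \row_j (if (j < k)%N then u 0 j else 0).

Lemma truncate0 u : truncate 0 u = 0.
Proof. by apply/rowP => j; rewrite !mxE. Qed.

Lemma truncate_full u : truncate n u = u.
Proof. by apply/rowP => j; rewrite !mxE ltn_ord. Qed.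

Lemma truncateS (k : 'I_n) u : truncate k.+1 u = u 0 k *: e_ k + truncate k u.
Proof.
apply/rowP => j; rewrite !mxE eqxx /= ltnS leq_eqVlt.
have [->|jk] := eqVneq j k; first by rewrite eqxx ltnn mulr1 addr0.
by rewrite (inj_eq val_inj) (negPf jk) /= mulr0 add0r.
Qed.

Lemma norm_truncate_line (k : 'I_n) u (t : R) : `|t| <= `|u| ->
  `|t *: e_ k + truncate k u| <= `|u|.
Proof.
move=> tu; apply: norm_le_coord => // j; rewrite !mxE eqxx /=.
have [->|jk] := eqVneq j k; first by rewrite ltnn addr0 mulr1.
by rewrite mulr0 add0r; case: ifP => _; rewrite ?normr0// coord_le_norm.
Qed.

Definition gradient F v u : R := \sum_k u 0 k * 'D_(e_ k) F v.

Lemma gradient_linear F v : linear (gradient F v).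
Proof.
move=> a x y; rewrite /gradient scaler_sumr -big_split /=.
by apply: eq_bigr => k _; rewrite !mxE mulrDl -mulrA.
Qed.
HB.instance Definition _ F v :=
  GRing.isLinear.Build R 'rV[R]_n R *:%R (gradient F v) (gradient_linear F v).

Lemma gradient_continuous F v : continuous (gradient F v).
Proof.
move=> x; rewrite /gradient; apply: (@cvg_big _ _ _ _ _ _ _ (nbhs x)) => [|k _]; first exact: add_continuous.
by apply: cvgM; [exact: coord_continuous|exact: cvg_cst].
Qed.

(** The increment of [F] telescopes along the corners [truncate k u]. On each edge the mean value
    theorem replaces it by a partial derivative at a point no farther from [v] than [u] is long, and
    continuity compares that with the value at [v]. *)
Lemma continuous_partials_diff F v :
  (\forall w \near v, forall k : 'I_n, derivable F w (e_ k)) ->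
  (forall k : 'I_n, {for v, continuous ('D_(e_ k) F)}) ->
  differentiable F v /\ forall u, 'D_u F v = gradient F v u.
Proof.
move=> dF cF.
have E : (F \o shift v : 'rV[R]_n -> R) =
      (cst (F v) + gradient F v : 'rV[R]_n -> R) +o_ (0 : 'rV[R]_n) id.
  apply/eqaddoP => eps eps0.
  (* The [n] edges contribute at most [d * |u|] each; [n.+1] keeps the quotient meaningful for
     [n = 0]. *)
  pose d := eps / n.+1%:R.
  have d0 : 0 < d by rewrite divr_gt0.
  have cF' : \forall w \near v, forall k : 'I_n, `|'D_(e_ k) F v - 'D_(e_ k) F w| <= d.
    apply: (@filter_forall _ 'I_n (fun k w =>
      `|'D_(e_ k) F v - 'D_(e_ k) F w| <= d) (nbhs v)) => k.
    by have /cvgrPdist_le/(_ _ d0) := cF k.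
  have [r /= r0 rP] := (nbhs_ballP _ _).1 (filterI dF cF').
  apply/nbhs_ballP; exists r => //= u; rewrite -ball_normE /= sub0r normrN => ur.
  have inb w : `|w| <= `|u| -> (forall k : 'I_n, derivable F (w + v) (e_ k)) /\
      forall k : 'I_n, `|'D_(e_ k) F v - 'D_(e_ k) F (w + v)| <= d.
    move=> wu; apply: rP; rewrite -ball_normE /= opprD addrCA subrr addr0 normrN.
    exact: le_lt_trans ur.
  have step (k : 'I_n) : `|F (truncate k.+1 u + v) - F (truncate k u + v)
      - u 0 k * 'D_(e_ k) F v| <= d * `|u|.
    have [|c cu Ec] := @mvt_line R _ F (truncate k u + v) (e_ k) (u 0 k).
      move=> t tk; rewrite addrA; apply: (inb _ _).1.
      by apply: norm_truncate_line; rewrite (le_trans tk)// coord_le_norm.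
    rewrite truncateS -[_ + truncate k u + v]addrA Ec -mulrBr normrM mulrC ler_pM// ?coord_le_norm//.
    rewrite distrC addrA; apply: (inb _ _).2.
    by apply: norm_truncate_line; rewrite (le_trans cu)// coord_le_norm.
  have tele : F (u + v) - F v =
      \sum_(k < n) (F (truncate k.+1 u + v) - F (truncate k u + v)).
    rewrite -(big_mkord xpredT (fun k => F (truncate k.+1 u + v) - F (truncate k u + v))).
    by rewrite telescope_sumr// truncate_full truncate0 add0r.
  rewrite [X in `|X|](_ : _ = \sum_(k < n) (F (truncate k.+1 u + v)
     - F (truncate k u + v) - u 0 k * 'D_(e_ k) F v)); last first.
    rewrite sumrB -tele /=.
    rewrite -[LHS]/(F (u + v) - (F v + gradient F v u)) /gradient; ring.
  apply: (le_trans (ler_norm_sum _ _ _)).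
  apply: (@le_trans _ _ (\sum_(k < n) d * `|u|)); first exact: ler_sum.
  rewrite sumr_const card_ord -mulr_natl mulrA ler_wpM2r//.
  by rewrite /d mulrCA ger_pMr// ler_pdivrMr// mul1r ler_nat.
have D := diff_unique (@gradient_continuous F v) E.
have dFv : differentiable F v.
  by apply/diff_locallyP; rewrite D; split; [exact: gradient_continuous|].
by split=> // u; rewrite deriveE// D.
Qed.

End Partial.

(** * Symmetry of second derivatives *)

Section Schwarz.
Variables (R : realType) (V : normedModType R).
Implicit Types (F : V -> R) (a b v w : V).

Lemma is_derive_shift_arg F a c w : derivable F (w + c) a ->
  is_derive w a (fun u => F (u + c)) ('D_a F (w + c)).
Proof.
move=> dF.
have E : (fun h : R => h^-1 *: (F (h *: a + (w + c)) - F (w + c))) =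
  (fun h : R => h^-1 *: (((fun u => F (u + c)) \o shift w) (h *: a) - F (w + c))).
  by apply: funext => h /=; rewrite addrA.
by apply: DeriveDef; [move: dF; rewrite /derivable /= E | rewrite /derive /= E].
Qed.

(** The mean value theorem is applied to [u |-> F (u + t *: b) - F u] along [a], then to ['D_a F]
    along [b]. *)
Lemma double_difference F v a b (t : R) :
  (forall w, `|w| <= `|t| * (`|a| + `|b|) ->
     derivable F (w + v) a /\ derivable ('D_a F) (w + v) b) ->
  exists2 w, `|w| <= `|t| * (`|a| + `|b|) &
    F (t *: a + v + t *: b) - F (t *: a + v) - (F (v + t *: b) - F v) =
    t * (t * 'D_b ('D_a F) (w + v)).
Proof.
move=> dF.
have bnd (x y : R) : `|x| <= `|t| -> `|y| <= `|t| ->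
    `|y *: b + x *: a| <= `|t| * (`|a| + `|b|).
  move=> xt yt; rewrite (le_trans (ler_normD _ _))// !normrZ mulrDr addrC.
  by rewrite lerD// ler_wpM2r.
have dG (x : R) : `|x| <= `|t| -> is_derive (x *: a + v) a
    (fun u => F (u + t *: b) - F u)
    ('D_a F (x *: a + v + t *: b) - 'D_a F (x *: a + v)).
  move=> xt.
  have D1 : derivable F (x *: a + v + t *: b) a.
    by rewrite addrAC [_ *: a + _]addrC; apply: (dF _ _).1; exact: bnd.
  have D2 : derivable F (x *: a + v) a.
    rewrite -[x *: a]add0r -(scale0r b); apply: (dF _ _).1.
    by apply: bnd; rewrite // normr0.
  exact: is_deriveB (is_derive_shift_arg D1) (derivableP D2).
have [c ct Ec] := mvt_line (fun x xt => @ex_derive _ _ _ _ _ _ _ (dG x xt)).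
have [|d dt Ed] := @mvt_line _ _ ('D_a F) (c *: a + v) b t.
  by move=> y yt; rewrite addrA; apply: (dF _ _).2; exact: bnd.
exists (d *: b + c *: a); first exact: bnd.
rewrite Ec (@derive_val _ _ _ _ _ _ _ (dG c ct)).
by rewrite -[d *: b + c *: a + v]addrA -Ed [c *: a + v + t *: b]addrC.
Qed.

(** The second difference is symmetric in [a] and [b], so the two mixed derivatives coincide at two
    points close to [v]; continuity at [v] does the rest. *)
Lemma schwarz F v a b :
  (\forall w \near v, [/\ derivable F w a, derivable F w b,
     derivable ('D_a F) w b & derivable ('D_b F) w a]) ->
  {for v, continuous ('D_b ('D_a F))} -> {for v, continuous ('D_a ('D_b F))} ->
  'D_b ('D_a F) v = 'D_a ('D_b F) v.
Proof.
move=> dF cba cab; apply/eqP; rewrite -subr_eq0 -normr_le0.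
apply/ler_addgt0Pl => eps eps0; rewrite addr0.
have e20 : 0 < eps / 2 by rewrite divr_gt0.
have /cvgrPdist_le/(_ _ e20) nba := cba.
have /cvgrPdist_le/(_ _ e20) nab := cab.
have [r /= r0 rP] := (nbhs_ballP _ _).1 (filterI dF (filterI nba nab)).
pose s := `|a| + `|b|; have s0 : 0 <= s by rewrite addr_ge0.
(* Small enough that the whole parallelogram stays in the ball of radius [r]; adding 1 avoids a
   division by 0 when [a] and [b] vanish. *)
pose t := r / (s + 1) / 2.
have t0 : 0 < t by rewrite !divr_gt0// ltr_wpDl.
have tsr : `|t| * s < r.
  have E : t * (s + 1) = r / 2 by rewrite /t mulrAC divfK// gt_eqF// ltr_wpDl.
  rewrite gtr0_norm // (@le_lt_trans _ _ (t * (s + 1)))//.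
    by rewrite ler_pM2l// lerDl.
  by rewrite E ltr_pdivrMr// ltr_pMr// ltr1n.
have inr w : `|w| <= `|t| * s -> ball v r (w + v).
  move=> ws; rewrite -ball_normE /= opprD addrCA subrr addr0 normrN.
  exact: le_lt_trans tsr.
have [|w1 w1s E1] := @double_difference F v a b t.
  by move=> w /inr/rP[[]].
have [|w2 w2s E2] := @double_difference F v b a t.
  by rewrite [`|b| + _]addrC => w /inr/rP[[]].
have E : 'D_b ('D_a F) (w1 + v) = 'D_a ('D_b F) (w2 + v).
  apply: (mulfI (lt0r_neq0 t0)); apply: (mulfI (lt0r_neq0 t0)).
  apply: (etrans (esym E1)); apply: etrans E2.
  rewrite [t *: b + v]addrC [t *: a + v]addrC [v + t *: b + t *: a]addrAC.
  ring.
have [_ [H1 _]] := rP _ (inr _ w1s).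
rewrite [`|b| + _]addrC in w2s; have [_ [_ H2]] := rP _ (inr _ w2s).
rewrite (splitr eps); apply: le_trans (ler_distD ('D_b ('D_a F) (w1 + v)) _ _) _.
by apply: lerD; [exact: H1|rewrite E distrC; exact: H2].
Qed.

End Schwarz.

Section Chain.
Variable R : realType.

(** Only a directional derivative of [G] is available. Restricting to the line through [x] makes the
    inner map a function of one real variable, for which derivable and differentiable agree, and the
    usual chain rule applies. *)
Lemma is_derive_comp_diff (V W : normedModType R) (G : V -> W) (F : W -> R) x v :
  derivable G x v -> differentiable F (G x) ->
  is_derive x v (F \o G) ('d F (G x) ('D_v G x)).
Proof.
move=> dG dF.
have x0 : x = 0 *: v + x by rewrite scale0r add0r.
have [dg Dg] : is_derive (0 : R) (1 : R) (fun t : R => G (t *: v + x)) ('D_v G x).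
  by rewrite {2}x0; apply: is_derive_line; rewrite -x0.
have dg' := (derivable1_diffP _ _).1 dg.
have dF0 : differentiable F (G (0 *: v + x)) by rewrite -x0.
have dFg : differentiable (F \o (fun t : R => G (t *: v + x))) 0.
  exact: differentiable_comp.
have E : (fun h : R => h^-1 *: ((F \o G) (h *: v + x) - (F \o G) x)) =
   (fun h : R => h^-1 *: (((F \o (fun t : R => G (t *: v + x))) \o shift 0) (h *: 1)
      - (F \o (fun t : R => G (t *: v + x))) 0)).
  by apply: funext => h /=; rewrite addr0 [h *: 1]mulr1 -x0.
have dd : derivable (F \o (fun t : R => G (t *: v + x))) 0 (1 : R).
  exact: diff_derivable.
apply: DeriveDef; first by move: dd; rewrite /derivable /= -E.
rewrite -[LHS]/(lim ((fun h : R => h^-1 *: ((F \o G) (h *: v + x) - (F \o G) x)) @ 0^')).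
rewrite E -[LHS]/('D_1 (F \o (fun t : R => G (t *: v + x))) 0).
rewrite deriveE // diff_comp //= -[X in 'd _ _ X = _]deriveE //.
by rewrite Dg -x0.
Qed.

End Chain.

(** * Smooth functions in a chart *)

(** A chart whose domain may have been cut down by an open set. [linv_near] is the form in which
    openness of the image is used: derivatives at [lmap p] see only values on the domain. *)
Record local_chart (R : realType) (n : nat) (T : topologicalType) := LocalChart {
  lmap : T -> 'rV[R]_n;
  linv : 'rV[R]_n -> T;
  ldom : set T;
  ldom_open : open ldom;
  lmapK : forall p, ldom p -> linv (lmap p) = p;
  linv_near : forall p, ldom p ->
    \forall v \near lmap p, ldom (linv v) /\ lmap (linv v) = v;
  lmap_continuous : forall p, ldom p -> {for p, continuous lmap};
  linv_continuous : forall p, ldom p -> {for lmap p, continuous linv} }.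

Section LocalChart.
Variables (R : realType) (n : nat) (T : topologicalType) (c : local_chart R n T).
Implicit Types (f g : T -> R) (p : T).
Local Notation D := (ldom c).
Local Notation e_ k := (delta_mx 0 k : 'rV[R]_n).
Local Notation pdl k f := (pderiv (lmap c) (linv c) k f).
Local Notation smoothl f := (smooth_coord (lmap c) (linv c) D f).

Definition pderivable (k : 'I_n) f p : Prop :=
  derivable (f \o linv c) (lmap c p) (e_ k).

Lemma near_ldom p : D p -> \forall q \near p, D q.
Proof. by move=> Dp; apply: open_nbhs_nbhs; split => //; exact: ldom_open. Qed.

Lemma near_comp_linv f g p : D p -> (forall q, D q -> f q = g q) ->
  \forall v \near lmap c p, (f \o linv c) v = (g \o linv c) v.
Proof.
by move=> Dp fg; apply: filterS (linv_near Dp) => v [Dv _]; exact: fg.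
Qed.

Lemma continuous_on_eq f g p : D p -> (forall q, D q -> f q = g q) ->
  {for p, continuous f} -> {for p, continuous g}.
Proof.
move=> Dp fg cf; rewrite /prop_for /continuous_at -fg //.
apply: cvg_trans cf; apply: near_eq_cvg.
by apply: filterS (near_ldom Dp) => q /fg.
Qed.

Lemma pderivable_on_eq k f g p : D p -> (forall q, D q -> f q = g q) ->
  pderivable k f p -> pderivable k g p.
Proof. by move=> Dp fg; apply: near_eq_derivable; exact: near_comp_linv. Qed.

Lemma pderiv_on_eq k f g p : D p -> (forall q, D q -> f q = g q) ->
  pdl k f p = pdl k g p.
Proof. by move=> Dp fg; apply: near_eq_derive; exact: near_comp_linv. Qed.

(** Class C^m on the domain. The recursion strips the innermost derivative and so supports
    inductions on the order that apply to all functions at once. *)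
Fixpoint Cn (m : nat) f : Prop :=
  (forall p, D p -> {for p, continuous f}) /\
  if m is m'.+1 then
    (forall k p, D p -> pderivable k f p) /\ forall k, Cn m' (pdl k f)
  else True.

Lemma Cn_continuous m f p : Cn m f -> D p -> {for p, continuous f}.
Proof. by case: m => [|m] [cf _]; exact: cf. Qed.

Lemma CnS_le m f : Cn m.+1 f -> Cn m f.
Proof.
elim: m f => [|m IH] f [cf [df pf]]; split => //.
by split=> // k; apply: IH.
Qed.

Lemma Cn_on_eq m f g : (forall q, D q -> f q = g q) -> Cn m f -> Cn m g.
Proof.
elim: m f g => [|m IH] f g fg [cf H]; (split; first by
  move=> p Dp; apply: continuous_on_eq (cf _ Dp)) => //.
case: H => df pf; split; first by move=> k p Dp; apply: pderivable_on_eq (df k p Dp).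
by move=> k; apply: IH (pf k) => q Dq; exact: pderiv_on_eq.
Qed.

Lemma smooth_coord_pderiv k f : smoothl f -> smoothl (pdl k f).
Proof. by move=> sf w p Dp; have := sf (rcons w k) p Dp; rewrite foldr_rcons. Qed.

(** [foldr] applies the last letter of the word first; induction from the end of the word therefore
    matches the recursion of [Cn]. *)
Lemma smooth_coordP f : smoothl f <-> forall m, Cn m f.
Proof.
split=> [sf m|].
  elim: m f sf => [|m IH] f sf; (split; first by move=> p /(sf [::])[]) => //.
  split; first by move=> k p /(sf [::])[_]; exact.
  by move=> k; apply: IH; exact: smooth_coord_pderiv.
move=> sf w; elim/last_ind: w f sf => [|w k IH] f sf p Dp /=.
  by have [cf [df _]] := sf 1%N; split=> [|k]; [exact: cf|exact: df].
by rewrite foldr_rcons; apply: IH => // m; have [_ [_]] := sf m.+1; exact.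
Qed.

Lemma smooth_continuous f p : smoothl f -> D p -> {for p, continuous f}.
Proof. by move=> sf /(sf [::])[]. Qed.

Lemma smooth_pderivable k f p : smoothl f -> D p -> pderivable k f p.
Proof. by move=> sf /(sf [::])[_]; exact. Qed.

Lemma smooth_on_eq f g : (forall q, D q -> f q = g q) -> smoothl f -> smoothl g.
Proof. by move=> fg /smooth_coordP sf; apply/smooth_coordP => m; exact: Cn_on_eq (sf m). Qed.

Lemma pderivable_cst k (a : R) p : pderivable k (cst a) p.
Proof. exact: derivable_cst. Qed.

Lemma pderiv_cst k (a : R) p : pdl k (cst a) p = 0.
Proof. exact: derive_cst. Qed.

Lemma Cn_cst m (a : R) : Cn m (cst a).
Proof.
elim: m a => [|m IH] a; (split; first by move=> p _; exact: cvg_cst) => //.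
split; first by move=> k p _; exact: pderivable_cst.
by move=> k; apply: (Cn_on_eq _ (IH 0)) => q _; rewrite pderiv_cst.
Qed.

Section Rules.
Variables (k : 'I_n) (f g : T -> R) (p : T).
Hypotheses (df : pderivable k f p) (dg : pderivable k g p).

Lemma pderivableD : pderivable k (fun q => f q + g q) p.
Proof. exact: (derivableD df dg). Qed.

Lemma pderivD : pdl k (fun q => f q + g q) p = pdl k f p + pdl k g p.
Proof. exact: (deriveD df dg). Qed.

Lemma pderivableN : pderivable k (fun q => - f q) p.
Proof. exact: (derivableN df). Qed.

Lemma pderivN : pdl k (fun q => - f q) p = - pdl k f p.
Proof. exact: (deriveN df). Qed.

Lemma pderivableM : pderivable k (fun q => f q * g q) p.
Proof. exact: (derivableM df dg). Qed.

Lemma pderivM : D p ->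
  pdl k (fun q => f q * g q) p = pdl k f p * g p + f p * pdl k g p.
Proof.
move=> Dp; have := deriveM df dg; rewrite /= !(lmapK Dp) => E.
by rewrite [LHS]E addrC [g p *: _]mulrC.
Qed.

Lemma is_pderive_comp (F : R -> R) (dF : R) : D p ->
  is_derive (f p) (1 : R) F dF ->
  is_derive (lmap c p) (e_ k) (F \o f \o linv c) (dF * pdl k f p).
Proof.
move=> Dp [dFp <-].
have dF1 : differentiable F ((f \o linv c) (lmap c p)).
  by apply/derivable1_diffP; rewrite /= lmapK.
have [H1 H2] := is_derive_comp_diff df dF1.
apply: DeriveDef; first exact: H1.
rewrite -[F \o f \o linv c]/(F \o (f \o linv c)) H2.
set z := (f \o linv c) (lmap c p) in dF1 *; set y := 'D__ (f \o _) _.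
have -> : f p = z by rewrite /z /= lmapK.
rewrite (@deriveE _ _ _ F z 1 dF1) -[y in LHS]mulr1 [RHS]mulrC.
by rewrite -[y * 1]/(y *: (1 : R)) linearZ.
Qed.

End Rules.

End LocalChart.

(** * Closure properties of smooth functions *)

Section SmoothClosure.
Variables (R : realType) (n : nat) (T : topologicalType) (c : local_chart R n T).
Implicit Types (f g : T -> R) (p : T).
Local Notation D := (ldom c).
Local Notation e_ k := (delta_mx 0 k : 'rV[R]_n).
Local Notation pdl k f := (pderiv (lmap c) (linv c) k f).
Local Notation smoothl f := (smooth_coord (lmap c) (linv c) D f).

Lemma CnD m f g : Cn c m f -> Cn c m g -> Cn c m (fun q => f q + g q).
Proof.
elim: m f g => [|m IH] f g [cf Hf] [cg Hg];
  (split; first by move=> p Dp; exact: cvgD (cf p Dp) (cg p Dp)) => //.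
case: Hf Hg => df pf [dg pg]; split.
  by move=> k p Dp; apply: pderivableD; [exact: df|exact: dg].
move=> k; apply: (Cn_on_eq _ (IH _ _ (pf k) (pg k))) => q Dq.
by rewrite pderivD //; [exact: df|exact: dg].
Qed.

Lemma CnN m f : Cn c m f -> Cn c m (fun q => - f q).
Proof.
elim: m f => [|m IH] f [cf Hf];
  (split; first by move=> p Dp; exact: cvgN (cf p Dp)) => //.
case: Hf => df pf; split.
  by move=> k p Dp; apply: pderivableN; exact: df.
move=> k; apply: (Cn_on_eq _ (IH _ (pf k))) => q Dq.
by rewrite pderivN //; exact: df.
Qed.

Lemma CnM m f g : Cn c m f -> Cn c m g -> Cn c m (fun q => f q * g q).
Proof.
elim: m f g => [|m IH] f g Cf Cg.
  by case: Cf Cg => cf _ [cg _]; split => // p Dp; exact: cvgM (cf p Dp) (cg p Dp).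
have [[cf [df pf]] [cg [dg pg]]] := (Cf, Cg).
split; first by move=> p Dp; exact: cvgM (cf p Dp) (cg p Dp).
split; first by move=> k p Dp; apply: pderivableM; [exact: df|exact: dg].
move=> k; apply: (Cn_on_eq _ (CnD (IH _ _ (pf k) (CnS_le Cg))
  (IH _ _ (CnS_le Cf) (pg k)))) => q Dq.
by rewrite pderivM //; [exact: df|exact: dg].
Qed.

(* The derivative of [F] at [f] is only required to be as smooth as [F \o f],
   so that it may be an expression in [F \o f] itself. *)
Lemma Cn_comp_real (F F' : R -> R) m f : Cn c m f ->
  (forall p, D p -> is_derive (f p) (1 : R) F (F' (f p))) ->
  (forall l, Cn c l (F \o f) -> Cn c l (F' \o f)) ->
  Cn c m (F \o f).
Proof.
move=> + dF HF; elim: m => [|m IH] Cf.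
  split=> // p Dp; apply: continuous_comp; first exact: (Cn_continuous Cf).
  apply: differentiable_continuous; apply/derivable1_diffP.
  by have := dF p Dp; case.
have Cm := IH (CnS_le Cf).
have [_ [df pf]] := Cf.
have dd k p : D p -> is_derive (lmap c p) (e_ k) (F \o f \o linv c)
    (F' (f p) * pdl k f p).
  by move=> Dp; apply: is_pderive_comp => //; [exact: df|exact: dF].
split; first by move=> p Dp; exact: (Cn_continuous Cm).
split=> [k p Dp|k]; first by have := dd k p Dp; case.
apply: (Cn_on_eq _ (CnM (HF _ Cm) (pf k))) => q Dq.
by rewrite /pderiv (@derive_val _ _ _ _ _ _ _ (dd k q Dq)).
Qed.

Lemma CnV m f : Cn c m f -> (forall p, D p -> f p != 0) ->
  Cn c m (fun q => (f q)^-1).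
Proof.
move=> sf f0; apply: (@Cn_comp_real (fun x => x^-1) (fun x => - (x^-1 * x^-1))) => //.
  move=> p Dp; apply: DeriveDef.
    by apply: (@derivableV _ _ id); [exact: f0|exact: derivable_id].
  have := @deriveV _ _ id (f p) 1 (f0 p Dp) (@derivable_id _ _ _ _).
  by rewrite derive_id expr2 invfM [_ *: _]mulr1.
by move=> l H; exact: CnN (CnM H H).
Qed.

Lemma Cn_sqrt m f : Cn c m f -> (forall p, D p -> 0 < f p) ->
  Cn c m (fun q => Num.sqrt (f q)).
Proof.
move=> sf f0.
apply: (@Cn_comp_real (@Num.sqrt R) (fun x => (2 * Num.sqrt x)^-1)) => //.
  by move=> p Dp; apply: is_derive1_sqrt; exact: f0.
move=> l H; apply: CnV; first exact: (CnM (Cn_cst c l 2) H).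
by move=> p Dp; rewrite mulf_neq0 ?pnatr_eq0// gt_eqF// sqrtr_gt0 f0.
Qed.

Lemma smooth_cst a : smoothl (cst a).
Proof. by apply/smooth_coordP => m; exact: Cn_cst. Qed.

Lemma smoothD f g : smoothl f -> smoothl g -> smoothl (fun q => f q + g q).
Proof. by move=> /smooth_coordP sf /smooth_coordP sg; apply/smooth_coordP => m; exact: CnD. Qed.

Lemma smoothN f : smoothl f -> smoothl (fun q => - f q).
Proof. by move=> /smooth_coordP sf; apply/smooth_coordP => m; exact: CnN. Qed.

Lemma smoothM f g : smoothl f -> smoothl g -> smoothl (fun q => f q * g q).
Proof. by move=> /smooth_coordP sf /smooth_coordP sg; apply/smooth_coordP => m; exact: CnM. Qed.

Lemma smoothV f : smoothl f -> (forall p, D p -> f p != 0) ->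
  smoothl (fun q => (f q)^-1).
Proof. by move=> /smooth_coordP sf f0; apply/smooth_coordP => m; exact: CnV. Qed.

Lemma smooth_sqrt f : smoothl f -> (forall p, D p -> 0 < f p) ->
  smoothl (fun q => Num.sqrt (f q)).
Proof. by move=> /smooth_coordP sf f0; apply/smooth_coordP => m; exact: Cn_sqrt. Qed.

Lemma smooth_ln f : smoothl f -> (forall p, D p -> 0 < f p) ->
  smoothl (fun q => ln (f q)).
Proof.
move=> sf f0; apply/smooth_coordP => m.
apply: (@Cn_comp_real (@ln R) (fun x => x^-1)).
- by move/smooth_coordP: sf; exact.
- by move=> p Dp; apply: is_derive1_ln; exact: f0.
- move=> l _; apply: CnV; first by move/smooth_coordP: sf; exact.
  by move=> p Dp; rewrite gt_eqF// f0.
Qed.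

Lemma pderiv_ln k f p : smoothl f -> D p -> 0 < f p ->
  pdl k (fun q => ln (f q)) p = (f p)^-1 * pdl k f p.
Proof.
move=> sf Dp f0.
have H := @is_pderive_comp _ _ _ c k f p (smooth_pderivable sf Dp) _ _ Dp (is_derive1_ln f0).
exact: derive_val.
Qed.

Lemma near_pderiv k f p : D p ->
  \forall w \near lmap c p, (pdl k f \o linv c) w = 'D_(e_ k) (f \o linv c) w.
Proof. by move=> Dp; apply: filterS (linv_near Dp) => v [_ xv]; rewrite /= /pderiv xv. Qed.

Lemma near_derivable_linv f p : smoothl f -> D p ->
  \forall w \near lmap c p, forall k : 'I_n, derivable (f \o linv c) w (e_ k).
Proof.
move=> sf Dp; apply: filterS (linv_near Dp) => w [Dw xw] k.
by have := smooth_pderivable (k := k) sf Dw; rewrite /pderivable xw.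
Qed.

Lemma continuous_comp_linv f p : D p -> {for p, continuous f} ->
  {for lmap c p, continuous (f \o linv c)}.
Proof.
move=> Dp cf; apply: continuous_comp; first exact: linv_continuous.
by rewrite lmapK.
Qed.

Lemma continuous_partial_linv k f p : smoothl f -> D p ->
  {for lmap c p, continuous ('D_(e_ k) (f \o linv c))}.
Proof.
move=> sf Dp.
have cf := continuous_comp_linv Dp (smooth_continuous (smooth_coord_pderiv k sf) Dp).
have nE := near_pderiv k f Dp.
rewrite /prop_for /continuous_at -(nbhs_singleton nE).
by apply: cvg_trans cf; exact: near_eq_cvg nE.
Qed.

Lemma near_partial2 k l f p : D p ->
  \forall w \near lmap c p,
    'D_(e_ l) (pdl k f \o linv c) w = 'D_(e_ l) ('D_(e_ k) (f \o linv c)) w.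
Proof.
move=> Dp; apply: filterS (linv_near Dp) => w [Dw xw].
by apply: near_eq_derive; rewrite -xw; exact: near_pderiv.
Qed.

(** [schwarz] read through the chart. A partial derivative carried to the coordinate space is the
    derivative of [f \o linv c] only near [lmap c p], hence the preceding lemmas on
    neighbourhoods. *)
Lemma pderivC k l f p : smoothl f -> D p ->
  pdl k (pdl l f) p = pdl l (pdl k f) p.
Proof.
move=> sf Dp.
have E i j : pdl j (pdl i f) p = 'D_(e_ j) ('D_(e_ i) (f \o linv c)) (lmap c p).
  exact: nbhs_singleton (near_partial2 i j f Dp).
rewrite !E.
have cont i j : {for lmap c p, continuous ('D_(e_ j) ('D_(e_ i) (f \o linv c)))}.
  have cf := continuous_partial_linv (k := j) (smooth_coord_pderiv i sf) Dp.
  have nE := near_partial2 i j f Dp.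
  rewrite /prop_for /continuous_at -(nbhs_singleton nE).
  by apply: cvg_trans cf; exact: near_eq_cvg nE.
apply: schwarz; [|exact: cont|exact: cont].
apply: filterS (linv_near Dp) => w [Dw xw].
have d2 i j : derivable ('D_(e_ i) (f \o linv c)) w (e_ j).
  apply: near_eq_derivable.
    by have := near_pderiv i f Dw; rewrite xw; exact.
  by have := smooth_pderivable (k := j) (smooth_coord_pderiv i sf) Dw; rewrite /pderivable xw.
have d1 i : derivable (f \o linv c) w (e_ i).
  by have := smooth_pderivable (k := i) sf Dw; rewrite /pderivable xw.
by split; [exact: d1|exact: d1|exact: d2|exact: d2].
Qed.

End SmoothClosure.

(** * Pull-back along a smooth map *)

Section Pullback.
Variables (R : realType) (m n : nat) (T T' : topologicalType).
Variables (c : local_chart R m T) (c' : local_chart R n T') (phi : T -> T').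
Hypothesis phi_dom : forall p, ldom c p -> ldom c' (phi p).
Hypothesis phi_continuous : forall p, ldom c p -> {for p, continuous phi}.
Local Notation comp b := (fun q => lmap c' (phi q) 0 b).
Hypothesis phi_smooth : forall b,
  smooth_coord (lmap c) (linv c) (ldom c) (comp b).

(** [f] read in its chart is truly differentiable by [continuous_partials_diff], while the
    coordinate expression of [phi] only has to be derivable along one axis. The two composites agree
    just near [lmap c p], where [linv c'] undoes [lmap c']. *)
Lemma is_pderive_pullback a f p :
  smooth_coord (lmap c') (linv c') (ldom c') f -> ldom c p ->
  is_derive (lmap c p) (delta_mx 0 a) (f \o phi \o linv c)
    (\sum_(b < n) pderiv (lmap c) (linv c) a (comp b) p
                  * pderiv (lmap c') (linv c') b f (phi p)).
Proof.
move=> sf Dp; have D'p := phi_dom Dp.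
pose F := f \o linv c'; pose G := lmap c' \o phi \o linv c.
have Gp : G (lmap c p) = lmap c' (phi p) by rewrite /G /= lmapK.
have [dF DF] : differentiable F (G (lmap c p)) /\
    forall u, 'D_u F (G (lmap c p)) = gradient F (G (lmap c p)) u.
  rewrite Gp; apply: continuous_partials_diff; first exact: near_derivable_linv.
  by move=> k; exact: continuous_partial_linv.
have dG : derivable G (lmap c p) (delta_mx 0 a).
  by apply/derivable_mxP => i b; rewrite ord1; exact: smooth_pderivable (phi_smooth b) Dp.
have H := is_derive_comp_diff dG dF.
apply: (near_eq_is_derive _ (f := F \o G)).
  apply: filterS (linv_near Dp) => v [Dv _].
  by rewrite /F /G /= lmapK //; exact: phi_dom.
apply: (is_derive_eq H); rewrite -deriveE // DF /gradient Gp.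
apply: eq_bigr => b _; congr (_ * _).
by rewrite (derive_mx dG) mxE.
Qed.

Lemma pderivable_pullback a f p :
  smooth_coord (lmap c') (linv c') (ldom c') f -> ldom c p ->
  pderivable c a (f \o phi) p.
Proof. by move=> sf Dp; case: (is_pderive_pullback a sf Dp). Qed.

Lemma pderiv_pullback a f p :
  smooth_coord (lmap c') (linv c') (ldom c') f -> ldom c p ->
  pderiv (lmap c) (linv c) a (f \o phi) p =
  \sum_(b < n) pderiv (lmap c) (linv c) a (comp b) p
               * pderiv (lmap c') (linv c') b f (phi p).
Proof. by move=> sf Dp; have H := is_pderive_pullback a sf Dp; exact: derive_val. Qed.

Lemma Cn_sum l (I : finType) (F : I -> T -> R) :
  (forall i, Cn c l (F i)) -> Cn c l (fun q => \sum_i F i q).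
Proof.
move=> CF; elim: (index_enum I) => [|i s IH].
  by apply: (Cn_on_eq _ (Cn_cst c l 0)) => q _; rewrite big_nil.
by apply: (Cn_on_eq _ (CnD (CF i) IH)) => q _; rewrite big_cons.
Qed.

(** Induction on the order for all [f] together: a partial derivative of [f \o phi] is a combination
    of pull-backs of partial derivatives of [f], with Jacobian entries as coefficients. *)
Lemma smooth_pullback f : smooth_coord (lmap c') (linv c') (ldom c') f ->
  smooth_coord (lmap c) (linv c) (ldom c) (f \o phi).
Proof.
move=> sf; apply/smooth_coordP => l; elim: l f sf => [|l IH] f sf.
  split=> // p Dp; apply: continuous_comp; first exact: phi_continuous.
  exact: smooth_continuous sf (phi_dom Dp).
split.
  by move=> p Dp; exact: Cn_continuous (IH f sf) Dp.
split=> [a p Dp|a]; first exact: pderivable_pullback.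
apply: (Cn_on_eq (f := fun q => \sum_(b < n) pderiv (lmap c) (linv c) a (comp b) q
                  * (pderiv (lmap c') (linv c') b f \o phi) q)).
  by move=> q Dq; rewrite pderiv_pullback.
apply: Cn_sum => b; apply: CnM; last exact: IH (smooth_coord_pderiv b sf).
by have /smooth_coordP := smooth_coord_pderiv a (phi_smooth b); exact.
Qed.

End Pullback.

(** * The ring of smooth functions on a chart domain *)

Section SmoothRing.
Variables (R : realType) (n : nat) (T : topologicalType) (c : local_chart R n T).
Implicit Types (p : T).
Local Notation D := (ldom c).
Local Notation smoothl f := (smooth_coord (lmap c) (linv c) D f).

(* Smooth functions on the domain, extended by [0] so that functions agreeing
   on the domain are equal. *)
Record smooth_fun := SmoothFun {
  sfun :> T -> R;
  sfun_smooth : smoothl sfun;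
  sfun_out : forall p, ~ D p -> sfun p = 0 }.

Lemma smooth_fun_eq (f g : smooth_fun) : (forall p, D p -> f p = g p) -> f = g.
Proof.
case: f g => [f sf f0] [g sg g0] /= fg.
have E : f = g.
  apply: funext => p; have [Dp|nDp] := pselect (D p); first exact: fg.
  by rewrite f0 // g0.
by case: _ / E sg g0 {fg} => sg g0; congr SmoothFun; exact: Prop_irrelevance.
Qed.

Definition restr (f : T -> R) p : R := if `[< D p >] then f p else 0.

Lemma restrE f p : D p -> restr f p = f p.
Proof. by move=> Dp; rewrite /restr asboolT. Qed.

Lemma restr_out f p : ~ D p -> restr f p = 0.
Proof. by move=> nDp; rewrite /restr asboolF. Qed.

Lemma restr_smooth f : smoothl f -> smoothl (restr f).
Proof. by apply: smooth_on_eq => q Dq; rewrite restrE. Qed.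

Definition to_smooth f (sf : smoothl f) : smooth_fun :=
  SmoothFun (restr_smooth sf) (@restr_out f).

Lemma to_smoothE f (sf : smoothl f) p : D p -> to_smooth sf p = f p.
Proof. exact: restrE. Qed.

Definition sf_cst (a : R) : smooth_fun := to_smooth (smooth_cst (c := c) a).
Definition sf_add (f g : smooth_fun) : smooth_fun :=
  to_smooth (smoothD (sfun_smooth f) (sfun_smooth g)).
Definition sf_opp (f : smooth_fun) : smooth_fun :=
  to_smooth (smoothN (sfun_smooth f)).
Definition sf_mul (f g : smooth_fun) : smooth_fun :=
  to_smooth (smoothM (sfun_smooth f) (sfun_smooth g)).

HB.instance Definition _ := gen_eqMixin smooth_fun.
HB.instance Definition _ := gen_choiceMixin smooth_fun.

Fact sf_addA : associative sf_add.
Proof. by move=> f g h; apply: smooth_fun_eq => p Dp; rewrite !to_smoothE // addrA. Qed.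
Fact sf_addC : commutative sf_add.
Proof. by move=> f g; apply: smooth_fun_eq => p Dp; rewrite !to_smoothE // addrC. Qed.
Fact sf_add0 : left_id (sf_cst 0) sf_add.
Proof. by move=> f; apply: smooth_fun_eq => p Dp; rewrite !to_smoothE // add0r. Qed.
Fact sf_addN : left_inverse (sf_cst 0) sf_opp sf_add.
Proof. by move=> f; apply: smooth_fun_eq => p Dp; rewrite !to_smoothE // addNr. Qed.
HB.instance Definition _ :=
  GRing.isZmodule.Build smooth_fun sf_addA sf_addC sf_add0 sf_addN.

Fact sf_mulA : associative sf_mul.
Proof. by move=> f g h; apply: smooth_fun_eq => p Dp; rewrite !to_smoothE // mulrA. Qed.
Fact sf_mulC : commutative sf_mul.
Proof. by move=> f g; apply: smooth_fun_eq => p Dp; rewrite !to_smoothE // mulrC. Qed.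
Fact sf_mul1 : left_id (sf_cst 1) sf_mul.
Proof. by move=> f; apply: smooth_fun_eq => p Dp; rewrite !to_smoothE // mul1r. Qed.
Fact sf_mulDl : left_distributive sf_mul sf_add.
Proof. by move=> f g h; apply: smooth_fun_eq => p Dp; rewrite !to_smoothE // mulrDl. Qed.
HB.instance Definition _ :=
  GRing.Zmodule_isComPzRing.Build smooth_fun sf_mulA sf_mulC sf_mul1 sf_mulDl.

(** Evaluation is additive and multiplicative at every point, since off the domain everything is 0,
    but it preserves 1 only on the domain. Hence it is declared as an additive morphism and not as a
    ring morphism. *)
Definition eval p (f : smooth_fun) : R := f p.
Arguments eval : simpl never.

Fact eval_additive p : zmod_morphism (eval p).
Proof.
move=> f g; have [Dp|nDp] := pselect (D p); first by rewrite /eval !to_smoothE.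
by rewrite /eval !sfun_out // subr0.
Qed.
HB.instance Definition _ p :=
  GRing.isZmodMorphism.Build smooth_fun R (eval p) (eval_additive p).

Lemma evalM p (f g : smooth_fun) : eval p (f * g) = eval p f * eval p g.
Proof.
have [Dp|nDp] := pselect (D p); first by rewrite /eval !to_smoothE.
by rewrite /eval !sfun_out // mulr0.
Qed.

Lemma evalD p (f g : smooth_fun) : eval p (f + g) = eval p f + eval p g.
Proof. exact: raddfD. Qed.
Lemma evalN p (f : smooth_fun) : eval p (- f) = - eval p f.
Proof. exact: raddfN. Qed.
Lemma eval0 p : eval p 0 = 0.
Proof. exact: raddf0. Qed.
Lemma evalMn p (f : smooth_fun) k : eval p (f *+ k) = eval p f *+ k.
Proof. exact: raddfMn. Qed.

Lemma eval1 p : D p -> eval p 1 = 1.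
Proof. by move=> Dp; rewrite /eval to_smoothE. Qed.

Lemma eval_cst p a : D p -> eval p (sf_cst a) = a.
Proof. by move=> Dp; rewrite /eval to_smoothE. Qed.

Lemma eval_eq (f g : smooth_fun) : (forall p, D p -> eval p f = eval p g) -> f = g.
Proof. exact: smooth_fun_eq. Qed.

Lemma sf_cstM a b : sf_cst (a * b) = sf_cst a * sf_cst b.
Proof. by apply: eval_eq => p Dp; rewrite evalM !eval_cst. Qed.

Lemma sf_cstD a b : sf_cst (a + b) = sf_cst a + sf_cst b.
Proof. by apply: eval_eq => p Dp; rewrite raddfD /= !eval_cst. Qed.

Definition sf_partial (k : 'I_n) (f : smooth_fun) : smooth_fun :=
  to_smooth (smooth_coord_pderiv k (sfun_smooth f)).

Lemma eval_partial k (f : smooth_fun) p : D p ->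
  eval p (sf_partial k f) = pderiv (lmap c) (linv c) k f p.
Proof. exact: to_smoothE. Qed.

Lemma eval_partial_on k (f : smooth_fun) (F : T -> R) p : D p ->
  (forall q, D q -> F q = eval q f) ->
  eval p (sf_partial k f) = pderiv (lmap c) (linv c) k F p.
Proof. by move=> Dp E; rewrite eval_partial //; apply: pderiv_on_eq => // q /E. Qed.

Fact sf_partial_additive k : zmod_morphism (sf_partial k).
Proof.
move=> f g; apply: eval_eq => p Dp; rewrite raddfB /= !eval_partial //.
have df := smooth_pderivable (k := k) (sfun_smooth f) Dp.
have dg := smooth_pderivable (k := k) (sfun_smooth g) Dp.
rewrite -(pderivN dg) -(pderivD df (pderivableN dg)).
apply: pderiv_on_eq => // q Dq.
by rewrite -[LHS]/(eval q (f - g)) raddfB.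
Qed.
HB.instance Definition _ k :=
  GRing.isZmodMorphism.Build smooth_fun smooth_fun (sf_partial k) (sf_partial_additive k).

Lemma sf_partialM k (f g : smooth_fun) :
  sf_partial k (f * g) = sf_partial k f * g + f * sf_partial k g.
Proof.
apply: eval_eq => p Dp; rewrite raddfD /= !evalM !eval_partial //.
have df := smooth_pderivable (k := k) (sfun_smooth f) Dp.
have dg := smooth_pderivable (k := k) (sfun_smooth g) Dp.
rewrite -(pderivM df dg Dp); apply: pderiv_on_eq => // q Dq.
exact: (evalM q f g).
Qed.

Lemma sf_partialC k l (f : smooth_fun) :
  sf_partial k (sf_partial l f) = sf_partial l (sf_partial k f).
Proof.
apply: eval_eq => p Dp.
have E i j : eval p (sf_partial i (sf_partial j f)) =
    pderiv (lmap c) (linv c) i (pderiv (lmap c) (linv c) j f) p.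
  apply: (@eval_partial_on i (sf_partial j f)) => // q Dq.
  exact: esym (eval_partial j f Dq).
exact: etrans (E k l) (etrans (pderivC k l (sfun_smooth f) Dp) (esym (E l k))).
Qed.

Lemma sf_partial_cst k a : sf_partial k (sf_cst a) = 0.
Proof.
apply: eval_eq => p Dp; rewrite raddf0.
rewrite (@eval_partial_on k _ (cst a) p Dp); last by move=> q Dq; rewrite eval_cst.
exact: pderiv_cst.
Qed.

Lemma sf_inverse (f : smooth_fun) : (forall p, D p -> eval p f != 0) ->
  exists g : smooth_fun, f * g = 1.
Proof.
move=> f0; exists (to_smooth (smoothV (sfun_smooth f) f0)).
apply: eval_eq => p Dp; rewrite evalM eval1 // {2}/eval to_smoothE //.
by rewrite mulfV // f0.
Qed.

Lemma sf_sqrt (f : smooth_fun) : (forall p, D p -> 0 < eval p f) ->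
  exists g : smooth_fun, g * g = f /\ forall p, D p -> 0 < eval p g.
Proof.
move=> f0; exists (to_smooth (smooth_sqrt (sfun_smooth f) f0)); split.
  apply: eval_eq => p Dp; rewrite evalM {1 2}/eval to_smoothE //.
  by rewrite -expr2 sqr_sqrtr // ltW // f0.
by move=> p Dp; rewrite /eval to_smoothE // sqrtr_gt0 f0.
Qed.

(** The derivative rule is stated free of division, as it will be used inside the ring. *)
Lemma sf_ln (f : smooth_fun) : (forall p, D p -> 0 < eval p f) ->
  exists g : smooth_fun, (forall p, D p -> eval p g = ln (eval p f)) /\
    forall k, f * sf_partial k g = sf_partial k f.
Proof.
move=> f0; exists (to_smooth (smooth_ln (sfun_smooth f) f0)).
split=> [p Dp|k]; first by rewrite {1}/eval to_smoothE.
apply: eval_eq => p Dp; rewrite evalM (@eval_partial_on _ _ (fun q => ln (f q))) //.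
  rewrite (pderiv_ln k (sfun_smooth f) Dp (f0 p Dp)) mulrA mulfV ?mul1r ?eval_partial //.
  by rewrite gt_eqF // f0.
by move=> q Dq; rewrite /eval to_smoothE.
Qed.

End SmoothRing.
Arguments eval : simpl never.

Section PullbackRing.
Variables (R : realType) (m n : nat) (T T' : topologicalType).
Variables (c : local_chart R m T) (c' : local_chart R n T') (phi : T -> T').
Hypothesis phi_dom : forall p, ldom c p -> ldom c' (phi p).
Hypothesis phi_continuous : forall p, ldom c p -> {for p, continuous phi}.
Hypothesis phi_smooth : forall b, smooth_coord (lmap c) (linv c) (ldom c)
  (fun q => lmap c' (phi q) 0 b).

Definition sf_pullback (f : smooth_fun c') : smooth_fun c :=
  to_smooth (smooth_pullback phi_dom phi_continuous phi_smooth (sfun_smooth f)).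

Lemma eval_pullback f p : ldom c p -> eval p (sf_pullback f) = eval (phi p) f.
Proof. exact: to_smoothE. Qed.

Fact sf_pullback_additive : zmod_morphism sf_pullback.
Proof. by move=> f g; apply: eval_eq => p Dp; rewrite raddfB /= !eval_pullback // raddfB. Qed.
Fact sf_pullback_multiplicative : monoid_morphism sf_pullback.
Proof.
split=> [|f g]; apply: eval_eq => p Dp; first by rewrite eval_pullback // !eval1 //; exact: phi_dom.
by rewrite evalM !eval_pullback // evalM.
Qed.
HB.instance Definition _ :=
  GRing.isZmodMorphism.Build (smooth_fun c') (smooth_fun c) sf_pullback sf_pullback_additive.
HB.instance Definition _ :=
  GRing.isMonoidMorphism.Build (smooth_fun c') (smooth_fun c) sf_pullback sf_pullback_multiplicative.

Definition sf_jacobian (a : 'I_m) (b : 'I_n) : smooth_fun c :=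
  to_smooth (smooth_coord_pderiv a (phi_smooth b)).

Lemma sf_partial_pullback a f : sf_partial a (sf_pullback f) =
  \sum_b sf_jacobian a b * sf_pullback (sf_partial b f).
Proof.
apply: eval_eq => p Dp.
rewrite (@eval_partial_on _ _ _ _ _ _ (f \o phi)) //; last by move=> q Dq; rewrite eval_pullback.
rewrite (pderiv_pullback phi_dom phi_smooth a (sfun_smooth f) Dp) raddf_sum /=.
apply: eq_bigr => b _; rewrite evalM eval_pullback // eval_partial; last exact: phi_dom.
by rewrite [in RHS]/eval to_smoothE.
Qed.

(** The entries with a fixed [b] are the partial derivatives of a single function, the component [b]
    of [phi]. *)
Lemma sf_jacobianC a a' b :
  sf_partial a (sf_jacobian a' b) = sf_partial a' (sf_jacobian a b).
Proof.
pose comp := to_smooth (phi_smooth b).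
have E i : sf_jacobian i b = sf_partial i comp.
  apply: eval_eq => p Dp; rewrite (@eval_partial_on _ _ _ _ _ _ (fun q => lmap c' (phi q) 0 b)) //.
    by rewrite /eval to_smoothE.
  by move=> q Dq; rewrite /eval to_smoothE.
by rewrite !E sf_partialC.
Qed.

End PullbackRing.

(** * Levi-Civita connections over a commutative ring *)

(* [S] stands for the ring of functions and [V] for the module of fields. *)
Record levi_civita (S : comPzRingType) (V : lmodType S) := LeviCivita {
  der : V -> S -> S;
  br : V -> V -> V;
  nab : V -> V -> V;
  inn : V -> V -> S;
  half : S;
  halfP : half + half = 1;
  derDl : forall X Y f, der (X + Y) f = der X f + der Y f;
  derZl : forall a X f, der (a *: X) f = a * der X f;
  derDr : forall X f h, der X (f + h) = der X f + der X h;
  derM : forall X f h, der X (f * h) = der X f * h + f * der X h;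
  der_br : forall X Y f, der (br X Y) f = der X (der Y f) - der Y (der X f);
  jacobi : forall X Y Z, br X (br Y Z) + br Y (br Z X) + br Z (br X Y) = 0;
  innC : forall X Y, inn X Y = inn Y X;
  innDl : forall X Y Z, inn (X + Y) Z = inn X Z + inn Y Z;
  innZl : forall a X Z, inn (a *: X) Z = a * inn X Z;
  inn_ext : forall X Y, (forall Z, inn X Z = inn Y Z) -> X = Y;
  nabDl : forall X Y Z, nab (X + Y) Z = nab X Z + nab Y Z;
  nabZl : forall a X Z, nab (a *: X) Z = a *: nab X Z;
  nabDr : forall X Y Z, nab X (Y + Z) = nab X Y + nab X Z;
  nabZr : forall a X Y, nab X (a *: Y) = der X a *: Y + a *: nab X Y;
  torsion_free : forall X Y, nab X Y - nab Y X = br X Y;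
  metric_compat : forall X Y Z,
    der X (inn Y Z) = inn (nab X Y) Z + inn Y (nab X Z) }.

Section LinearForms.
Variables (S : comPzRingType) (V : lmodType S).
Implicit Types (F G : V -> S) (B C : V -> V -> S).

Definition linf F := (forall X Y, F (X + Y) = F X + F Y) /\
  (forall a X, F (a *: X) = a * F X).
Definition bilinf B := (forall Y, linf (B^~ Y)) /\ (forall X, linf (B X)).

Lemma linf_sum (I : Type) (s : seq I) (F : I -> V -> S) :
  (forall i, linf (F i)) -> linf (fun X => \sum_(i <- s) F i X).
Proof.
move=> HF; split=> [X Y|a X].
  by rewrite -big_split; apply: eq_bigr => i _; case: (HF i).
by rewrite big_distrr; apply: eq_bigr => i _; case: (HF i).
Qed.

Lemma linfD F G : linf F -> linf G -> linf (fun X => F X + G X).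
Proof. by move=> [F1 F2] [G1 G2]; split=> *; rewrite ?F1 ?G1 ?F2 ?G2; ring. Qed.
Lemma linfN F : linf F -> linf (fun X => - F X).
Proof. by move=> [F1 F2]; split=> *; rewrite ?F1 ?F2; ring. Qed.
Lemma linfM a F : linf F -> linf (fun X => a * F X).
Proof. by move=> [F1 F2]; split=> *; rewrite ?F1 ?F2; ring. Qed.
Lemma linfMr a F : linf F -> linf (fun X => F X * a).
Proof. by move=> [F1 F2]; split=> *; rewrite ?F1 ?F2; ring. Qed.

Lemma linf0 F : linf F -> F 0 = 0.
Proof. by move=> [_ FZ]; rewrite -(scale0r 0) FZ mul0r. Qed.

Lemma linfNE F X : linf F -> F (- X) = - F X.
Proof. by move=> [_ FZ]; rewrite -scaleN1r FZ mulN1r. Qed.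

Lemma linf_comb F (I : Type) (s : seq I) (a : I -> S) (x : I -> V) : linf F ->
  F (\sum_(i <- s) a i *: x i) = \sum_(i <- s) a i * F (x i).
Proof.
move=> LF; elim: s => [|i s IH]; first by rewrite !big_nil linf0.
by rewrite !big_cons LF.1 LF.2 IH.
Qed.

Lemma bilinfD B C : bilinf B -> bilinf C -> bilinf (fun X Y => B X Y + C X Y).
Proof. by move=> [B1 B2] [C1 C2]; split=> ?; apply: linfD. Qed.
Lemma bilinfN B : bilinf B -> bilinf (fun X Y => - B X Y).
Proof. by move=> [B1 B2]; split=> ?; apply: linfN. Qed.
Lemma bilinfM a B : bilinf B -> bilinf (fun X Y => a * B X Y).
Proof. by move=> [B1 B2]; split=> ?; apply: linfM. Qed.
Lemma bilinf_tensor F G : linf F -> linf G -> bilinf (fun X Y => F X * G Y).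
Proof. by move=> LF LG; split=> ?; [apply: linfMr|apply: linfM]. Qed.
Lemma bilinf_sum (I : Type) (s : seq I) (B : I -> V -> V -> S) :
  (forall i, bilinf (B i)) -> bilinf (fun X Y => \sum_(i <- s) B i X Y).
Proof. by move=> HB; split=> ?; apply: linf_sum => i; case: (HB i). Qed.

Lemma bilinf_comb B (I J : Type) (s : seq I) (t : seq J)
    (a : I -> S) (x : I -> V) (b : J -> S) (y : J -> V) : bilinf B ->
  B (\sum_(i <- s) a i *: x i) (\sum_(j <- t) b j *: y j) =
  \sum_(i <- s) \sum_(j <- t) a i * b j * B (x i) (y j).
Proof.
move=> [B1 B2]; rewrite (linf_comb _ _ _ (B1 _)); apply: eq_bigr => i _.
rewrite (linf_comb _ _ _ (B2 _)) big_distrr; apply: eq_bigr => j _.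
by rewrite /= mulrA.
Qed.

End LinearForms.

Section LeviCivitaTheory.
Variables (S : comPzRingType) (V : lmodType S) (L : levi_civita V).
Implicit Types (X Y Z u : V) (f h : S) (e : seq V).
Local Notation der := (der L).
Local Notation br := (br L).
Local Notation nab := (nab L).
Local Notation inn := (inn L).

(** Koszul's formula yields only twice the connection; [half] makes this sufficient in a ring with
    zero divisors. *)
Lemma double_inj (x y : S) : x + x = y + y -> x = y.
Proof.
move=> E; rewrite -[x]mul1r -[y]mul1r -(halfP L) !mulrDl -!mulrDr E //.
Qed.

Lemma innDr X Y Z : inn X (Y + Z) = inn X Y + inn X Z.
Proof. by rewrite !(innC L X) innDl. Qed.
Lemma innZr a X Z : inn X (a *: Z) = a * inn X Z.
Proof. by rewrite !(innC L X) innZl. Qed.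
Lemma innNl X Z : inn (- X) Z = - inn X Z.
Proof. by rewrite -scaleN1r innZl mulN1r. Qed.
Lemma innNr X Z : inn X (- Z) = - inn X Z.
Proof. by rewrite !(innC L X) innNl. Qed.
Lemma derNl X f : der (- X) f = - der X f.
Proof. by rewrite -scaleN1r derZl mulN1r. Qed.
Lemma der0r X : der X 0 = 0.
Proof. by apply: (addrI (der X 0)); rewrite -derDr !addr0. Qed.
Lemma der_sum X (I : Type) (s : seq I) (F : I -> S) :
  der X (\sum_(k <- s) F k) = \sum_(k <- s) der X (F k).
Proof. by apply: (big_morph (der X)); [exact: derDr|exact: der0r]. Qed.
Lemma der1 X : der X 1 = 0.
Proof.
apply: (addrI (der X 1)); rewrite addr0.
by rewrite -[in RHS](mulr1 1) derM mulr1 mul1r.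
Qed.
Lemma derNr X f : der X (- f) = - der X f.
Proof. by apply: (addrI (der X f)); rewrite -derDr !subrr der0r. Qed.
Lemma nabNl X Z : nab (- X) Z = - nab X Z.
Proof. by rewrite -scaleN1r nabZl scaleN1r. Qed.
Lemma nab0r X : nab X 0 = 0.
Proof. by rewrite -[in LHS](scale0r 0) nabZr der0r !scale0r addr0. Qed.
Lemma nabNr X Z : nab X (- Z) = - nab X Z.
Proof. by rewrite -scaleN1r nabZr derNr der1 oppr0 scale0r add0r scaleN1r. Qed.

Lemma inn0l X : inn 0 X = 0.
Proof. by rewrite -(scale0r 0) innZl mul0r. Qed.
Lemma inn0r X : inn X 0 = 0.
Proof. by rewrite innC inn0l. Qed.
Lemma nab0l X : nab 0 X = 0.
Proof. by rewrite -(scale0r 0) nabZl !scale0r. Qed.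
Lemma der0l f : der 0 f = 0.
Proof. by rewrite -(scale0r 0) derZl mul0r. Qed.

Lemma brE X Y : br X Y = nab X Y - nab Y X.
Proof. by rewrite torsion_free. Qed.
Lemma brC X Y : br X Y = - br Y X.
Proof. by rewrite !brE opprB. Qed.
Lemma brDr X Y Z : br X (Y + Z) = br X Y + br X Z.
Proof. by rewrite !brE nabDl nabDr opprD addrACA. Qed.
Lemma brZr a X Y : br X (a *: Y) = der X a *: Y + a *: br X Y.
Proof. by rewrite !brE nabZl nabZr scalerBr addrA. Qed.
Lemma brNr X Y : br X (- Y) = - br X Y.
Proof. by rewrite !brE nabNl nabNr opprD. Qed.
Lemma brDl X Y Z : br (X + Y) Z = br X Z + br Y Z.
Proof. by rewrite brC brDr opprD -!brC. Qed.
Lemma brZl a X Y : br (a *: X) Y = - (der Y a *: X) + a *: br X Y.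
Proof. by rewrite brC brZr opprD [br X Y]brC scalerN. Qed.

Definition riem X Y Z := nab X (nab Y Z) - nab Y (nab X Z) - nab (br X Y) Z.

Definition innE := (innDl, innZl, innNl).
Definition nabE := (nabDl, nabZl, nabNl, nabDr, nabZr, nabNr).
Definition derE := (derDl, derZl, derNl, derDr, derM, derNr).

(** Pairing with an arbitrary [W] turns an identity between vectors into one between scalars, within
    reach of [ring]; the same device proves the linearity of the curvature. *)
Lemma riemC X Y Z : riem X Y Z = - riem Y X Z.
Proof. by apply: (inn_ext (l := L)) => W; rewrite /riem (brC Y X) !(nabE, innE); ring. Qed.

Lemma riemDl X X' Y Z : riem (X + X') Y Z = riem X Y Z + riem X' Y Z.
Proof. by apply: (inn_ext (l := L)) => W; rewrite /riem brDl !(nabE, innE); ring. Qed.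

Lemma riemZl a X Y Z : riem (a *: X) Y Z = a *: riem X Y Z.
Proof. by apply: (inn_ext (l := L)) => W; rewrite /riem brZl !(nabE, innE); ring. Qed.

Lemma riemDm X Y Y' Z : riem X (Y + Y') Z = riem X Y Z + riem X Y' Z.
Proof. by rewrite riemC riemDl opprD -!riemC. Qed.
Lemma riemZm a X Y Z : riem X (a *: Y) Z = a *: riem X Y Z.
Proof. by rewrite riemC riemZl [riem X Y Z]riemC scalerN. Qed.

Lemma riemDr X Y Z Z' : riem X Y (Z + Z') = riem X Y Z + riem X Y Z'.
Proof. by apply: (inn_ext (l := L)) => W; rewrite /riem !(nabE, innE); ring. Qed.

(** The second derivatives of [a] cancel against the derivative along the bracket, by [der_br]. *)
Lemma riemZr a X Y Z : riem X Y (a *: Z) = a *: riem X Y Z.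
Proof.
by apply: (inn_ext (l := L)) => W; rewrite /riem !(nabE, innE) der_br; ring.
Qed.

Lemma linf_inn_r X : linf (inn X).
Proof. by split=> *; rewrite ?innDr ?innZr. Qed.
Lemma linf_inn_l X : linf (inn^~ X).
Proof. by split=> *; rewrite ?innDl ?innZl. Qed.
Lemma bilinf_inn : bilinf inn.
Proof. by split=> X; [exact: linf_inn_l|exact: linf_inn_r]. Qed.
Lemma linf_der f : linf (der^~ f).
Proof. by split=> *; rewrite ?derDl ?derZl. Qed.

Definition ricci_frame (I : finType) (e : I -> V) Y Z : S :=
  \sum_i inn (riem (e i) Y Z) (e i).

Lemma bilinf_ricci (I : finType) (e : I -> V) : bilinf (ricci_frame e).
Proof.
by apply: bilinf_sum => i; split=> X; split=> *;
  rewrite ?riemDm ?riemZm ?riemDr ?riemZr innE.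
Qed.

(** The Lie derivative of the metric written with the connection, which makes it visibly linear over
    functions in [Y] and [Z]; [lie_gE] links it to the definition by brackets. *)
Definition lie_g X Y Z : S := inn (nab Y X) Z + inn Y (nab Z X).

Lemma lie_gE X Y Z :
  der X (inn Y Z) - inn (br X Y) Z - inn Y (br X Z) = lie_g X Y Z.
Proof. rewrite /lie_g metric_compat !brE !(innE, innDr, innNr); ring. Qed.

Lemma bilinf_lie X : bilinf (lie_g X).
Proof.
by split=> Z; split=> *; rewrite /lie_g !(nabDl, nabZl, innDl, innZl, innDr, innZr); ring.
Qed.

Lemma lie_gD X X' Y Z : lie_g (X + X') Y Z = lie_g X Y Z + lie_g X' Y Z.
Proof. by rewrite /lie_g !nabDr innDl innDr; ring. Qed.
Lemma lie_gN X Y Z : lie_g (- X) Y Z = - lie_g X Y Z.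
Proof. by rewrite /lie_g !nabNr innNl innNr; ring. Qed.
Lemma lie_gZ f X Y Z : lie_g (f *: X) Y Z =
  f * lie_g X Y Z + der Y f * inn X Z + der Z f * inn X Y.
Proof. by rewrite /lie_g !nabZr innDl innDr !innZl !innZr (innC L Y X); ring. Qed.

Definition hess f Y Z : S := der Y (der Z f) - der (nab Y Z) f.

Lemma bilinf_hess f : bilinf (hess f).
Proof.
by split=> Z; split=> *; rewrite /hess !(derE, nabE); ring.
Qed.

Definition dform (w : V -> S) Y Z : S := der Y (w Z) - der Z (w Y) - w (br Y Z).

Lemma bilinf_dform w : linf w -> bilinf (dform w).
Proof.
move=> Lw; split=> Z; split=> *;
  by rewrite /dform !(Lw.1, Lw.2, brDl, brDr, brZl, brZr, derE, linfNE _ Lw); ring.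
Qed.

Definition nab_form (W : V -> V -> S) X Y Z : S :=
  der X (W Y Z) - W (nab X Y) Z - W Y (nab X Z).

Lemma bilinf_nab_form12 W Z : bilinf W -> bilinf (fun X Y => nab_form W X Y Z).
Proof.
move=> [W1 W2]; split=> X; split=> *; rewrite /nab_form;
by rewrite !((W1 _).1, (W1 _).2, (W2 _).1, (W2 _).2, derE, nabE); ring.
Qed.

Lemma linf_nab_form3 W X Y : bilinf W -> linf (nab_form W X Y).
Proof.
move=> [W1 W2]; split=> *; rewrite /nab_form;
by rewrite !((W1 _).1, (W1 _).2, (W2 _).1, (W2 _).2, derE, nabE); ring.
Qed.

Lemma koszul X Y Z : inn (nab X Y) Z + inn (nab X Y) Z =
  der X (inn Y Z) + der Y (inn X Z) - der Z (inn X Y)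
  + inn (br X Y) Z - inn (br X Z) Y - inn (br Y Z) X.
Proof.
rewrite !metric_compat !brE !innE !(innC L _ (nab _ _)); ring.
Qed.

End LeviCivitaTheory.

(** * The Levi-Civita connection of a Gram matrix *)

Section CoordinateConnection.
Variables (S : comPzRingType) (n : nat) (D : 'I_n -> {additive S -> S}).
Variables (G G' : 'M[S]_n) (h : S).
Hypothesis DM : forall k f g, D k (f * g) = D k f * g + f * D k g.
Hypothesis DC : forall k l f, D k (D l f) = D l (D k f).
Hypothesis G_sym : G^T = G.
Hypothesis GG' : G *m G' = 1%:M.
Hypothesis hP : h + h = 1.
Local Notation V := 'rV[S]_n.
Implicit Types (X Y Z : V) (f : S).

Definition cder X f : S := \sum_k X 0 k * D k f.
Definition cvec X Y : V := \row_b cder X (Y 0 b).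
Definition cbr X Y : V := cvec X Y - cvec Y X.
Definition cinn X Y : S := (X *m G *m Y^T) 0 0.
Definition cchr (c a b : 'I_n) : S :=
  h * \sum_d G' c d * (D a (G b d) + D b (G a d) - D d (G a b)).
Definition cgam X Y : V :=
  \row_c \sum_a \sum_b cchr c a b * X 0 a * Y 0 b.
Definition cnab X Y : V := cvec X Y + cgam X Y.

Let cderDl X Y f : cder (X + Y) f = cder X f + cder Y f.
Proof. by rewrite /cder -big_split; apply: eq_bigr => k _; rewrite mxE mulrDl. Qed.
Let cderZl a X f : cder (a *: X) f = a * cder X f.
Proof. by rewrite /cder big_distrr; apply: eq_bigr => k _; rewrite mxE /= mulrA. Qed.
Let cderDr X f g : cder X (f + g) = cder X f + cder X g.
Proof. by rewrite /cder -big_split; apply: eq_bigr => k _; rewrite raddfD mulrDr. Qed.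
Let cderM X f g : cder X (f * g) = cder X f * g + f * cder X g.
Proof.
rewrite /cder big_distrl big_distrr -big_split; apply: eq_bigr => k _ /=.
by rewrite DM; ring.
Qed.
Let cder0 X : cder X 0 = 0.
Proof. by rewrite /cder big1 // => k _; rewrite raddf0 mulr0. Qed.
Let cder_sum X (I : finType) (F : I -> S) :
  cder X (\sum_i F i) = \sum_i cder X (F i).
Proof.
apply: (big_morph (cder X)); [exact: cderDr|exact: cder0].
Qed.
Let cderNl X f : cder (- X) f = - cder X f.
Proof. by rewrite -scaleN1r cderZl mulN1r. Qed.
Let cderNr X f : cder X (- f) = - cder X f.
Proof. by apply: (addrI (cder X f)); rewrite -cderDr !subrr cder0. Qed.

(** The subtracted term, with second derivatives of [f], is symmetric in [X] and [Y] because the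
    derivations commute; it drops out of the bracket. *)
Let cder_cvec X Y f : cder (cvec X Y) f =
  cder X (cder Y f) - \sum_b \sum_k Y 0 b * (X 0 k * D k (D b f)).
Proof.
apply/eqP; rewrite eq_sym subr_eq eq_sym; apply/eqP.
rewrite [cder Y f]/cder [cder (cvec X Y) f]/cder cder_sum -big_split; apply: eq_bigr => b _ /=.
by rewrite cderM mxE big_distrr.
Qed.

Let cder_br X Y f : cder (cbr X Y) f = cder X (cder Y f) - cder Y (cder X f).
Proof.
rewrite /cbr cderDl cderNl !cder_cvec.
suff -> : \sum_b \sum_k Y 0 b * (X 0 k * D k (D b f)) =
          \sum_b \sum_k X 0 b * (Y 0 k * D k (D b f)) by ring.
rewrite exchange_big; apply: eq_bigr => b _; apply: eq_bigr => k _ /=.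
by rewrite DC; ring.
Qed.

Let cbr_coord X Y b : cbr X Y 0 b = cder X (Y 0 b) - cder Y (X 0 b).
Proof. by rewrite !mxE. Qed.

Let cjacobi X Y Z : cbr X (cbr Y Z) + cbr Y (cbr Z X) + cbr Z (cbr X Y) = 0.
Proof.
apply/rowP => b; rewrite [LHS]mxE [X in X + _]mxE [RHS]mxE !cbr_coord.
rewrite !(cder_br, cderDr, cderNr); ring.
Qed.

Lemma cinnE X Y : cinn X Y = \sum_a \sum_b X 0 a * G a b * Y 0 b.
Proof.
rewrite /cinn mxE exchange_big; apply: eq_bigr => b _.
by rewrite !mxE big_distrl.
Qed.

Let cinnC X Y : cinn X Y = cinn Y X.
Proof.
rewrite /cinn; have -> : X *m G *m Y^T = (Y *m G *m X^T)^T.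
  by rewrite !trmx_mul trmxK G_sym mulmxA.
by rewrite mxE.
Qed.
Let cinnDl X Y Z : cinn (X + Y) Z = cinn X Z + cinn Y Z.
Proof. by rewrite /cinn !mulmxDl mxE. Qed.
Let cinnZl a X Z : cinn (a *: X) Z = a * cinn X Z.
Proof. by rewrite /cinn -!scalemxAl mxE. Qed.

Lemma cinn_delta X b : cinn X (delta_mx 0 b) = (X *m G) 0 b.
Proof.
rewrite /cinn trmx_delta -colE mxE //.
Qed.

Let G'TG : G'^T *m G = 1%:M.
Proof. by apply: mulmx1C; rewrite -{1}G_sym -trmx_mul (mulmx1C GG') trmx1. Qed.

Let cinn_ext X Y : (forall Z, cinn X Z = cinn Y Z) -> X = Y.
Proof.
move=> E; rewrite -[X]mulmx1 -[Y]mulmx1 -GG' !mulmxA; congr (_ *m _).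
by apply/rowP => b; rewrite -!cinn_delta E.
Qed.

(** The derivative along [X] of the metric coefficients alone, the components of [Y] and [Z] being
    held fixed. *)
Definition dmetric X Y Z : S :=
  \sum_a \sum_b \sum_c X 0 a * D a (G b c) * Y 0 b * Z 0 c.

Let dmetricC X Y Z : dmetric X Y Z = dmetric X Z Y.
Proof.
apply: eq_bigr => a _; rewrite exchange_big; apply: eq_bigr => b _.
by apply: eq_bigr => c _; rewrite -[in LHS]G_sym mxE; ring.
Qed.

Let cder_inn X Y Z : cder X (cinn Y Z) =
  cinn (cvec X Y) Z + cinn Y (cvec X Z) + dmetric X Y Z.
Proof.
rewrite !cinnE cder_sum -big_split /=.
have -> : dmetric X Y Z = \sum_b \sum_c cder X (G b c) * Y 0 b * Z 0 c.
  rewrite /dmetric exchange_big; apply: eq_bigr => b _ /=.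
  rewrite exchange_big; apply: eq_bigr => c _ /=.
  by rewrite /cder !big_distrl.
rewrite -big_split; apply: eq_bigr => a _ /=.
rewrite cder_sum -!big_split; apply: eq_bigr => b _ /=.
by rewrite !cderM !mxE; ring.
Qed.

Let lowered X Y : V := \row_d (h * \sum_a \sum_b
  (D a (G b d) + D b (G a d) - D d (G a b)) * X 0 a * Y 0 b).

Let cgam_lowered X Y : cgam X Y = lowered X Y *m G'^T.
Proof.
apply/rowP => c; rewrite !mxE.
have -> : \sum_a \sum_b cchr c a b * X 0 a * Y 0 b =
   \sum_a \sum_b \sum_d h * (G' c d * ((D a (G b d) + D b (G a d) - D d (G a b))
     * X 0 a * Y 0 b)).
  apply: eq_bigr => a _; apply: eq_bigr => b _.
  rewrite /cchr -mulrA -mulrA big_distrl big_distrr; apply: eq_bigr => d _ /=.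
  by rewrite !mulrA.
under eq_bigr => a _ do rewrite exchange_big.
rewrite exchange_big; apply: eq_bigr => d _ /=.
rewrite !mxE -mulrA [_ * G' c d]mulrC !big_distrr; apply: eq_bigr => a _ /=.
by rewrite !big_distrr.
Qed.

(** Lowering the index cancels the inverse Gram matrix and leaves Christoffel symbols of the first
    kind. Symmetry of the connection and metric compatibility are both read off from this. *)
Let cinn_gam X Y Z : cinn (cgam X Y) Z =
  h * (dmetric X Y Z + dmetric Y X Z - dmetric Z X Y).
Proof.
rewrite /cinn cgam_lowered -[_ *m _ *m G]mulmxA G'TG mulmx1 mxE.
have -> : dmetric X Y Z = \sum_d \sum_a \sum_b D a (G b d) * X 0 a * Y 0 b * Z 0 d.
  rewrite /dmetric; under eq_bigr => a _ do rewrite exchange_big.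
  rewrite exchange_big; apply: eq_bigr => d _; apply: eq_bigr => a _.
  by apply: eq_bigr => b _; ring.
have -> : dmetric Y X Z = \sum_d \sum_a \sum_b D b (G a d) * X 0 a * Y 0 b * Z 0 d.
  rewrite /dmetric; under eq_bigr => a _ do rewrite exchange_big.
  rewrite exchange_big; apply: eq_bigr => d _; rewrite exchange_big.
  by apply: eq_bigr => a _; apply: eq_bigr => b _; ring.
have -> : dmetric Z X Y = \sum_d \sum_a \sum_b D d (G a b) * X 0 a * Y 0 b * Z 0 d.
  apply: eq_bigr => d _; apply: eq_bigr => a _.
  by apply: eq_bigr => b _; ring.
rewrite -big_split -sumrB big_distrr; apply: eq_bigr => d _ /=.
rewrite !mxE -mulrA; congr (_ * _).
rewrite -big_split -sumrB big_distrl; apply: eq_bigr => a _ /=.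
rewrite -big_split -sumrB big_distrl; apply: eq_bigr => b _ /=.
by ring.
Qed.

Let cvecDl X Y Z : cvec (X + Y) Z = cvec X Z + cvec Y Z.
Proof. by apply/rowP => b; rewrite !mxE cderDl. Qed.
Let cvecZl a X Z : cvec (a *: X) Z = a *: cvec X Z.
Proof. by apply/rowP => b; rewrite !mxE cderZl. Qed.
Let cvecDr X Y Z : cvec X (Y + Z) = cvec X Y + cvec X Z.
Proof. by apply/rowP => b; rewrite !mxE cderDr. Qed.
Let cvecZr a X Y : cvec X (a *: Y) = cder X a *: Y + a *: cvec X Y.
Proof. by apply/rowP => b; rewrite !mxE cderM. Qed.

Let cgamC X Y : cgam X Y = cgam Y X.
Proof. by apply: cinn_ext => Z; rewrite !cinn_gam (dmetricC Z); ring. Qed.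
Let cgamDl X Y Z : cgam (X + Y) Z = cgam X Z + cgam Y Z.
Proof.
apply/rowP => c; rewrite !mxE -big_split; apply: eq_bigr => a _ /=.
by rewrite -big_split; apply: eq_bigr => b _; rewrite mxE /=; ring.
Qed.
Let cgamZl a X Z : cgam (a *: X) Z = a *: cgam X Z.
Proof.
apply/rowP => c; rewrite !mxE big_distrr; apply: eq_bigr => i _ /=.
by rewrite big_distrr; apply: eq_bigr => b _; rewrite mxE /=; ring.
Qed.

Let cnabDl X Y Z : cnab (X + Y) Z = cnab X Z + cnab Y Z.
Proof. by rewrite /cnab cvecDl cgamDl addrACA. Qed.
Let cnabZl a X Z : cnab (a *: X) Z = a *: cnab X Z.
Proof. by rewrite /cnab cvecZl cgamZl scalerDr. Qed.
Let cnabDr X Y Z : cnab X (Y + Z) = cnab X Y + cnab X Z.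
Proof. by rewrite /cnab cvecDr cgamC cgamDl !(cgamC _ X) addrACA. Qed.
Let cnabZr a X Y : cnab X (a *: Y) = cder X a *: Y + a *: cnab X Y.
Proof. by rewrite /cnab cvecZr cgamC cgamZl (cgamC _ X) scalerDr addrA. Qed.
Let ctorsion X Y : cnab X Y - cnab Y X = cbr X Y.
Proof. by rewrite /cnab (cgamC Y X) opprD addrACA subrr addr0. Qed.
Let cmetric X Y Z : cder X (cinn Y Z) = cinn (cnab X Y) Z + cinn Y (cnab X Z).
Proof.
rewrite cder_inn /cnab (cinnC Y (_ + _)) !cinnDl (cinnC Y (cvec X Z)) !cinn_gam.
rewrite (dmetricC X Z Y).
(* The two Christoffel terms add up to [h + h] times [dmetric X Y Z]; their other parts cancel. *)
rewrite -[X in _ + X = _]mul1r -hP; ring.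
Qed.

Definition coordinate_levi_civita : levi_civita V :=
  LeviCivita hP cderDl cderZl cderDr cderM cder_br cjacobi cinnC cinnDl cinnZl
    cinn_ext cnabDl cnabZl cnabDr cnabZr ctorsion cmetric.

End CoordinateConnection.

(** * Curvature in an adapted frame *)

Section Frame3.
Variables (S : comPzRingType) (V : lmodType S) (L : levi_civita V).
Local Notation der := (der L).
Local Notation br := (br L).
Local Notation nab := (nab L).
Local Notation inn := (inn L).
Local Notation half := (half L).

Variables (e1 e2 U : V) (al be v sg m1 m2 : S).
Hypothesis i11 : inn e1 e1 = 1.
Hypothesis i22 : inn e2 e2 = 1.
Hypothesis iUU : inn U U = 1.
Hypothesis i12 : inn e1 e2 = 0.
Hypothesis i1U : inn e1 U = 0.
Hypothesis i2U : inn e2 U = 0.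
Hypothesis frame_complete : forall X,
  X = inn X e1 *: e1 + inn X e2 *: e2 + inn X U *: U.
Hypothesis b12 : br e1 e2 = al *: e1 + be *: e2 + (v + v) *: U.
Hypothesis bU1 : br U e1 = sg *: e1 - m1 *: U.
Hypothesis bU2 : br U e2 = sg *: e2 - m2 *: U.

Let i21 : inn e2 e1 = 0. Proof. by rewrite innC. Qed.
Let iU1 : inn U e1 = 0. Proof. by rewrite innC. Qed.
Let iU2 : inn U e2 = 0. Proof. by rewrite innC. Qed.
Let b21 : br e2 e1 = - (al *: e1 + be *: e2 + (v + v) *: U).
Proof. by rewrite brC b12. Qed.
Let b1U : br e1 U = - (sg *: e1 - m1 *: U).
Proof. by rewrite brC bU1. Qed.
Let b2U : br e2 U = - (sg *: e2 - m2 *: U).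
Proof. by rewrite brC bU2. Qed.
Let b11 X : br X X = 0. Proof. by rewrite brE subrr. Qed.
Definition fib := (b11, b12, b21, b1U, bU1, b2U, bU2).
Definition fii := (i11, i22, iUU, i12, i21, i1U, iU1, i2U, iU2).
Definition f0E := (nab0l, nab0r, inn0l, inn0r, der0l, der0r, der1, scale0r, mulr0, mul0r, mulr1,
  mul1r, add0r, addr0, oppr0).

Local Ltac connection :=
  rewrite [LHS]frame_complete; congr (_ *: _ + _ *: _ + _ *: _);
  apply: (double_inj L); rewrite koszul !(fib, fii, innE, f0E); ring.

(** The inner products of the frame are constant, so only structure functions survive in Koszul's
    formula. By [nabUU], [m1] and [m2] are the components of the mean curvature. *)
Lemma nab11 : nab e1 e1 = 0 *: e1 + (- al) *: e2 + sg *: U.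
Proof. connection. Qed.
Lemma nab12 : nab e1 e2 = al *: e1 + 0 *: e2 + v *: U.
Proof. connection. Qed.
Lemma nab1U : nab e1 U = (- sg) *: e1 + (- v) *: e2 + 0 *: U.
Proof. connection. Qed.
Lemma nab21 : nab e2 e1 = 0 *: e1 + (- be) *: e2 + (- v) *: U.
Proof. connection. Qed.
Lemma nab22 : nab e2 e2 = be *: e1 + 0 *: e2 + sg *: U.
Proof. connection. Qed.
Lemma nab2U : nab e2 U = v *: e1 + (- sg) *: e2 + 0 *: U.
Proof. connection. Qed.
Lemma nabU1 : nab U e1 = 0 *: e1 + (- v) *: e2 + (- m1) *: U.
Proof. connection. Qed.
Lemma nabU2 : nab U e2 = v *: e1 + 0 *: e2 + (- m2) *: U.
Proof. connection. Qed.
Lemma nabUU : nab U U = m1 *: e1 + m2 *: e2 + 0 *: U.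
Proof. connection. Qed.
Definition fin := (nab11, nab12, nab1U, nab21, nab22, nab2U, nabU1, nabU2, nabUU).

Local Notation mu := (nab U U).
Local Notation th := (inn U).
Local Notation Om := (dform L th).
Definition frame3 (i : 'I_3) : V := nth 0 [:: e1; e2; U] i.
Local Notation Ric := (ricci_frame L frame3).

Definition frame_codiff Y : S :=
  - \sum_i nab_form L Om (frame3 i) (frame3 i) Y.

Let sum3 (F : V -> S) : \sum_i F (frame3 i) = F e1 + F e2 + F U.
Proof. by rewrite !big_ord_recl big_ord0 addr0 /= addrA. Qed.

(** Linearity over functions, that is tensoriality, reduces an identity to the nine pairs of frame
    vectors. *)
Lemma frame_ext (B C : V -> V -> S) : bilinf B -> bilinf C ->
  (forall i j, B (frame3 i) (frame3 j) = C (frame3 i) (frame3 j)) ->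
  forall Y Z, B Y Z = C Y Z.
Proof.
move=> [B1 B2] [C1 C2] E Y Z.
have comb X : X = \sum_i inn X (frame3 i) *: frame3 i.
  by rewrite !big_ord_recl big_ord0 addr0 addrA /=; exact: frame_complete.
by rewrite (comb Y) (comb Z) !bilinf_comb //; apply: eq_bigr => i _;
  apply: eq_bigr => j _; rewrite E.
Qed.

(** The [U] component of the Jacobi identity for [U], [e1], [e2], which expresses d(d theta) = 0 on
    the frame. *)
Let jac : der U v *+ 2 = v * sg *+ 4 - der e1 m2 + der e2 m1
   + al * m1 + be * m2.
Proof.
have := congr1 (inn^~ U) (jacobi L U e1 e2).
rewrite !(fib, brDr, brZr, brNr, innE, fii, f0E, derDr) => H.
apply: (addIr (- (v * sg *+ 4 - der e1 m2 + der e2 m1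
   + al * m1 + be * m2))); rewrite subrr -[RHS]H; ring.
Qed.

Local Ltac expand :=
  rewrite ?fib ?fin ?scale0r ?add0r ?addr0 ?nabE ?fin ?scale0r ?add0r ?addr0
    ?(innE, innDr, innZr, innNr) ?fii ?derE ?f0E.
Local Ltac ricc := rewrite /ricci_frame (sum3 (fun X => inn (riem L X _ _) X)) /riem;
  expand.

Lemma Ric11 : Ric e1 e1 = der e1 be - der e2 al - al * al - be * be - sg * sg *+ 2
  - v * v *+ 2 + der e1 m1 + al * m2 + der U sg - m1 * m1.
Proof. ricc; ring. Qed.
Lemma Ric22 : Ric e2 e2 = der e1 be - der e2 al - al * al - be * be - sg * sg *+ 2
  - v * v *+ 2 + der e2 m2 - be * m1 + der U sg - m2 * m2.
Proof. ricc; ring. Qed.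
Lemma RicUU : Ric U U = der e1 m1 + der e2 m2 + al * m2 - be * m1 + der U sg *+ 2
  + v * v *+ 2 - sg * sg *+ 2 - m1 * m1 - m2 * m2.
Proof. ricc; ring. Qed.
(** The trace produces [der U v], which has no counterpart in the result; [jac] trades it for
    horizontal derivatives of [m1] and [m2]. *)
Lemma Ric12 : Ric e1 e2 *+ 2 =
  der e1 m2 + der e2 m1 - al * m1 + be * m2 - m1 * m2 *+ 2.
Proof. ricc; ring: jac. Qed.
Lemma Ric21 : Ric e2 e1 *+ 2 =
  der e1 m2 + der e2 m1 - al * m1 + be * m2 - m1 * m2 *+ 2.
Proof.
(* In this order of the arguments [der U v] occurs with the opposite sign, and the relation is
   supplied in that form. *)
have jacN : - (der U v *+ 2) = - (v * sg *+ 4 - der e1 m2 + der e2 m1 + al * m1 + be * m2).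
  by rewrite jac.
ricc; ring: jacN.
Qed.
Lemma Ric1U : Ric e1 U = der e1 sg - der e2 v + v * m2 *+ 2.
Proof. ricc; ring. Qed.
Lemma Ric2U : Ric e2 U = der e2 sg + der e1 v - v * m1 *+ 2.
Proof. ricc; ring. Qed.
Lemma RicU1 : Ric U e1 = - der e2 v + m1 * sg + der U be - sg * be + v * m2 *+ 2.
Proof. ricc; ring. Qed.
Lemma RicU2 : Ric U e2 = der e1 v + m2 * sg - der U al + sg * al - v * m1 *+ 2.
Proof. ricc; ring. Qed.

Lemma OmE Y Z : Om Y Z = inn (nab Y U) Z - inn (nab Z U) Y.
Proof. rewrite /dform !metric_compat brE innDr innNr; ring. Qed.

Local Ltac codiffc := rewrite /frame_codiff
  (sum3 (fun X => nab_form L Om X X _)) /nab_form !OmE; expand; ring.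

Lemma codiff1 : frame_codiff e1 = - der e2 v *+ 2 + sg * m1 - der U m1 + v * m2 *+ 2.
Proof. codiffc. Qed.
Lemma codiff2 : frame_codiff e2 = der e1 v *+ 2 + sg * m2 - der U m2 - v * m1 *+ 2.
Proof. codiffc. Qed.
Lemma codiffU : frame_codiff U =
  der e1 m1 + der e2 m2 + al * m2 - be * m1 + v * v *+ 4.
Proof. codiffc. Qed.

Lemma lie_mu11 : lie_g L mu e1 e1 = (der e1 m1 + al * m2) *+ 2.
Proof. rewrite /lie_g; expand; ring. Qed.
Lemma lie_mu22 : lie_g L mu e2 e2 = (der e2 m2 - be * m1) *+ 2.
Proof. rewrite /lie_g; expand; ring. Qed.
Lemma lie_mu12 : lie_g L mu e1 e2 = der e1 m2 + der e2 m1 - al * m1 + be * m2.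
Proof. rewrite /lie_g; expand; ring. Qed.
Lemma lie_mu1U : lie_g L mu e1 U = der U m1 + v * m2 *+ 2 + sg * m1.
Proof. rewrite /lie_g; expand; ring. Qed.
Lemma lie_mu2U : lie_g L mu e2 U = der U m2 - v * m1 *+ 2 + sg * m2.
Proof. rewrite /lie_g; expand; ring. Qed.
Lemma lie_muUU : lie_g L mu U U = - (m1 * m1 + m2 * m2) *+ 2.
Proof. rewrite /lie_g; expand; ring. Qed.
Lemma lie_gC X Y Z : lie_g L X Y Z = lie_g L X Z Y.
Proof. by rewrite /lie_g (innC L _ Z) (innC L Y) addrC. Qed.

Definition frame_laplacian f := \sum_i hess L f (frame3 i) (frame3 i).
Lemma frame_laplacianE f : frame_laplacian f =
  der e1 (der e1 f) + der e2 (der e2 f) + der U (der U f) + al * der e2 f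
  - be * der e1 f - sg * der U f *+ 2 - m1 * der e1 f - m2 * der e2 f.
Proof.
rewrite /frame_laplacian (sum3 (fun X => hess L f X X)) /hess; expand; ring.
Qed.

(** On horizontal fields the form theta of a bracket is minus d theta, because theta vanishes on
    both. This shows the left side to be linear over functions, after which the frame decides. *)
Lemma vertical_bracket Y Z : th (br (Y - th Y *: U) (Z - th Z *: U)) =
  (v + v) * (inn Y e1 * inn Z e2 - inn Y e2 * inn Z e1).
Proof.
pose hp X := X - th X *: U.
have hpD X X' : hp (X + X') = hp X + hp X'.
  by rewrite /hp innDr scalerDl opprD addrACA.
have hpZ a X : hp (a *: X) = a *: hp X.
  by rewrite /hp innZr scalerBr scalerA.
have th_hp X : th (hp X) = 0 by rewrite /hp innDr innNr innZr iUU mulr1 subrr.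
pose B Y' Z' := th (br (hp Y') (hp Z')).
pose C Y' Z' := (v + v) * (inn Y' e1 * inn Z' e2 - inn Y' e2 * inn Z' e1).
rewrite -[LHS]/(B Y Z) -[RHS]/(C Y Z).
have BO Y' Z' : B Y' Z' = - Om (hp Y') (hp Z').
  by rewrite /B /dform !th_hp !der0r; ring.
have [Om1 Om2] := bilinf_dform L (linf_inn_r L U).
apply: frame_ext.
- split=> X; split=> [X1 X2|a X1]; rewrite !BO.
  + by rewrite hpD (Om1 _).1; ring.
  + by rewrite hpZ (Om1 _).2; ring.
  + by rewrite hpD (Om2 _).1; ring.
  + by rewrite hpZ (Om2 _).2; ring.
- apply: bilinfM; apply: bilinfD; last apply: bilinfN;
    exact: bilinf_tensor (linf_inn_l L _) (linf_inn_l L _).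
have hp1 : hp e1 = e1 by rewrite /hp iU1 scale0r subr0.
have hp2 : hp e2 = e2 by rewrite /hp iU2 scale0r subr0.
have hpU : hp U = 0 by rewrite /hp iUU scale1r subrr.
have br0l X : br 0 X = 0 by rewrite brE nab0l nab0r subrr.
have br0r X : br X 0 = 0 by rewrite brE nab0l nab0r subrr.
by move=> [[|[|[|//]]] ?] [[|[|[|//]]] ?];
  rewrite /B /C /frame3 /= ?hp1 ?hp2 ?hpU ?br0l ?br0r !(fib, innDr, innNr, innZr, inn0r, fii);
  ring.
Qed.

(** Semi-conformality enters through [bU1] and [bU2]: the flow of [U] scales the horizontal metric
    at the rate [-2 sg], without shear. Hence the terms of the theorem that involve [f]. *)
Lemma lie_vertical f Y Z : lie_g L (f *: U) Y Z =
  - (f * sg *+ 2 * (inn Y Z - th Y * th Z))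
  + ((der Y f + f * inn mu Y) * th Z + th Y * (der Z f + f * inn mu Z)).
Proof.
have Lth := linf_inn_r L U; have Lmu := linf_inn_r L mu.
have -> : lie_g L (f *: U) Y Z = f * lie_g L U Y Z + der Y f * th Z + der Z f * th Y.
  exact: lie_gZ.
pose C Y' Z' := - (sg *+ 2 * (inn Y' Z' - th Y' * th Z'))
    + (inn mu Y' * th Z' + th Y' * inn mu Z').
have -> : lie_g L U Y Z = C Y Z; last by rewrite /C; ring.
apply: frame_ext; first exact: bilinf_lie.
  have Bi := bilinf_inn L.
  repeat first [exact: Bi | apply: bilinfD | apply: bilinfN
    | apply: bilinfM | exact: bilinf_tensor].
by move=> [[|[|[|//]]] ?] [[|[|[|//]]] ?]; rewrite /C /frame3 /lie_g /=; expand; ring.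
Qed.

(* [l] is the logarithm of the dilation [lam]; [a], [b] are the structure
   functions of an orthonormal frame of the base, constant along the fibres, and
   [a2], [b1] their derivatives in that frame. *)
Variables (l lam a b a2 b1 : S).
Hypothesis sgE : sg = der U l.
Hypothesis alE : al = lam * a - der e2 l.
Hypothesis beE : be = lam * b + der e1 l.
Hypothesis dlam : forall X, der X lam = lam * der X l.
Hypothesis dUa : der U a = 0.
Hypothesis dUb : der U b = 0.
Hypothesis d2a : der e2 a = lam * a2.
Hypothesis d1b : der e1 b = lam * b1.

Let K := b1 - a2 - a * a - b * b.

(** The tensor of the theorem for zero [f], [X] and [A], plus half the Lie derivative along [mu],
    which changes sides because the soliton field contains [- mu]. The term [v * v *+ 2] is a
    quarter of 8 v^2. *)
Definition fibred_ricci Y Z : S :=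
  (lam * lam * K + frame_laplacian l + der mu l) * (inn Y Z - th Y * th Z)
  - v * v *+ 2 * inn Y Z + half * lie_g L mu Y Z
  - (inn mu Y + sg * th Y) * (inn mu Z + sg * th Z) - (sg * th Y) * (sg * th Z)
  + half * ((der Y sg *+ 2 + frame_codiff Y) * th Z
            + th Y * (der Z sg *+ 2 + frame_codiff Z)).

Lemma bilinf_fibred_ricci : bilinf fibred_ricci.
Proof.
have Lth := linf_inn_r L U; have Lmu := linf_inn_r L mu.
have Lds := linf_der L sg.
have Lco : linf frame_codiff.
  apply: linfN; apply: linf_sum => i; apply: linf_nab_form3.
  exact/bilinf_dform/linf_inn_r.
have Lsg : linf (fun X => sg * th X) by exact: linfM.
have Lms : linf (fun X => inn mu X + sg * th X) by exact: linfD.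
have LF : linf (fun X => der X sg *+ 2 + frame_codiff X).
  by apply: linfD => //; apply: linfD.
have Bi := bilinf_inn L.
repeat first [exact: Bi | exact: bilinf_lie | apply: bilinfD | apply: bilinfN
  | apply: bilinfM | exact: bilinf_tensor].
Qed.

(** Each frame component becomes a polynomial identity once the derivatives of [al] and [be] are
    expanded. Those along [U] are needed only when [U] is the first argument and the second is
    horizontal: there [a] and [b] are constant along the fibres, and [U] is moved past [e1] and [e2]
    on [l] by the brackets. *)
Theorem ricci_frameE Y Z : Ric Y Z = fibred_ricci Y Z.
Proof.
apply: frame_ext; [exact: bilinf_ricci|exact: bilinf_fibred_ricci|].
have dX X : der X (lam * lam) = (lam * lam * der X l) *+ 2.
  by rewrite derM dlam; ring.
have d1be : der e1 be = lam * der e1 l * b + lam * (lam * b1) + der e1 (der e1 l).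
  by rewrite beE derDr derM dlam d1b.
have d2al : der e2 al = lam * der e2 l * a + lam * (lam * a2) - der e2 (der e2 l).
  by rewrite alE derDr derNr derM dlam d2a.
have cU1 : der U (der e1 l) = der e1 sg + sg * der e1 l - m1 * sg.
  have := der_br L U e1 l; rewrite bU1 derDl derNl !derZl -sgE => /eqP.
  by rewrite eq_sym subr_eq => /eqP ->; ring.
have cU2 : der U (der e2 l) = der e2 sg + sg * der e2 l - m2 * sg.
  have := der_br L U e2 l; rewrite bU2 derDl derNl !derZl -sgE => /eqP.
  by rewrite eq_sym subr_eq => /eqP ->; ring.
have dUbe : der U be = lam * sg * b + der e1 sg + sg * der e1 l - m1 * sg.
  by rewrite beE derDr derM dlam dUb cU1 -sgE; ring.
have dUal : der U al = lam * sg * a - (der e2 sg + sg * der e2 l - m2 * sg).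
  by rewrite alE derDr derNr derM dlam dUa cU2 -sgE; ring.
(* Components are compared after doubling, so that [half] disappears from its two places, the Lie
   derivative along [mu] and the symmetric product with theta. *)
have halve x A B C D P Q : x *+ 2 = (A - B - C - D) *+ 2 + P + Q ->
    x = A - B + half * P - C - D + half * Q.
  move=> E; apply: (double_inj L); rewrite -[x + x]mulr2n E.
  rewrite -[in LHS](mul1r P) -[in LHS](mul1r Q) -(halfP L); ring.
have muE f : der mu f = m1 * der e1 f + m2 * der e2 f.
  by rewrite nabUU !(derDl, derZl) mul0r addr0.
have mu1 : inn mu e1 = m1 by rewrite nabUU !innE !fii; ring.
have mu2 : inn mu e2 = m2 by rewrite nabUU !innE !fii; ring.
have muU : inn mu U = 0 by rewrite nabUU !innE !fii; ring.
move=> [[|[|[|//]]] ?] [[|[|[|//]]] ?]; rewrite /frame3 /=; apply: halve.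
- rewrite Ric11 lie_mu11 !(frame_laplacianE, muE, mu1, mu2, muU, fii) -!sgE.
  by rewrite d1be d2al alE beE /K; ring.
- by rewrite Ric12 lie_mu12 mu1 mu2 !fii; ring.
- rewrite Ric1U lie_mu1U codiff1 mu1 muU !fii; ring.
- by rewrite Ric21 lie_gC lie_mu12 mu1 mu2 !fii; ring.
- rewrite Ric22 lie_mu22 !(frame_laplacianE, muE, mu1, mu2, muU, fii) -!sgE.
  by rewrite d1be d2al alE beE /K; ring.
- rewrite Ric2U lie_mu2U codiff2 mu2 muU !fii; ring.
- rewrite RicU1 lie_gC lie_mu1U codiff1 mu1 muU !fii dUbe beE; ring.
- rewrite RicU2 lie_gC lie_mu2U codiff2 mu2 muU !fii dUal alE; ring.
- rewrite RicUU lie_muUU codiffU muU !fii; ring.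
Qed.

End Frame3.

(** * Curvature of a surface in an orthonormal frame *)

Section Frame2.
Variables (S : comPzRingType) (V : lmodType S) (L : levi_civita V).
Local Notation der := (der L).
Local Notation br := (br L).
Local Notation nab := (nab L).
Local Notation inn := (inn L).

(** The bracket acts on the function [inn Z W] as a commutator; expanding both sides by metric
    compatibility leaves the two curvature terms. *)
Lemma riem_skew X Y Z W : inn (riem L X Y Z) W = - inn (riem L X Y W) Z.
Proof.
have := der_br L X Y (inn Z W).
rewrite /riem !(innE, derDr, metric_compat L) (innC L (nab _ Z) (nab _ W)).
rewrite (innC L Z (nab X (nab Y W))) (innC L Z (nab Y (nab X W))) (innC L Z (nab _ W)).
move=> /eqP; rewrite -subr_eq0 => /eqP H.
apply: (addIr (inn (nab X (nab Y W) - nab Y (nab X W) - nab (br X Y) W) Z)).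
rewrite !innE addNr -[RHS]oppr0 -[in RHS]H; ring.
Qed.

Variables (f1 f2 : V) (a b : S).
Hypothesis i11 : inn f1 f1 = 1.
Hypothesis i22 : inn f2 f2 = 1.
Hypothesis i12 : inn f1 f2 = 0.
Hypothesis frame_complete : forall X, X = inn X f1 *: f1 + inn X f2 *: f2.
Hypothesis b12 : br f1 f2 = a *: f1 + b *: f2.

Let i21 : inn f2 f1 = 0. Proof. by rewrite innC. Qed.
Let b21 : br f2 f1 = - (a *: f1 + b *: f2). Proof. by rewrite brC b12. Qed.
Let b11 X : br X X = 0. Proof. by rewrite brE subrr. Qed.

Local Ltac connection :=
  rewrite [LHS]frame_complete; congr (_ *: _ + _ *: _);
  apply: (double_inj L);
  rewrite koszul !(b11, b12, b21, i11, i12, i21, i22, innE, f0E); ring.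

Lemma surface_curvature : inn (riem L f1 f2 f2) f1 =
  der f1 b - der f2 a - a * a - b * b.
Proof.
have n12 : nab f1 f2 = a *: f1 + 0 *: f2 by connection.
have n21 : nab f2 f1 = 0 *: f1 + (- b) *: f2 by connection.
have n11 : nab f1 f1 = 0 *: f1 + (- a) *: f2 by connection.
have n22 : nab f2 f2 = b *: f1 + 0 *: f2 by connection.
rewrite /riem !(b12, n11, n12, n21, n22, nabE, innE, i11, i12, i21, i22, f0E, derE).
ring.
Qed.

End Frame2.

(** * Riemannian geometry in a chart *)

Section OrthonormalTrace.
Variables (S : comPzRingType) (n : nat) (G G' : 'M[S]_n).
Hypothesis GG' : G *m G' = 1%:M.

(* The rows of [E] are orthonormal for [G] iff [E^T E] is the inverse of [G]. *)
Lemma orthonormal_trace (E : 'M[S]_n) (B : 'rV[S]_n -> 'rV[S]_n -> S) :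
  E *m G *m E^T = 1%:M -> bilinf B ->
  \sum_k B (row k E) (row k E) =
  \sum_a \sum_b G' a b * B (delta_mx 0 a) (delta_mx 0 b).
Proof.
move=> EGE BB.
have EtE : E^T *m E = G'.
  have H := mulmx1C EGE; rewrite mulmxA in H.
  by rewrite -[LHS]mulmx1 -GG' mulmxA H mul1mx.
have -> : \sum_k B (row k E) (row k E) = \sum_k \sum_a \sum_b
    E k a * E k b * B (delta_mx 0 a) (delta_mx 0 b).
  apply: eq_bigr => k _; rewrite {1 2}(row_sum_delta (row k E)) bilinf_comb //.
  by apply: eq_bigr => a _; apply: eq_bigr => b _; rewrite !mxE.
rewrite exchange_big; apply: eq_bigr => a _ /=.
rewrite exchange_big; apply: eq_bigr => b _ /=.
rewrite -EtE mxE big_distrl; apply: eq_bigr => k _ /=.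
by rewrite mxE.
Qed.

Lemma linf_delta (F : 'rV[S]_n -> S) X : linf F ->
  F X = \sum_k X 0 k * F (delta_mx 0 k).
Proof. by move=> LF; rewrite {1}(row_sum_delta X) linf_comb. Qed.

End OrthonormalTrace.

Section ManifoldChart.
Variables (R : realType) (n : nat) (M : manifold R n).

Lemma chart_inv_near (i : chart M) p : chart_dom i p ->
  \forall v \near chart_map i p,
    chart_dom i (chart_inv i v) /\ chart_map i (chart_inv i v) = v.
Proof.
move=> Dp; have : nbhs (chart_map i p) (chart_map i @` chart_dom i).
  by apply: open_nbhs_nbhs; split; [exact: chart_image_open|exists p].
by apply: filterS => _ [q Dq <-]; rewrite chart_mapK.
Qed.

Variables (i : chart M) (O : set M).
Hypothesis O_open : open O.

Lemma chart_inv_near_in p : (chart_dom i `&` O) p ->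
  \forall v \near chart_map i p,
    (chart_dom i `&` O) (chart_inv i v) /\ chart_map i (chart_inv i v) = v.
Proof.
move=> [Dp Op].
have nO : \forall v \near chart_map i p, O (chart_inv i v).
  apply: (chart_inv_continuous (imageP _ Dp)); rewrite chart_mapK //.
  by apply: open_nbhs_nbhs; split.
by apply: filterS2 (chart_inv_near Dp) nO => v [Dv ->] Ov.
Qed.

(** [O] is the whole space, the preimage under [phi] of a chart domain of the base, or the domain of
    a second chart, so that another coordinate system is at hand throughout. *)
Definition chart_on : local_chart R n M :=
  LocalChart (openI (chart_dom_open i) O_open)
    (fun p Dp => chart_mapK Dp.1) chart_inv_near_in
    (fun p Dp => chart_map_continuous Dp.1)
    (fun p Dp => chart_inv_continuous (imageP _ Dp.1)).

End ManifoldChart.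

Lemma smooth_coord_subset (R : realType) (n : nat) (T : topologicalType)
    (x : T -> 'rV[R]_n) y (D D' : set T) f :
  D' `<=` D -> smooth_coord x y D f -> smooth_coord x y D' f.
Proof. by move=> sDD sf w p /sDD; exact: sf. Qed.

(** * From pointwise tensors to tensors over the ring of smooth functions *)

Section Geometry.
Variables (R : realType) (n : nat) (M : manifold R n).
Variables (g : chart M -> M -> 'M[R]_n) (i : chart M) (c : local_chart R n M).
Hypothesis lmapE : lmap c = chart_map i.
Hypothesis linvE : linv c = chart_inv i.
Local Notation D := (ldom c).
Local Notation S := (smooth_fun c).
Local Notation V := 'rV[S]_n.

Definition evalv p m k (A : 'M[S]_(m, k)) : 'M[R]_(m, k) := map_mx (eval p) A.
Definition constv m k (A : 'M[R]_(m, k)) : 'M[S]_(m, k) := map_mx (@sf_cst _ _ _ c) A.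

Lemma evalv_mul p m k l (A : 'M[S]_(m, k)) (B : 'M[S]_(k, l)) :
  evalv p (A *m B) = evalv p A *m evalv p B.
Proof.
apply/matrixP => a b; rewrite !mxE raddf_sum.
by apply: eq_bigr => d _ /=; rewrite /= evalM !mxE.
Qed.

Lemma evalv_tr p m k (A : 'M[S]_(m, k)) : evalv p A^T = (evalv p A)^T.
Proof. by rewrite /evalv map_trmx. Qed.

Lemma evalvD p m k (A B : 'M[S]_(m, k)) : evalv p (A + B) = evalv p A + evalv p B.
Proof. by apply/matrixP => a b; rewrite !mxE evalD. Qed.
Lemma evalvN p m k (A : 'M[S]_(m, k)) : evalv p (- A) = - evalv p A.
Proof. by apply/matrixP => a b; rewrite !mxE evalN. Qed.
Lemma evalvZ p m k a (A : 'M[S]_(m, k)) : evalv p (a *: A) = eval p a *: evalv p A.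
Proof. by apply/matrixP => x y; rewrite !mxE evalM. Qed.

Lemma evalv1 p m : D p -> evalv p (1%:M : 'M[S]_m) = 1%:M.
Proof.
move=> Dp; apply/matrixP => a b; rewrite !mxE.
by case: (a == b); [exact: eval1|exact: raddf0].
Qed.

Lemma evalv_const p m k (A : 'M[R]_(m, k)) : D p -> evalv p (constv A) = A.
Proof. by move=> Dp; apply/matrixP => a b; rewrite !mxE eval_cst. Qed.

Lemma evalv_ext m k (A B : 'M[S]_(m, k)) :
  (forall p, D p -> evalv p A = evalv p B) -> A = B.
Proof.
move=> E; apply/matrixP => a b; apply: eval_eq => p Dp.
by have /matrixP/(_ a b) := E p Dp; rewrite !mxE.
Qed.

Lemma constv_delta a : constv (delta_mx 0 a : 'rV[R]_n) = delta_mx 0 a.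
Proof.
by apply/rowP => b; rewrite !mxE; case: (_ && _).
Qed.

(** [F] is an expression as in the definitions, arbitrary off the domain, and [X] its counterpart in
    the module. Every differential operator is carried over by a lemma on represented fields. *)
Definition repr_field (F : M -> 'rV[R]_n) (X : V) := forall q, D q -> F q = evalv q X.
Definition repr_fun (f : M -> R) (F : S) := forall q, D q -> f q = eval q F.

Lemma repr_coord F X k : repr_field F X -> repr_fun (fun q => F q 0 k) (X 0 k).
Proof. by move=> FX q Dq; rewrite FX // mxE. Qed.

Lemma repr_const y : repr_field (cst y) (constv y).
Proof. by move=> q Dq; rewrite evalv_const. Qed.

Lemma repr_pd k f F : repr_fun f F -> repr_fun (pd i k f) (sf_partial k F).
Proof.
move=> fF q Dq; rewrite (eval_partial_on k Dq fF).
by rewrite /pd lmapE linvE.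
Qed.

Local Notation Der := (cder (@sf_partial R n M c)).
Local Notation Br := (cbr (@sf_partial R n M c)).

Lemma repr_deriv F X f h : repr_field F X -> repr_fun f h ->
  repr_fun (deriv_along i F f) (Der X h).
Proof.
move=> FX fh q Dq; rewrite /deriv_along /cder raddf_sum; apply: eq_bigr => k _ /=.
by rewrite evalM -(repr_pd k fh Dq) FX // mxE.
Qed.

Lemma repr_bracket F X F' X' : repr_field F X -> repr_field F' X' ->
  repr_field (bracket i F F') (Br X X').
Proof.
move=> FX FX' q Dq; apply/rowP => b; rewrite !mxE.
rewrite (repr_deriv FX (repr_coord b FX') Dq) (repr_deriv FX' (repr_coord b FX) Dq).
by rewrite -raddfB.
Qed.

Variables (G G' : 'M[S]_n).
Hypothesis GE : forall p, D p -> evalv p G = g i p.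
Hypothesis G_sym : G^T = G.
Hypothesis GG' : G *m G' = 1%:M.

Local Notation hf := (sf_cst c 2^-1).
Lemma half_half : hf + hf = 1 :> S.
Proof.
apply: eval_eq => p Dp; rewrite raddfD /= eval_cst // eval1 //.
lra.
Qed.

Definition smooth_lc : levi_civita V :=
  coordinate_levi_civita (D := @sf_partial R n M c) (@sf_partialM R n M c)
   (@sf_partialC R n M c) G_sym GG' half_half.
Local Notation L := smooth_lc.

Lemma invmxE p : D p -> invmx (g i p) = evalv p G'.
Proof.
move=> Dp; have H : g i p *m evalv p G' = 1%:M.
  by rewrite -GE // -evalv_mul GG' evalv1.
have [u _] := mulmx1_unit H.
by rewrite -[RHS]mul1mx -(mulVmx u) -mulmxA H mulmx1.
Qed.

Lemma repr_g a b : repr_fun (fun q => g i q a b) (G a b).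
Proof. by move=> q Dq; rewrite -GE // mxE. Qed.

Lemma repr_christoffel e a b : repr_fun (christoffel g i e a b)
  (cchr (@sf_partial R n M c) G G' hf e a b).
Proof.
move=> q Dq; rewrite /christoffel /cchr evalM eval_cst //; congr (_ * _).
rewrite raddf_sum; apply: eq_bigr => d _ /=; rewrite invmxE // mxE evalM.
rewrite raddfB raddfD /=.
by rewrite (repr_pd a (repr_g b d) Dq) (repr_pd b (repr_g a d) Dq) (repr_pd d (repr_g a b) Dq).
Qed.

Lemma repr_nabla F X F' X' : repr_field F X -> repr_field F' X' ->
  repr_field (nabla g i F F') (nab L X X').
Proof.
move=> FX FX' q Dq; apply/rowP => e; rewrite !mxE raddfD /=; congr (_ + _).
  by rewrite (repr_deriv FX (repr_coord e FX') Dq).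
rewrite raddf_sum; apply: eq_bigr => a _ /=.
rewrite raddf_sum; apply: eq_bigr => b _ /=.
by rewrite !evalM (repr_christoffel e a b Dq) FX // FX' // !mxE /cchr evalM.
Qed.

Lemma repr_riemann F X F' X' F'' X'' :
  repr_field F X -> repr_field F' X' -> repr_field F'' X'' ->
  repr_field (riemann g i F F' F'') (riem L X X' X'').
Proof.
move=> H H' H'' q Dq; rewrite /riemann /riem /evalv !raddfB /=.
rewrite (repr_nabla H (repr_nabla H' H'') Dq) (repr_nabla H' (repr_nabla H H'') Dq).
by rewrite (repr_nabla (repr_bracket H H') H'' Dq).
Qed.

Lemma repr_inner F X F' X' : repr_field F X -> repr_field F' X' ->
  repr_fun (fun q => inner (g i q) (F q) (F' q)) (inn L X X').
Proof.
move=> H H' q Dq; rewrite /inner H // H' // -GE // -evalv_tr -!evalv_mul.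
by rewrite mxE.
Qed.

Lemma inner_const p y z : D p ->
  inner (g i p) y z = eval p (inn L (constv y) (constv z)).
Proof. by move=> Dp; rewrite -(repr_inner (repr_const y) (repr_const z) Dp). Qed.

Lemma lie_metricE F X p y z : repr_field F X -> D p ->
  lie_metric g i F p y z = eval p (lie_g L X (constv y) (constv z)).
Proof.
move=> H Dp; rewrite -lie_gE !raddfB /=; congr (_ - _ - _).
- by rewrite (repr_deriv H (repr_inner (repr_const y) (repr_const z)) Dp).
- exact: (repr_inner (repr_bracket H (repr_const y)) (repr_const z) Dp).
- exact: (repr_inner (repr_const y) (repr_bracket H (repr_const z)) Dp).
Qed.

(** A form that is linear over functions depends on [X] only through its value at [p], which may
    then be extended by constant components, as the pointwise definitions do. *)
Lemma linf_local (F : V -> S) X p : linf F -> D p ->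
  eval p (F X) = eval p (F (constv (evalv p X))).
Proof.
move=> LF Dp; rewrite (linf_delta X LF) (linf_delta (constv _) LF) !raddf_sum.
by apply: eq_bigr => k _ /=; rewrite !evalM !mxE eval_cst.
Qed.

Lemma bilinf_local (B : V -> V -> S) X Y p : bilinf B -> D p ->
  eval p (B X Y) = eval p (B (constv (evalv p X)) (constv (evalv p Y))).
Proof.
by move=> [B1 B2] Dp; rewrite (linf_local _ (B1 Y)) // (linf_local Y (B2 _)).
Qed.

Lemma bilinf_eval (B : V -> V -> S) p : bilinf B -> D p ->
  bilinf (fun y z : 'rV[R]_n => eval p (B (constv y) (constv z))).
Proof.
move=> [B1 B2] Dp.
have cD (x y : 'rV[R]_n) : constv (x + y) = constv x + constv y.
  by apply/rowP => b; rewrite !mxE sf_cstD.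
have cZ a (x : 'rV[R]_n) : constv (a *: x) = sf_cst c a *: constv x.
  by apply/rowP => b; rewrite !mxE sf_cstM.
split=> y; split=> *; rewrite ?cD ?cZ.
- by rewrite (B1 _).1 raddfD.
- by rewrite (B1 _).2 evalM eval_cst.
- by rewrite (B2 _).1 raddfD.
- by rewrite (B2 _).2 evalM eval_cst.
Qed.

Lemma extdE (w : M -> 'rV[R]_n -> R) (W : V -> S) p y z : linf W ->
  (forall q x, D q -> w q x = eval q (W (constv x))) -> D p ->
  extd i w p y z = eval p (dform L W (constv y) (constv z)).
Proof.
move=> LW wW Dp; rewrite /extd /dform !raddfB /=; congr (_ - _ - _).
- by rewrite (repr_deriv (repr_const y) (h := W (constv z))) // => q Dq; rewrite wW.
- by rewrite (repr_deriv (repr_const z) (h := W (constv y))) // => q Dq; rewrite wW.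
rewrite wW // (linf_local (br L _ _)) //; congr (eval p (W (constv _))).
exact: (repr_bracket (repr_const y) (repr_const z) Dp).
Qed.

Lemma nabla2formE (w : M -> 'rV[R]_n -> 'rV[R]_n -> R) (W : V -> V -> S) p u y z :
  bilinf W -> (forall q x x', D q -> w q x x' = eval q (W (constv x) (constv x'))) ->
  D p ->
  nabla2form g i w p u y z = eval p (nab_form L W (constv u) (constv y) (constv z)).
Proof.
move=> [W1 W2] wW Dp; rewrite /nabla2form /nab_form !raddfB /=; congr (_ - _ - _).
- by rewrite (repr_deriv (repr_const u) (h := W (constv y) (constv z))) // => q Dq; rewrite wW.
- rewrite wW // (linf_local (nab L _ _) (W1 _)) //; congr (eval p (W (constv _) _)).
  exact: (repr_nabla (repr_const u) (repr_const y) Dp).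
- rewrite wW // (linf_local (nab L _ _) (W2 _)) //; congr (eval p (W _ (constv _))).
  exact: (repr_nabla (repr_const u) (repr_const z) Dp).
Qed.

Lemma hessianE f F p y z : repr_fun f F -> D p ->
  hessian g i f p y z = eval p (hess L F (constv y) (constv z)).
Proof.
move=> fF Dp; rewrite /hessian /hess raddfB /=; congr (_ - _).
  by rewrite (repr_deriv (repr_const y) (repr_deriv (repr_const z) fF) Dp).
exact: (repr_deriv (repr_nabla (repr_const y) (repr_const z)) fF Dp).
Qed.

Section OrthonormalFrame.
Variable E : 'I_n -> V.
Hypothesis E_onb : forall a b, inn L (E a) (E b) = (a == b)%:R.

Let Em : 'M[S]_n := \matrix_(a, b) E a 0 b.
Let rowEm k : row k Em = E k.
Proof. by apply/rowP => b; rewrite !mxE. Qed.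

Let EmG : Em *m G *m Em^T = 1%:M.
Proof.
apply/matrixP => a b; rewrite [RHS]mxE -E_onb -(rowEm a) -(rowEm b).
rewrite /inn /= /cinn -row_mul mxE [RHS]mxE; apply: eq_bigr => k _.
by rewrite !mxE; congr (_ * _); apply: eq_bigr => l _; rewrite !mxE.
Qed.

(** Over a commutative ring a one-sided inverse of a square matrix is two-sided, so [n] orthonormal
    fields are automatically a basis. *)
Lemma frame_expansion X : X = \sum_k inn L X (E k) *: E k.
Proof.
have H := mulmx1C EmG; rewrite mulmxA in H.
have H2 : G *m Em^T *m Em = 1%:M.
  have /(congr1 (fun A => A^T)) := H.
  by rewrite !trmx_mul trmxK G_sym trmx1 mulmxA.
rewrite -[LHS]mulmx1 -H2 2!mulmxA; apply/rowP => b.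
rewrite mxE summxE; apply: eq_bigr => k _ /=; rewrite !mxE; congr (_ * _).
rewrite /cinn -(rowEm k) [RHS]mxE; apply: eq_bigr => a _ /=.
by rewrite !mxE.
Qed.

(** The definition is a coordinate trace without a metric. The trace over an orthonormal frame is a
    contraction with the inverse Gram matrix, which undoes the lowering of the index in the inner
    product. *)
Lemma ricciE p y z : D p ->
  ricci g i p y z = eval p (ricci_frame L E (constv y) (constv z)).
Proof.
move=> Dp; rewrite /ricci_frame.
pose B (X Y : V) := inn L (riem L X (constv y) (constv z)) Y.
have BB : bilinf B.
  split=> X; last exact: linf_inn_r.
  split=> [Y Y'|a Y]; first by rewrite /B riemDl innDl.
  by rewrite /B riemZl innZl.
have -> : \sum_k inn L (riem L (E k) (constv y) (constv z)) (E k) =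
    \sum_k B (row k Em) (row k Em) by apply: eq_bigr => k _ /=; rewrite rowEm.
rewrite (orthonormal_trace GG' EmG BB) raddf_sum; apply: eq_bigr => a _ /=.
pose r := riem L (delta_mx 0 a) (constv y) (constv z).
have -> : riemann g i (cst (delta_mx 0 a)) (cst y) (cst z) p 0 a = eval p (r 0 a).
  rewrite (repr_riemann (repr_const _) (repr_const y) (repr_const z) Dp) constv_delta.
  by rewrite mxE.
congr (eval p _).
have G'sym : G'^T = G'.
  rewrite -[LHS]mulmx1 -GG' mulmxA -{1}G_sym -trmx_mul (GG') trmx1 mul1mx //.
rewrite -[r]mulmx1 -GG' mulmxA mxE; apply: eq_bigr => b _ /=.
rewrite /B -/r [inn L r _]cinn_delta mulrC; congr (_ * _).
by rewrite -[in LHS]G'sym mxE.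
Qed.

(** The values of [E] at [p] are a candidate, so [xget] does not fall back on its default. *)
Lemma onb_spec p : D p -> orthonormal_at g i p (onb g i p).
Proof.
move=> Dp; apply: (xgetPex _ (P := [set e | orthonormal_at g i p e])).
exists (fun k => evalv p (E k)) => a b.
rewrite (inner_const _ _ Dp) -(bilinf_local _ _ (bilinf_inn L) Dp) E_onb.
by case: (a == b); [exact: eval1|exact: raddf0].
Qed.

(** Both traces equal the contraction with the inverse Gram matrix; the basis chosen by [onb] may
    therefore vary with the point in an arbitrary way. *)
Lemma onb_trace (B : V -> V -> S) p : bilinf B -> D p ->
  \sum_k eval p (B (constv (onb g i p k)) (constv (onb g i p k))) =
  eval p (\sum_k B (E k) (E k)).
Proof.
move=> BB Dp.
have -> : \sum_k B (E k) (E k) = \sum_k B (row k Em) (row k Em).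
  by apply: eq_bigr => k _ /=; rewrite rowEm.
rewrite (orthonormal_trace GG' EmG BB).
pose u : 'M[R]_n := \matrix_(a, b) onb g i p a 0 b.
have ru k : row k u = onb g i p k by apply/rowP => b; rewrite !mxE.
have uGu : u *m g i p *m u^T = 1%:M.
  apply/matrixP => a b; rewrite [RHS]mxE -(onb_spec Dp) -!ru.
  rewrite /inner -row_mul mxE [RHS]mxE; apply: eq_bigr => k _.
  by rewrite !mxE; congr (_ * _); apply: eq_bigr => l _; rewrite !mxE.
have gg : g i p *m evalv p G' = 1%:M by rewrite -GE // -evalv_mul GG' evalv1.
under eq_bigr => k _ do rewrite -ru.
rewrite (orthonormal_trace gg uGu (bilinf_eval BB Dp)).
rewrite raddf_sum; apply: eq_bigr => a _ /=; rewrite raddf_sum; apply: eq_bigr => b _ /=.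
by rewrite evalM mxE !constv_delta.
Qed.

Lemma laplacianE f F p : repr_fun f F -> D p ->
  laplacian g i f p = eval p (\sum_k hess L F (E k) (E k)).
Proof.
move=> fF Dp; rewrite -(onb_trace (bilinf_hess L F) Dp); apply: eq_bigr => k _ /=.
exact: hessianE.
Qed.

Lemma codiffE (w : M -> 'rV[R]_n -> 'rV[R]_n -> R) (W : V -> V -> S) p y :
  bilinf W -> (forall q x x', D q -> w q x x' = eval q (W (constv x) (constv x'))) ->
  D p -> codiff g i w p y = eval p (- \sum_k nab_form L W (E k) (E k) (constv y)).
Proof.
move=> BW wW Dp; rewrite /codiff raddfN; congr (- _).
have BB := bilinf_nab_form12 L (constv y) BW.
have /= <- := onb_trace BB Dp; apply: eq_bigr => k _ /=.
exact: nabla2formE.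
Qed.

End OrthonormalFrame.

End Geometry.

Lemma posdef_det (R : realType) (n : nat) (A : 'M[R]_n) :
  (forall u, u != 0 -> 0 < inner A u u) -> \det A != 0.
Proof.
move=> Apos; apply/negP => /det0P [v v0 vA]; have := Apos v v0.
by rewrite /inner vA mul0mx mxE ltxx.
Qed.

Section SmoothMetric.
Variables (R : realType) (n : nat) (M : manifold R n).
Variables (g : chart M -> M -> 'M[R]_n) (g_metric : riemannian_metric g).
Variables (i : chart M) (O : set M) (O_open : open O).
Local Notation c := (chart_on i O_open).

Lemma smooth_in_on f : smooth_in i setT f ->
  smooth_coord (lmap c) (linv c) (ldom c) f.
Proof. by apply: smooth_coord_subset => p [Dp _]. Qed.

Definition gram : 'M[smooth_fun c]_n := \matrix_(a, b)
  let: And4 gs _ _ _ := g_metric in to_smooth (smooth_in_on (gs i a b)).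

Lemma gramE p : ldom c p -> evalv p gram = g i p.
Proof.
move=> Dp; apply/matrixP => a b; rewrite !mxE; case: g_metric => gs _ _ _.
exact: to_smoothE.
Qed.

Lemma gram_sym : gram^T = gram.
Proof.
apply: evalv_ext => p Dp; rewrite evalv_tr gramE //.
by case: g_metric => _ _ gs _; apply: gs; case: Dp.
Qed.

Lemma eval_det p m (A : 'M[smooth_fun c]_m) : ldom c p ->
  eval p (\det A) = \det (evalv p A).
Proof.
move=> Dp; rewrite /determinant raddf_sum; apply: eq_bigr => s _ /=.
rewrite evalM; congr (_ * _).
  by case: (perm.odd_perm s); rewrite ?expr1 ?expr0 ?raddfN /= eval1.
rewrite (big_morph (eval p) (evalM p) (eval1 Dp)); apply: eq_bigr => a _.
by rewrite mxE.
Qed.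

(** Pointwise invertibility is turned into a smooth inverse by the adjugate: the determinant
    vanishes nowhere and is thus a unit of the ring. *)
Lemma gram_inverse : exists G' : 'M[smooth_fun c]_n, gram *m G' = 1%:M.
Proof.
have [d Hd] : exists d, \det gram * d = 1.
  apply: sf_inverse => p Dp; rewrite eval_det // gramE //; apply: posdef_det => u u0.
  by case: g_metric => _ _ _; apply=> //; case: Dp.
exists (d *: \adj gram); rewrite -scalemxAr mul_mx_adj -mul_scalar_mx.
by rewrite -scalar_mxM mulrC Hd.
Qed.

Definition gram_inv := proj1_sig (cid gram_inverse).
Lemma gramV : gram *m gram_inv = 1%:M.
Proof. exact: (proj2_sig (cid gram_inverse)). Qed.

Definition metric_lc : levi_civita 'rV[smooth_fun c]_n := smooth_lc gram_sym gramV.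

(** Interface to [metric_lc], for use once it has been made opaque. *)
Lemma metric_derE X f : der metric_lc X f = \sum_k X 0 k * sf_partial k f.
Proof. by []. Qed.
Lemma metric_half : half metric_lc = sf_cst c 2^-1.
Proof. by []. Qed.
Lemma metric_brE X Y b : br metric_lc X Y 0 b =
  der metric_lc X (Y 0 b) - der metric_lc Y (X 0 b).
Proof. by rewrite /= !mxE. Qed.
Lemma metric_innE X Y : inn metric_lc X Y = (X *m gram *m Y^T) 0 0.
Proof. by []. Qed.

Lemma metric_repr_deriv F X f k : repr_field F X -> repr_fun f k ->
  repr_fun (deriv_along i F f) (der metric_lc X k).
Proof. exact: repr_deriv. Qed.
Definition metric_repr_bracket F X F' X' (H : repr_field F X) (H' : repr_field F' X') :
  repr_field (bracket i F F') (br metric_lc X X') :=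
  repr_bracket (i := i) (c := c) erefl erefl H H'.
Lemma metric_repr_inner F X F' X' q : repr_field F X -> repr_field F' X' ->
  ldom c q -> inner (g i q) (F q) (F' q) = eval q (inn metric_lc X X').
Proof. by move=> H H' Dq; exact: (repr_inner gramE gram_sym gramV H H' Dq). Qed.

Lemma metric_inner_const p y z : ldom c p ->
  inner (g i p) y z = eval p (inn metric_lc (constv c y) (constv c z)).
Proof. exact: (inner_const gramE gram_sym gramV). Qed.

Lemma metric_frame_expansion (E : 'I_n -> 'rV[smooth_fun c]_n) X :
  (forall a b, inn metric_lc (E a) (E b) = (a == b)%:R) ->
  X = \sum_k inn metric_lc X (E k) *: E k.
Proof. by move=> E_onb; exact: frame_expansion. Qed.

Lemma metric_repr_nabla F X F' X' q : repr_field F X -> repr_field F' X' ->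
  ldom c q -> nabla g i F F' q = evalv q (nab metric_lc X X').
Proof.
by move=> H H' Dq; exact: (repr_nabla (i := i) (c := c) erefl erefl gramE gram_sym gramV H H' Dq).
Qed.

Lemma metric_repr_riemann F X F' X' F'' X'' q :
  repr_field F X -> repr_field F' X' -> repr_field F'' X'' -> ldom c q ->
  riemann g i F F' F'' q = evalv q (riem metric_lc X X' X'').
Proof.
move=> H H' H'' Dq.
exact: (repr_riemann (i := i) (c := c) erefl erefl gramE gram_sym gramV H H' H'' Dq).
Qed.

Lemma metric_lieE F X p y z : repr_field F X -> ldom c p ->
  lie_metric g i F p y z =
  eval p (lie_g metric_lc X (constv c y) (constv c z)).
Proof. exact: (lie_metricE (i := i) (c := c) erefl erefl gramE). Qed.

Lemma metric_extdE (w : M -> 'rV[R]_n -> R) W p y z : linf W ->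
  (forall q x, ldom c q -> w q x = eval q (W (constv c x))) -> ldom c p ->
  extd i w p y z = eval p (dform metric_lc W (constv c y) (constv c z)).
Proof. exact: (@extdE _ _ _ i c erefl erefl _ _ gram_sym gramV). Qed.

Section OnFrame.
Variable E : 'I_n -> 'rV[smooth_fun c]_n.
Hypothesis E_onb : forall a b, inn metric_lc (E a) (E b) = (a == b)%:R.

Lemma metric_ricciE p y z : ldom c p ->
  ricci g i p y z = eval p (ricci_frame metric_lc E (constv c y) (constv c z)).
Proof. exact: (ricciE (i := i) (c := c) erefl erefl gramE E_onb). Qed.

Lemma metric_laplacianE f F p : repr_fun f F -> ldom c p ->
  laplacian g i f p = eval p (\sum_k hess metric_lc F (E k) (E k)).
Proof. exact: (laplacianE (i := i) (c := c) erefl erefl gramE E_onb). Qed.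

Lemma metric_codiffE (w : M -> 'rV[R]_n -> 'rV[R]_n -> R) W p y : bilinf W ->
  (forall q x x', ldom c q -> w q x x' = eval q (W (constv c x) (constv c x'))) ->
  ldom c p ->
  codiff g i w p y = eval p (- \sum_k nab_form metric_lc W (E k) (E k) (constv c y)).
Proof. exact: (codiffE (i := i) (c := c) erefl erefl gramE E_onb). Qed.

End OnFrame.

End SmoothMetric.
Arguments metric_repr_bracket {R n M g} g_metric {i O} O_open {F X F' X'} _ _ [q] _.

(** * An orthonormal frame and the Gauss curvature on a chart of the base *)

Section Surface.
Variables (R : realType) (N : manifold R 2).
Variables (h : chart N -> N -> 'M[R]_2) (h_metric : riemannian_metric h).
Variables (j : chart N) (O : set N) (O_open : open O).
Local Notation c := (chart_on j O_open).
Local Notation S := (smooth_fun c).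
Local Notation L := (metric_lc h_metric j O_open).

(** Gram-Schmidt applied to the coordinate fields, with [s] the length of the first and [t] the root
    of the Gram determinant. The structure functions are the components of the bracket in the
    resulting frame. *)
Lemma surface_frame : exists (f1 f2 : 'rV[S]_2) (a b : S),
  [/\ inn L f1 f1 = 1, inn L f2 f2 = 1, inn L f1 f2 = 0,
      br L f1 f2 = a *: f1 + b *: f2 &
      forall q, ldom c q -> gauss_curvature h j q =
        eval q (der L f1 b - der L f2 a - a * a - b * b)].
Proof.
pose d0 : 'rV[S]_2 := delta_mx 0 ord0; pose d1 : 'rV[S]_2 := delta_mx 0 ord_max.
pose h11 := inn L d0 d0; pose h12 := inn L d0 d1; pose h22 := inn L d1 d1.
have evi q (y z : 'rV[R]_2) : ldom c q ->
    inner (h j q) y z = eval q (inn L (constv c y) (constv c z)).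
  by move=> Dq; exact: metric_inner_const.
have h11_gt0 q : ldom c q -> 0 < eval q h11.
  move=> Dq; rewrite /h11 /d0 -(constv_delta c) -evi //.
  case: h_metric => _ _ _; apply; first by case: Dq.
  by apply/negP => /eqP/rowP/(_ ord0) /eqP; rewrite !mxE oner_eq0.
have [s [ss s_gt0]] := sf_sqrt h11_gt0.
pose dt := h11 * h22 - h12 * h12.
have dt_gt0 q : ldom c q -> 0 < eval q dt.
  move=> Dq; rewrite -(pmulr_rgt0 _ (h11_gt0 q Dq)) -evalM.
  (* The squared length of [w] is [h11 * dt], which gives the sign of the determinant. *)
  pose w : 'rV[R]_2 := eval q h11 *: delta_mx 0 ord_max - eval q h12 *: delta_mx 0 ord0.
  have -> : eval q (h11 * dt) = inner (h j q) w w.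
    have -> : w = evalv q (h11 *: d1 - h12 *: d0).
      rewrite /w -(evalv_const (delta_mx 0 ord_max) Dq) -(evalv_const (delta_mx 0 ord0) Dq).
      by rewrite !(constv_delta c); apply/rowP => k; rewrite !mxE raddfB /= !evalM.
    rewrite evi // -(bilinf_local _ _ (bilinf_inn L) Dq); congr (eval q _).
    rewrite !(innE, innDr, innZr, innNr) -/h11 -/h12 -/h22 (innC L d1 d0) -/h12 /dt; ring.
  case: h_metric => _ _ _; apply; first by case: Dq.
  apply/negP => /eqP/rowP/(_ ord_max) /eqP; rewrite !mxE /= mulr1 mulr0 subr0.
  by rewrite gt_eqF // h11_gt0.
have [t [tt t_gt0]] := sf_sqrt dt_gt0.
have [s' ss'] : exists s', s * s' = 1.
  by apply: sf_inverse => q Dq; rewrite gt_eqF // s_gt0.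
have [t' tt'] : exists t', t * t' = 1.
  by apply: sf_inverse => q Dq; rewrite gt_eqF // t_gt0.
pose f1 := s' *: d0; pose f2 := (s' * t') *: (h11 *: d1 - h12 *: d0).
have i11 : inn L f1 f1 = 1.
  rewrite /f1 innZl innZr -/h11 -ss.
  by ring: ss'.
have i12 : inn L f1 f2 = 0.
  by rewrite /f1 /f2 innZl !(innZr, innDr, innNr) -/h11 -/h12; ring.
have i22 : inn L f2 f2 = 1.
  rewrite /f2 innZl innZr !innDl !innDr !innNl !innNr !innZl !innZr.
  rewrite -/h11 -/h12 -/h22 (innC L d1 d0) -/h12.
  have -> : s' * t' * (s' * t' * (h11 * (h11 * h22) + - (h11 * (h12 * h12)) +
    (- (h12 * (h11 * h12)) + - - (h12 * (h12 * h11))))) = s' * t' * (s' * t' * (h11 * dt)).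
    by rewrite /dt; ring.
  by rewrite -tt -ss; ring: ss' tt'.
pose E (k : 'I_2) := nth 0 [:: f1; f2] k.
have E_onb a b : inn L (E a) (E b) = (a == b)%:R.
  case: a b => [[|[|//]] ?] [[|[|//]] ?];
    [exact: i11|exact: i12|exact: etrans (innC L f2 f1) i12|exact: i22].
have complete X : X = inn L X f1 *: f1 + inn L X f2 *: f2.
  have := metric_frame_expansion X E_onb.
  by rewrite !big_ord_recl big_ord0 addr0.
exists f1, f2, (inn L (br L f1 f2) f1), (inn L (br L f1 f2) f2); split=> //.
move=> q Dq; rewrite -(surface_curvature i11 i22 i12 complete (complete _)).
pose rho := inn L (riem L d0 d1 d1) d0.
have skew X Y Z : inn L (riem L X Y Z) Z = 0.
  by apply: (double_inj L); rewrite addr0 {2}riem_skew subrr.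
have rz X Z : riem L X X Z = 0.
  apply: (inn_ext (l := L)) => W; apply: (double_inj L).
  by rewrite inn0l addr0 {2}riemC innNl subrr.
(* The change of basis is triangular with determinant [s' * s' * t' * h11 = t'], and the curvature
   picks it up once for each skew pair of arguments. *)
have -> : inn L (riem L f1 f2 f2) f1 = t' * t' * rho.
  have -> : riem L f1 f2 f2 = (s' * (s' * t' * h11)) *: riem L d0 d1 f2.
    rewrite /f1 {1}/f2 riemZl riemZm riemDm -scaleN1r !riemZm rz.
    by rewrite !scaler0 addr0 !scalerA -!mulrA.
  rewrite innZl /f1 innZr riem_skew.
  have -> : inn L (riem L d0 d1 d0) f2 = - (s' * t' * h11 * rho).
    rewrite /f2 innZr innDr innNr !innZr skew mulr0 oppr0 addr0 riem_skew -/rho.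
    by ring.
  by rewrite -ss; ring: ss'.
rewrite /gauss_curvature /sectional.
rewrite (metric_repr_riemann h_metric (O_open := O_open) (repr_const (delta_mx 0 ord0))
  (repr_const (delta_mx 0 ord_max)) (repr_const (delta_mx 0 ord_max)) Dq).
rewrite -[X in inner _ _ X](evalv_const (delta_mx 0 ord0) Dq) !(constv_delta c).
have ev2 X Y : inner (h j q) (evalv q X) (evalv q Y) = eval q (inn L X Y).
  by rewrite evi // -(bilinf_local _ _ (bilinf_inn L) Dq).
rewrite ev2 !evi // !(constv_delta c) -/rho -/h11 -/h12 -/h22.
have -> : eval q h11 * eval q h22 - eval q h12 ^+ 2 = eval q t * eval q t.
  by rewrite -(evalM q t t) tt /dt raddfB /= !evalM expr2.
have t0 : eval q t != 0 by rewrite gt_eqF // t_gt0.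
have tq : eval q t * eval q t' = 1 by rewrite -evalM tt' eval1.
rewrite !evalM -[eval q t'](mulKf t0) tq.
by field.
Qed.
End Surface.

(** * Semi-conformal submersions *)

(* Keeps unification from unfolding [inn], [der] and [nab] into coordinates. *)
#[local] Opaque metric_lc.

Lemma innerZZ (R : realType) (n : nat) (A : 'M[R]_n) (a b : R) (x y : 'rV[R]_n) :
  inner A (a *: x) (b *: y) = a * b * inner A x y.
Proof.
by rewrite /inner -!scalemxAl linearZ -scalemxAr scalerA [LHS]mxE.
Qed.

(** Convertible to the right-hand side of the theorem, with the symmetric products unfolded. *)
Definition soliton_form (R : realType) (M : manifold R 3) (N : manifold R 2)
    (g : chart M -> M -> 'M[R]_3) (h : chart N -> N -> 'M[R]_2)
    (phi : M -> N) (lambda : M -> R) (U : chart M -> M -> 'rV[R]_3)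
    (i : chart M) (j : chart N) (f : M -> R) (X : M -> 'rV[R]_3) (A : R)
    (p : M) (y z : 'rV[R]_3) : R :=
  let lnl := fun q => ln (lambda q) in
  (lambda p ^+ 2 * gauss_curvature h j (phi p)
   + laplacian g i lnl p + deriv_along i (mu g U i) lnl p
   - f p * deriv_along i (U i) lnl p)
    * (inner (g i p) y z - theta g U i p y * theta g U i p z)
  - 4^-1 * integrability_norm2 g phi U i p * inner (g i p) y z
  + 2^-1 * lie_metric g i X p y z
  + A * inner (g i p) y z
  - (mu_flat g U i p y + dvert g U i lnl p y) * (mu_flat g U i p z + dvert g U i lnl p z)
  - dvert g U i lnl p y * dvert g U i lnl p z
  + 2^-1 * ((differential i f p y + f p * mu_flat g U i p y
             + 2 * differential i (deriv_along i (U i) lnl) p y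
             + codiff g i (Omega g U i) p y) * theta g U i p z
            + theta g U i p y * (differential i f p z + f p * mu_flat g U i p z
             + 2 * differential i (deriv_along i (U i) lnl) p z
             + codiff g i (Omega g U i) p z)).

Section SemiConformalLocal.
Variables (R : realType) (M : manifold R 3) (N : manifold R 2).
Variables (g : chart M -> M -> 'M[R]_3) (h : chart N -> N -> 'M[R]_2).
Variables (phi : M -> N) (lambda : M -> R) (U : chart M -> M -> 'rV[R]_3).
Hypothesis g_metric : riemannian_metric g.
Hypothesis h_metric : riemannian_metric h.
Hypothesis phi_submersion : submersion phi.
Hypothesis phi_semi_conformal : semi_conformal g h phi lambda.
Hypothesis U_vertical : vertical_field phi U.
Hypothesis U_unit : unit_field g U.
Variables (i : chart M) (j : chart N).

Lemma preim_chart_open : open (phi @^-1` chart_dom j).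
Proof.
by case: phi_submersion => -[cphi _] _; apply: open_comp => [x _|];
  [exact: cphi|exact: chart_dom_open].
Qed.

Local Notation c := (chart_on i preim_chart_open).
Local Notation c' := (chart_on j openT).
Local Notation S := (smooth_fun c).
Local Notation S' := (smooth_fun c').
Local Notation L := (metric_lc g_metric i preim_chart_open).
Local Notation L' := (metric_lc h_metric j openT).
Local Notation G := (gram g_metric i preim_chart_open).
Local Notation G' := (gram_inv g_metric i preim_chart_open).
Local Notation der' := (der L').
Local Notation inn' := (inn L').
Local Notation br' := (br L').
Local Notation der := (der L).
Local Notation inn := (inn L).
Local Notation br := (br L).

Lemma phi_dom p : ldom c p -> ldom c' (phi p).
Proof. by case. Qed.

Lemma phi_cont p : ldom c p -> {for p, continuous phi}.
Proof. by case: phi_submersion => -[cphi _] _ _; exact: cphi. Qed.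

Lemma phi_coord_smooth b : smooth_coord (lmap c) (linv c) (ldom c)
  (fun q => lmap c' (phi q) 0 b).
Proof. by case: phi_submersion => -[_ sphi] _; exact: sphi. Qed.

Local Notation pull := (sf_pullback phi_dom phi_cont phi_coord_smooth).
Definition pullv m k (A : 'M[S']_(m, k)) : 'M[S]_(m, k) := map_mx pull A.

Definition jac : 'M[S]_(3, 2) := \matrix_(a, b) sf_jacobian phi_coord_smooth a b.
Local Notation J := jac.

Lemma jacE p : ldom c p -> evalv p J = dmap phi i j p.
Proof. by move=> Dp; apply/matrixP => a b; rewrite !mxE /eval to_smoothE. Qed.

Definition base_gram : 'M[S]_2 := pullv (gram h_metric j openT).
Local Notation H := base_gram.

Lemma base_gramE p : ldom c p -> evalv p H = h j (phi p).
Proof.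
move=> Dp; rewrite -(gramE h_metric (O_open := openT) (phi_dom Dp)).
by apply/matrixP => a b; rewrite !mxE eval_pullback.
Qed.

Lemma base_gram_sym : H^T = H.
Proof. by rewrite /base_gram /pullv map_trmx gram_sym. Qed.

Lemma field_smooth (X : chart M -> M -> 'rV[R]_3) k : vector_field X ->
  smooth_coord (lmap c) (linv c) (ldom c) (fun q => X i q 0 k).
Proof. by case=> sX _; exact: smooth_in_on. Qed.

Definition lift_field X (vX : vector_field X) : 'rV[S]_3 :=
  \row_k to_smooth (field_smooth k vX).

Lemma repr_lift_field X (vX : vector_field X) : repr_field (X i) (lift_field vX).
Proof. by move=> q Dq; apply/rowP => k; rewrite !mxE /eval to_smoothE. Qed.

Definition Us : 'rV[S]_3 := lift_field (proj1 U_vertical).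

Lemma UsE p : ldom c p -> evalv p Us = U i p.
Proof. by move=> Dp; rewrite -(repr_lift_field (proj1 U_vertical) Dp). Qed.

Lemma Us_unit : inn Us Us = 1.
Proof.
apply: eval_eq => p Dp; rewrite eval1 //.
rewrite -(metric_repr_inner g_metric (O_open := preim_chart_open)
  (repr_lift_field (proj1 U_vertical)) (repr_lift_field (proj1 U_vertical)) Dp).
by apply: U_unit; case: Dp.
Qed.

Lemma Us_jac : Us *m J = 0.
Proof.
apply: evalv_ext => p Dp; rewrite evalv_mul jacE // UsE //.
case: U_vertical => _ /(_ i p); case: Dp => Di Dj /(_ Di j Dj) ->.
by apply/matrixP => a b; rewrite !mxE raddf0.
Qed.

Lemma gram_inv_sym : G'^T = G'.
Proof.
rewrite -[LHS]mulmx1 -(gramV g_metric i preim_chart_open) mulmxA.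
rewrite -{1}(gram_sym g_metric i preim_chart_open) -trmx_mul gramV.
by rewrite trmx1 mul1mx.
Qed.

(** The inner products of the gradients of the components of [phi], that is, the inverse metric
    pushed to the base. *)
Definition cojac : 'M[S]_2 := J^T *m G' *m J.
Local Notation Q := cojac.

Lemma cojac_sym : Q^T = Q.
Proof. by rewrite /cojac !trmx_mul trmxK gram_inv_sym mulmxA. Qed.

(** The rows of [P] are the gradients of the components of [phi]; they are horizontal.
    Semi-conformality applied to them reads q h q = lambda^2 q for [q] the value of [cojac], and [q]
    can be cancelled. *)
Lemma cojac_base p : ldom c p -> evalv p (Q *m H) = (lambda p ^+ 2)%:M.
Proof.
move=> Dp; have [Di Dj] := Dp.
pose Jp := dmap phi i j p; pose gp := g i p; pose hp := h j (phi p).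
pose gi := evalv p G'.
have gg : gp *m gi = 1%:M.
  by rewrite /gp -(gramE g_metric Dp) -evalv_mul gramV evalv1.
have gis : gi^T = gi by rewrite -evalv_tr gram_inv_sym.
pose P := Jp^T *m gi.
have PgJ : P *m gp = Jp^T by rewrite /P -mulmxA (mulmx1C gg) mulmx1.
have hor y : horizontal g phi i p (y *m P).
  move=> v /(_ j Dj) vJ; rewrite /inner -[y *m P *m _]mulmxA PgJ.
  by rewrite -mulmxA -trmx_mul vJ trmx0 mulmx0 mxE.
pose q := Jp^T *m gi *m Jp.
have qs : q^T = q by rewrite /q !trmx_mul trmxK gis mulmxA.
have PJ : P *m Jp = q by [].
have PgP : P *m gp *m P^T = q by rewrite PgJ /P trmx_mul trmxK gis mulmxA.
have qhq : q *m hp *m q = lambda p ^+ 2 *: q.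
  apply/matrixP => a b.
  have ent (A : 'M[R]_2) :
      ((delta_mx 0 a : 'rV_2) *m A *m (delta_mx 0 b : 'rV_2)^T) 0 0 = A a b.
    by rewrite trmx_delta -rowE -colE !mxE.
  have := phi_semi_conformal.2 i j p Di Dj _ _ (hor (delta_mx 0 a)) (hor (delta_mx 0 b)).
  rewrite /inner -/Jp -/hp -/gp.
  have -> : (delta_mx 0 a : 'rV_2) *m P *m Jp *m hp *m ((delta_mx 0 b : 'rV_2) *m P *m Jp)^T =
      (delta_mx 0 a : 'rV_2) *m (q *m hp *m q) *m (delta_mx 0 b : 'rV_2)^T.
    rewrite -[_ *m P *m Jp]mulmxA -[delta_mx 0 b *m P *m Jp]mulmxA PJ.
    by rewrite trmx_mul qs !mulmxA.
  have -> : (delta_mx 0 a : 'rV_2) *m P *m gp *m ((delta_mx 0 b : 'rV_2) *m P)^T =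
      (delta_mx 0 a : 'rV_2) *m q *m (delta_mx 0 b : 'rV_2)^T.
    by rewrite trmx_mul -PgP !mulmxA.
  by rewrite !ent => ->; rewrite [RHS]mxE.
(* If [y] kills [q], then [y *m P] has length 0, so [y] kills the transposed Jacobian, and
   surjectivity of the differential forces [y = 0]. *)
have qu : q \in unitmx.
  rewrite unitmxE unitfE; apply/negP => /det0P [y y0 yq].
  have yP0 : y *m P = 0.
    apply/eqP; apply/negPn/negP => yP0.
    have [_ _ _ gpos] := g_metric; have := gpos i p (y *m P) Di yP0.
    rewrite /inner trmx_mul mulmxA -[y *m P *m _]mulmxA -[y *m _ *m P^T]mulmxA PgP yq.
    by rewrite mul0mx mxE ltxx.
  have yJ : y *m Jp^T = 0 by rewrite -PgJ mulmxA yP0 mul0mx.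
  have /row_fullP[B BJ] := phi_submersion.2 i j p Di Dj.
  move: y0; rewrite -[y]mulmx1 -trmx1 -BJ trmx_mul mulmxA yJ mul0mx eqxx //.
have E : q *m hp = (lambda p ^+ 2)%:M.
  by rewrite -[LHS](mulmxK qu) qhq -scalemxAl mulmxV // scalemx1.
by rewrite !evalv_mul evalv_tr jacE // base_gramE.
Qed.

(** Smoothness of [lambda] is a consequence of [cojac_base]: its square is a diagonal entry of a
    matrix over the ring, and positivity allows the root and the logarithm. *)
Lemma smooth_dilation : exists lam lam' l : S,
  [/\ forall p, ldom c p -> eval p lam = lambda p,
      lam * lam' = 1, Q *m H = (lam * lam)%:M,
      forall p, ldom c p -> eval p l = ln (lambda p) &
      forall k, lam * sf_partial k l = sf_partial k lam].
Proof.
have lambda_gt0 := phi_semi_conformal.1.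
pose s := (Q *m H) ord0 ord0.
have sE p : ldom c p -> eval p s = lambda p ^+ 2.
  move=> Dp; have := congr1 (fun A : 'M[R]_2 => A ord0 ord0) (cojac_base Dp).
  by rewrite [evalv _ _ _ _]mxE [_%:M _ _]mxE eqxx mulr1n.
have [lam [ll lam_gt0]] : exists lam : S,
    lam * lam = s /\ forall p, ldom c p -> 0 < eval p lam.
  by apply: sf_sqrt => p Dp; rewrite sE // exprn_gt0.
have lamE p : ldom c p -> eval p lam = lambda p.
  move=> Dp; have := sE p Dp; rewrite -ll evalM -expr2 => /eqP.
  by rewrite eqrXn2 // ?ltW ?lam_gt0 // => /eqP.
have [lam' lamK] : exists lam', lam * lam' = 1.
  by apply: sf_inverse => p Dp; rewrite gt_eqF // lam_gt0.
have [l [lE dl]] := sf_ln lam_gt0.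
exists lam, lam', l; split=> //; last by move=> p Dp; rewrite lE // lamE.
apply: evalv_ext => p Dp; rewrite cojac_base //.
by apply/matrixP => a b; rewrite [RHS]mxE [_%:M _ _]mxE [_%:M _ _]mxE raddfMn /= evalM lamE // expr2.
Qed.

(** The derivatives of the Jacobian cancel by [sf_jacobianC]. The fields need not be projectable to
    the base. *)
Lemma push_br X Y b : (br X Y *m J) 0 b =
  der X ((Y *m J) 0 b) - der Y ((X *m J) 0 b).
Proof.
have dJ X' Y' : der X' ((Y' *m J) 0 b) =
    \sum_a der X' (Y' 0 a) * J a b + \sum_a \sum_k Y' 0 a * (X' 0 k * sf_partial k (J a b)).
  rewrite mxE der_sum -big_split; apply: eq_bigr => a _.
  by rewrite derM [der X' (J a b)]metric_derE big_distrr.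
rewrite !dJ mxE.
have -> : \sum_a \sum_k X 0 a * (Y 0 k * sf_partial k (J a b)) =
          \sum_a \sum_k Y 0 a * (X 0 k * sf_partial k (J a b)).
  rewrite exchange_big; apply: eq_bigr => a _; apply: eq_bigr => k _ /=.
  by rewrite !mxE sf_jacobianC; ring.
rewrite opprD addrACA subrr addr0 -sumrB; apply: eq_bigr => a _.
by rewrite -mulrBl metric_brE.
Qed.

Lemma der_pull X F : der X (pull F) = \sum_b (X *m J) 0 b * pull (sf_partial b F).
Proof.
rewrite metric_derE.
under eq_bigr => k _ do rewrite sf_partial_pullback big_distrr.
rewrite exchange_big; apply: eq_bigr => b _ /=.
rewrite mxE big_distrl; apply: eq_bigr => k _ /=.
by rewrite !mxE mulrA.
Qed.

Lemma pullv_inn y z : (pullv y *m H *m (pullv z)^T) 0 0 = pull (inn' y z).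
Proof.
by rewrite metric_innE /base_gram /pullv map_trmx -!map_mxM [LHS]mxE.
Qed.

Section Lift.
Variables (lam lam' : S).
Hypothesis lamK : lam * lam' = 1.
Hypothesis QH : Q *m H = (lam * lam)%:M.

(** The covector dual to [y] under [h], pulled back to [M] and raised by [g]; the factor compensates
    the square of the dilation in [QH]. *)
Definition hlift (y : 'rV[S]_2) : 'rV[S]_3 := (lam' * lam') *: (y *m H *m J^T *m G').

Lemma hlift_jac y : hlift y *m J = y.
Proof.
have HQ : H *m Q = (lam * lam)%:M.
  by rewrite -[LHS]trmxK trmx_mul cojac_sym base_gram_sym QH tr_scalar_mx.
rewrite /hlift -scalemxAl.
have -> : y *m H *m J^T *m G' *m J = y *m (H *m Q).
  by rewrite /cojac !mulmxA.
rewrite HQ mul_mx_scalar scalerA.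
have -> : lam' * lam' * (lam * lam) = 1 by ring: lamK.
by rewrite scale1r.
Qed.

Lemma inn_hlift X y : inn X (hlift y) = lam' * lam' * (X *m J *m H *m y^T) 0 0.
Proof.
rewrite innZr; congr (_ * _); rewrite metric_innE !trmx_mul trmxK gram_inv_sym base_gram_sym.
rewrite !mulmxA -[X *m G *m G']mulmxA gramV mulmx1 //.
Qed.

(** The factor [lam] turns unit vectors of the base into unit vectors of [M]. The second clause says
    that pairing with a lift only sees the image in the base, hence that lifts are horizontal. *)
Lemma horizontal_lift : exists e : 'rV[S']_2 -> 'rV[S]_3,
  (forall f, e f *m J = lam *: pullv f) /\
  (forall X f, inn X (e f) = lam' * (X *m J *m H *m (pullv f)^T) 0 0).
Proof.
exists (fun f => lam *: hlift (pullv f)); split=> [f|X f].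
  by rewrite -scalemxAl hlift_jac.
by rewrite innZr inn_hlift; ring: lamK.
Qed.

End Lift.

Section AdaptedFrame.
Variables (lam lam' l : S) (u : 'rV[S]_3) (hframe : 'rV[S']_2 -> 'rV[S]_3).
Hypothesis lamK : lam * lam' = 1.
Hypothesis dl : forall k, lam * sf_partial k l = sf_partial k lam.
Hypothesis u_unit : inn u u = 1.
Hypothesis u_jac : u *m J = 0.
Hypothesis push_hframe : forall f, hframe f *m J = lam *: pullv f.
Hypothesis inn_hframe : forall X f,
  inn X (hframe f) = lam' * (X *m J *m H *m (pullv f)^T) 0 0.
Variables (f1 f2 : 'rV[S']_2) (a0 b0 : S').
Hypothesis i11 : inn' f1 f1 = 1.
Hypothesis i22 : inn' f2 f2 = 1.
Hypothesis i12 : inn' f1 f2 = 0.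
Hypothesis b12 : br' f1 f2 = a0 *: f1 + b0 *: f2.

Local Notation e1 := (hframe f1).
Local Notation e2 := (hframe f2).

Lemma inn_hframes f f' : inn (hframe f) (hframe f') = pull (inn' f f').
Proof.
rewrite inn_hframe push_hframe -!scalemxAl mxE pullv_inn mulrA [lam' * lam]mulrC.
by rewrite lamK mul1r.
Qed.

Let e11 : inn e1 e1 = 1. Proof. by rewrite inn_hframes i11 rmorph1. Qed.
Let e22 : inn e2 e2 = 1. Proof. by rewrite inn_hframes i22 rmorph1. Qed.
Let e12 : inn e1 e2 = 0. Proof. by rewrite inn_hframes i12 rmorph0. Qed.
Let eU f : inn u (hframe f) = 0.
Proof. by rewrite inn_hframe u_jac !mul0mx mxE mulr0. Qed.

Let e1U : inn e1 u = 0. Proof. by rewrite innC eU. Qed.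
Let e2U : inn e2 u = 0. Proof. by rewrite innC eU. Qed.

Lemma adapted_onb k k' :
  inn (frame3 e1 e2 u k) (frame3 e1 e2 u k') = (k == k')%:R.
Proof.
case: k k' => [[|[|[|//]]] ?] [[|[|[|//]]] ?]; rewrite /frame3 /=;
 [exact: e11|exact: e12|exact: e1U|exact: etrans (innC L e2 e1) e12|exact: e22
 |exact: e2U|exact: eU|exact: eU|exact: u_unit].
Qed.

Lemma adapted_complete X :
  X = inn X e1 *: e1 + inn X e2 *: e2 + inn X u *: u.
Proof.
have := metric_frame_expansion X adapted_onb.
by rewrite !big_ord_recl big_ord0 addr0 addrA.
Qed.

(** Serves to determine brackets: their images in the base are computable, and only the component
    along [u] has to be named. *)
Lemma push_eq X x1 x2 : X *m J = x1 *: (lam *: pullv f1) + x2 *: (lam *: pullv f2) ->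
  X = x1 *: e1 + x2 *: e2 + inn X u *: u.
Proof.
rewrite -!push_hframe !scalemxAl -mulmxDl => E.
have key f : inn X (hframe f) = inn (x1 *: e1 + x2 *: e2) (hframe f).
  by rewrite !inn_hframe E.
have x1E : inn X e1 = x1.
  by rewrite key innDl !innZl e11 (innC L e2 e1) e12 mulr1 mulr0 addr0.
have x2E : inn X e2 = x2.
  by rewrite key innDl !innZl e22 e12 mulr1 mulr0 add0r.
by rewrite [LHS]adapted_complete x1E x2E.
Qed.

Lemma der_lam X : der X lam = lam * der X l.
Proof.
rewrite !metric_derE big_distrr; apply: eq_bigr => k _ /=.
by rewrite -dl mulrCA.
Qed.

Lemma der_hframe_pull f F : der (hframe f) (pull F) = lam * pull (der' f F).
Proof.
rewrite der_pull push_hframe metric_derE rmorph_sum big_distrr.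
by apply: eq_bigr => k _ /=; rewrite !mxE rmorphM mulrA.
Qed.

Lemma der_u_pull F : der u (pull F) = 0.
Proof. by rewrite der_pull u_jac big1 // => k _; rewrite mxE mul0r. Qed.

Let a := pull a0.
Let b := pull b0.

(** The images of the two lifts are [lam] times [f1] and [f2]. The Leibniz rule gives [lam] squared
    times the base bracket, and the derivatives of [lam] account for the terms in [l]. *)
Lemma push_br_e12 : br e1 e2 *m J =
  (lam * a - der e2 l) *: (lam *: pullv f1) + (lam * b + der e1 l) *: (lam *: pullv f2).
Proof.
apply/rowP => k; rewrite push_br !push_hframe.
have ent f : (lam *: pullv f) 0 k = lam * pull (f 0 k) by rewrite !mxE.
have entr x f : (x *: (lam *: pullv f)) 0 k = x * (lam * pull (f 0 k)).
  by rewrite mxE ent.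
rewrite [RHS]mxE !entr !ent !derM !der_lam !der_hframe_pull.
have B : pull (der' f1 (f2 0 k)) =
    pull (der' f2 (f1 0 k)) + a * pull (f1 0 k) + b * pull (f2 0 k).
  have := congr1 (fun A : 'rV[S']_2 => pull (A 0 k)) b12.
  rewrite metric_brE rmorphB => /eqP; rewrite subr_eq => /eqP ->.
  by rewrite !mxE rmorphD !rmorphM; ring.
by rewrite B; ring.
Qed.

(** [u] has image 0 and annihilates functions pulled back from the base, so only the derivative of
    [lam] remains. *)
Lemma push_br_u f : br u (hframe f) *m J = der u l *: (lam *: pullv f).
Proof.
apply/rowP => k; rewrite push_br push_hframe u_jac.
have ent x : (x *: pullv f) 0 k = x * pull (f 0 k) by rewrite !mxE.
rewrite ent [(0 : 'rV_2) _ _]mxE der0r subr0 derM der_u_pull mulr0 addr0 der_lam.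
by rewrite scalerA ent; ring.
Qed.

Let al := lam * a - der e2 l.
Let be := lam * b + der e1 l.
Let v := half L * inn (br e1 e2) u.
Let sg := der u l.
Let m1 := - inn (br u e1) u.
Let m2 := - inn (br u e2) u.

Let br12 : br e1 e2 = al *: e1 + be *: e2 + (v + v) *: u.
Proof.
have -> : v + v = inn (br e1 e2) u by rewrite /v -mulrDl halfP mul1r.
exact: push_eq push_br_e12.
Qed.

Let bru1 : br u e1 = sg *: e1 - m1 *: u.
Proof.
rewrite -scaleNr opprK.
have := @push_eq (br u e1) sg 0; rewrite !scale0r !addr0; apply.
exact: push_br_u.
Qed.

Let bru2 : br u e2 = sg *: e2 - m2 *: u.
Proof.
rewrite -scaleNr opprK.
have := @push_eq (br u e2) 0 sg; rewrite !scale0r !add0r; apply.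
exact: push_br_u.
Qed.

Let K0 := der' f1 b0 - der' f2 a0 - a0 * a0 - b0 * b0.

Lemma adapted_ricci Y Z : ricci_frame L (frame3 e1 e2 u) Y Z =
  (lam * lam * pull K0 + frame_laplacian L e1 e2 u l + der (nab L u u) l)
     * (inn Y Z - inn u Y * inn u Z)
  - v * v *+ 2 * inn Y Z + half L * lie_g L (nab L u u) Y Z
  - (inn (nab L u u) Y + sg * inn u Y) * (inn (nab L u u) Z + sg * inn u Z)
  - (sg * inn u Y) * (sg * inn u Z)
  + half L * ((der Y sg *+ 2 + frame_codiff L e1 e2 u Y) * inn u Z
            + inn u Y * (der Z sg *+ 2 + frame_codiff L e1 e2 u Z)).
Proof.
rewrite (ricci_frameE e11 e22 u_unit e12 e1U e2U adapted_complete br12 bru1 bru2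
  (l := l) (lam := lam) (a := a) (b := b) (a2 := pull (der' f2 a0))
  (b1 := pull (der' f1 b0)) erefl erefl erefl der_lam (der_u_pull a0) (der_u_pull b0)
  (der_hframe_pull f2 a0) (der_hframe_pull f1 b0)).
by rewrite /fibred_ricci /K0 !rmorphB !rmorphM.
Qed.

Lemma adapted_lie_vertical f Y Z : lie_g L (f *: u) Y Z =
  - (f * sg *+ 2 * (inn Y Z - inn u Y * inn u Z))
  + ((der Y f + f * inn (nab L u u) Y) * inn u Z
     + inn u Y * (der Z f + f * inn (nab L u u) Z)).
Proof.
exact: (lie_vertical e11 e22 u_unit e12 e1U e2U adapted_complete br12 bru1 bru2).
Qed.

Lemma adapted_vertical_bracket Y Z :
  inn u (br (Y - inn u Y *: u) (Z - inn u Z *: u)) =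
  (v + v) * (inn Y e1 * inn Z e2 - inn Y e2 * inn Z e1).
Proof.
exact: (vertical_bracket e11 e22 u_unit e12 e1U e2U adapted_complete br12).
Qed.

Hypothesis u_repr : repr_field (U i) u.
Hypothesis lamE : forall p, ldom c p -> eval p lam = lambda p.
Hypothesis lE : forall p, ldom c p -> eval p l = ln (lambda p).
Hypothesis curvatureE : forall q, ldom c' q -> gauss_curvature h j q = eval q K0.

Local Notation mus := (nab L u u).
Local Notation th := (inn u).
Local Notation lnl := (fun q => ln (lambda q)).
Local Notation ct := (constv c).

Lemma lnl_repr : repr_fun lnl l.
Proof. by move=> q Dq; rewrite lE. Qed.

Lemma thetaE q y : ldom c q -> theta g U i q y = eval q (th (ct y)).
Proof.
by move=> Dq; rewrite -(metric_repr_inner g_metric (O_open := preim_chart_open) u_repr (repr_const y) Dq).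
Qed.

Lemma mu_repr : repr_field (mu g U i) mus.
Proof. by move=> q Dq; exact: (metric_repr_nabla g_metric (O_open := preim_chart_open) u_repr u_repr Dq). Qed.

Lemma mu_flatE q y : ldom c q -> mu_flat g U i q y = eval q (inn mus (ct y)).
Proof.
by move=> Dq; rewrite -(metric_repr_inner g_metric (O_open := preim_chart_open) mu_repr (repr_const y) Dq).
Qed.

Lemma repr_der F X f k : repr_field F X -> repr_fun f k ->
  repr_fun (deriv_along i F f) (der X k).
Proof. exact: metric_repr_deriv. Qed.

Lemma sg_repr : repr_fun (deriv_along i (U i) lnl) sg.
Proof. exact: repr_der u_repr lnl_repr. Qed.

Lemma dvertE q y : ldom c q -> dvert g U i lnl q y = eval q (sg * th (ct y)).
Proof. by move=> Dq; rewrite /dvert evalM (sg_repr Dq) thetaE. Qed.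

Lemma linf_th : linf th. Proof. exact: linf_inn_r. Qed.

Lemma OmegaE q x x' : ldom c q ->
  Omega g U i q x x' = eval q (dform L th (ct x) (ct x')).
Proof.
by move=> Dq; apply: metric_extdE => //; [exact: linf_th|move=> *; exact: thetaE].
Qed.

Lemma codiff_OmegaE q y : ldom c q ->
  codiff g i (Omega g U i) q y = eval q (frame_codiff L e1 e2 u (ct y)).
Proof.
move=> Dq; apply: (metric_codiffE adapted_onb) => //.
  exact: bilinf_dform linf_th.
by move=> *; exact: OmegaE.
Qed.

Lemma laplacian_lnlE q : ldom c q ->
  laplacian g i lnl q = eval q (frame_laplacian L e1 e2 u l).
Proof.
by move=> Dq; apply: (metric_laplacianE adapted_onb lnl_repr).
Qed.

Lemma inner_evalv p X Y : ldom c p ->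
  inner (g i p) (evalv p X) (evalv p Y) = eval p (inn X Y).
Proof.
move=> Dp; rewrite (metric_inner_const g_metric (O_open := preim_chart_open)) //.
by rewrite -(bilinf_local _ _ (bilinf_inn L) Dp).
Qed.

Lemma horizontalP p y : ldom c p -> (forall w, w *m dmap phi i j p = 0 ->
  inner (g i p) y w = 0) -> horizontal g phi i p y.
Proof. by move=> [Di Dj] H w /(_ j Dj); exact: H. Qed.

Lemma hframe_horizontal p f : ldom c p -> horizontal g phi i p (evalv p (hframe f)).
Proof.
move=> Dp; apply: horizontalP => // w wJ.
rewrite -(evalv_const w Dp) inner_evalv // innC inn_hframe evalM.
rewrite [X in _ * X](_ : _ = 0) ?mulr0 //.
pose z := ct w *m J *m H *m (pullv f)^T.
rewrite -[eval p _]/(eval p (z 0 0)).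
have -> : eval p (z 0 0) = (evalv p z) 0 0 by rewrite [RHS]mxE.
by rewrite /z !evalv_mul evalv_const // jacE // wJ !mul0mx mxE.
Qed.

Lemma honb_spec p : ldom c p ->
  orthonormal_at g i p (honb g phi i p) /\
  forall a, horizontal g phi i p (honb g phi i p a).
Proof.
move=> Dp; apply: (xgetPex _ (P := [set e | orthonormal_at g i p e /\
  forall a, horizontal g phi i p (e a)])).
exists (fun k : 'I_2 => evalv p (hframe (nth 0 [:: f1; f2] k))); split; last first.
  by move=> k; exact: hframe_horizontal.
have on (k k' : 'I_2) : inn (hframe (nth 0 [:: f1; f2] k))
    (hframe (nth 0 [:: f1; f2] k')) = (k == k')%:R.
  case: k k' => [[|[|//]] ?] [[|[|//]] ?];
    [exact: e11|exact: e12|exact: etrans (innC L e2 e1) e12|exact: e22].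
move=> k k'; rewrite inner_evalv // on.
by case: (k == k'); [exact: eval1|exact: raddf0].
Qed.

Lemma inn_adapted Y Z :
  inn Y Z = inn Y e1 * inn Z e1 + inn Y e2 * inn Z e2 + inn u Y * inn u Z.
Proof.
by rewrite {1}[Y]adapted_complete !innDl !innZl !(innC L _ Z) (innC L u Y).
Qed.

Definition hcoord q f y : R := eval q (inn (ct y) (hframe f)).

(** The horizontal extensions in the definition are represented by constant fields minus their
    vertical part, the case treated by [adapted_vertical_bracket]. *)
Lemma integrabilityE q y z : ldom c q -> integrability g U i q y z =
  (2 * eval q v * (hcoord q f1 y * hcoord q f2 z - hcoord q f2 y * hcoord q f1 z))
    *: U i q.
Proof.
move=> Dq.
have evE (w A B C E : S) : eval q ((w + w) * (A * B - C * E)) =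
    2 * eval q w * (eval q A * eval q B - eval q C * eval q E).
  by rewrite evalM !(evalD, evalN) !evalM; ring.
rewrite /hcoord -evE -adapted_vertical_bracket /integrability /vproj.
congr (_ *: _).
have hr x : repr_field (fun q' => hproj g U i q' x) (ct x - th (ct x) *: u).
  move=> q' Dq'; rewrite /hproj /vproj thetaE // (u_repr Dq').
  by apply/rowP => k; rewrite !mxE raddfB /= evalM eval_cst.
rewrite /theta.
exact: (metric_repr_inner g_metric (O_open := preim_chart_open) u_repr
  (metric_repr_bracket g_metric preim_chart_open (hr y) (hr z)) Dq).
Qed.

Lemma inner_hcoord q y z : ldom c q -> inner (g i q) y z =
  hcoord q f1 y * hcoord q f1 z + hcoord q f2 y * hcoord q f2 z
  + theta g U i q y * theta g U i q z.
Proof.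
move=> Dq.
have evE (A B C E A' B' : S) : eval q (A * B + C * E + A' * B') =
    eval q A * eval q B + eval q C * eval q E + eval q A' * eval q B'.
  by rewrite !evalD !evalM.
rewrite (metric_inner_const g_metric (O_open := preim_chart_open)) // inn_adapted evE.
by rewrite /hcoord !thetaE.
Qed.

(** The chosen horizontal basis differs from the adapted one by an orthogonal matrix with rows
    [(x k, y k)], so each of the two ordered pairs of distinct vectors contributes [(2 v)^2]; hence
    the 8. *)
Lemma integrability_norm2E p : ldom c p ->
  integrability_norm2 g phi U i p = 8 * eval p v ^+ 2.
Proof.
move=> Dp; have [honb_on honb_hor] := honb_spec Dp.
rewrite /integrability_norm2.
pose x k := hcoord p f1 (honb g phi i p k).
pose y k := hcoord p f2 (honb g phi i p k).
have Uv : vertical phi i p (U i p) by case: U_vertical => _; apply; case: Dp.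
have U1 : inner (g i p) (U i p) (U i p) = 1 by apply: U_unit; case: Dp.
have IE a' b' : inner (g i p)
    (integrability g U i p (honb g phi i p a') (honb g phi i p b'))
    (integrability g U i p (honb g phi i p a') (honb g phi i p b')) =
    4 * eval p v ^+ 2 * (x a' * y b' - y a' * x b') ^+ 2.
  rewrite integrabilityE // innerZZ U1 -!/(x _) -!/(y _).
  by move: (eval p v) => w; clearbody x y; ring.
have on a' b' : x a' * x b' + y a' * y b' = (a' == b')%:R.
  rewrite -honb_on inner_hcoord //.
  have th0 k : theta g U i p (honb g phi i p k) = 0.
    rewrite /theta /inner.
    have := honb_hor k (U i p) Uv; rewrite /inner => <-.
    have gs : (g i p)^T = g i p by case: g_metric => _ _ gs _; apply: gs; case: Dp.
    suff -> : U i p *m g i p *m (honb g phi i p k)^T =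
      (honb g phi i p k *m g i p *m (U i p)^T)^T by rewrite mxE.
    by rewrite !trmx_mul trmxK gs mulmxA.
  by rewrite !th0 mul0r addr0.
transitivity (\sum_(a' < 2) \sum_(b' < 2)
    4 * eval p v ^+ 2 * (x a' * y b' - y a' * x b') ^+ 2).
  by apply: eq_bigr => a' _; apply: eq_bigr => b' _; exact: IE.
clearbody x y; move: (eval p v) => w.
have o00 : x ord0 * x ord0 + y ord0 * y ord0 = 1 by rewrite on.
have o01 : x ord0 * x ord_max + y ord0 * y ord_max = 0 by rewrite on.
have o11 : x ord_max * x ord_max + y ord_max * y ord_max = 1 by rewrite on.
rewrite !big_ord_recl !big_ord0 (_ : lift ord0 ord0 = ord_max); last exact: val_inj.
set x0 := x ord0 in o00 o01 *; set y0 := y ord0 in o00 o01 *.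
set x1 := x _ in o01 o11 *; set y1 := y _ in o01 o11 *.
(* By Lagrange's identity the determinant of an orthogonal matrix squares to 1. *)
have d1 : (x0 * y1 - y0 * x1) ^+ 2 = 1.
  have -> : (x0 * y1 - y0 * x1) ^+ 2 = (x0 * x0 + y0 * y0) * (x1 * x1 + y1 * y1)
     - (x0 * x1 + y0 * y1) ^+ 2 by ring.
  by rewrite o00 o01 o11 mulr1 expr0n subr0.
have -> : (x1 * y0 - y1 * x0) ^+ 2 = 1 by rewrite -d1; ring.
by rewrite d1; ring.
Qed.

Lemma local_identity (f : M -> R) (fs : S) (X E : M -> 'rV[R]_3) (Xs : 'rV[S]_3)
    (A : R) p y z :
  repr_fun f fs -> repr_field X Xs -> repr_field E (Xs + fs *: u - mus) ->
  ldom c p ->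
  ricci g i p y z + 2^-1 * lie_metric g i E p y z + A * inner (g i p) y z =
  soliton_form g h phi lambda U i j f X A p y z.
Proof.
move=> fE XE EE Dp.
(* The whole bookkeeping, stated for arbitrary ring elements so that [field] meets atoms only. The
   two halves of the Lie derivative along [mu] cancel, and a quarter of 8 v^2 matches
   [w * w *+ 2]. *)
have evE (lm k Lp M0 I tY tZ w LM mY mZ s dY dZ cY cZ LX F fY fZ : S) :
  eval p ((lm * lm * k + Lp + M0) * (I - tY * tZ) - w * w *+ 2 * I
     + sf_cst c 2^-1 * LM - (mY + s * tY) * (mZ + s * tZ) - (s * tY) * (s * tZ)
     + sf_cst c 2^-1 * ((dY *+ 2 + cY) * tZ + tY * (dZ *+ 2 + cZ)))
  + 2^-1 * eval p (LX + (- (F * s *+ 2 * (I - tY * tZ))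
      + ((fY + F * mY) * tZ + tY * (fZ + F * mZ))) + - LM) + A * eval p I =
  (eval p lm ^+ 2 * eval p k + eval p Lp + eval p M0 - eval p F * eval p s)
    * (eval p I - eval p tY * eval p tZ)
  - 4^-1 * (8 * eval p w ^+ 2) * eval p I + 2^-1 * eval p LX + A * eval p I
  - (eval p mY + eval p (s * tY)) * (eval p mZ + eval p (s * tZ))
  - eval p (s * tY) * eval p (s * tZ)
  + 2^-1 * ((eval p fY + eval p F * eval p mY + 2 * eval p dY + eval p cY) * eval p tZ
     + eval p tY * (eval p fZ + eval p F * eval p mZ + 2 * eval p dZ + eval p cZ)).
  by rewrite !(evalD, evalN, evalM, evalMn, eval_cst _ Dp); field.
rewrite /soliton_form; cbv zeta.
rewrite (metric_lieE g_metric (O_open := preim_chart_open) _ _ EE) //.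
rewrite (lie_gD L (Xs + fs *: u)) (lie_gD L Xs) lie_gN adapted_lie_vertical.
rewrite (metric_ricciE adapted_onb) // adapted_ricci metric_half.
rewrite (metric_inner_const g_metric (O_open := preim_chart_open)) //.
rewrite evE.
have dE F Fs x : repr_fun F Fs -> differential i F p x = eval p (der (ct x) Fs).
  by move=> FE; exact: repr_der (repr_const x) FE p Dp.
rewrite (lamE Dp) (curvatureE (phi_dom Dp)) (eval_pullback phi_dom phi_cont _ K0 Dp).
rewrite (laplacian_lnlE Dp) (repr_der mu_repr lnl_repr Dp) (sg_repr Dp).
rewrite !(thetaE _ Dp) (integrability_norm2E Dp) !(mu_flatE _ Dp) !(dvertE _ Dp).
rewrite (metric_lieE g_metric (O_open := preim_chart_open) _ _ XE) // (fE p Dp).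
by rewrite !(dE _ _ _ fE) !(dE _ _ _ sg_repr) !(codiff_OmegaE _ Dp).
Qed.

End AdaptedFrame.

(** With this identity for all [f], [X] and [A], the theorem is reduced to decomposing the soliton
    field and reassembling it. *)
Lemma semi_conformal_identity (f : M -> R) (X E : chart M -> M -> 'rV[R]_3) (A : R) p y z :
  smooth f -> vector_field X ->
  (forall q, chart_dom i q -> E i q = X i q + f q *: U i q - mu g U i q) ->
  chart_dom i p -> chart_dom j (phi p) ->
  ricci g i p y z + 2^-1 * lie_metric g i (E i) p y z + A * inner (g i p) y z =
  soliton_form g h phi lambda U i j f (X i) A p y z.
Proof.
move=> sf vX EE Di Dj; have Dp : ldom c p by [].
have [lam [lam' [l [lamE lamK QH lE dl]]]] := smooth_dilation.
have [e [push_e inn_e]] := horizontal_lift lamK QH.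
have [f1 [f2 [a0 [b0 [i11 i22 i12 b12 KE]]]]] := surface_frame h_metric j openT.
have sfc : smooth_coord (lmap c) (linv c) (ldom c) f by exact: smooth_in_on (sf i).
have fE : repr_fun f (to_smooth sfc) by move=> q Dq; rewrite /eval to_smoothE.
have UE : repr_field (U i) Us by exact: repr_lift_field.
have XE := repr_lift_field vX.
apply: (local_identity lamK dl Us_unit Us_jac push_e inn_e i11 i22 i12 b12
  UE lamE lE KE A y z fE XE _ Dp).
move=> q Dq; rewrite EE; last by case: Dq.
rewrite (mu_repr UE Dq) (XE q Dq) (UE q Dq) (fE q Dq).
by rewrite evalvD evalvN (evalvD q (lift_field vX)) evalvZ.
Qed.

End SemiConformalLocal.

(** * The mean curvature of the fibres as a vector field *)

Section UnitField.
Variables (S : comPzRingType) (V : lmodType S) (L : levi_civita V) (u : V).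
Hypothesis u_unit : inn L u u = 1.

Lemma inn_nab_unit Z : inn L (nab L Z u) u = 0.
Proof.
apply: (double_inj L); have := metric_compat L Z u u.
by rewrite u_unit der1 (innC L u) addr0.
Qed.

(** The derivative of a unit field is orthogonal to it, which leaves a single term of the skew part
    of its covariant derivative. *)
Lemma mean_curvature_dform Z : inn L (nab L u u) Z = dform L (inn L u) u Z.
Proof.
rewrite /dform !(metric_compat L) brE innDr innNr (innC L u (nab L Z u)) inn_nab_unit.
ring.
Qed.

End UnitField.

Section MeanCurvature.
Variables (R : realType) (n : nat) (M : manifold R n).
Variables (g : chart M -> M -> 'M[R]_n) (g_metric : riemannian_metric g).
Variables (U : chart M -> M -> 'rV[R]_n) (U_field : vector_field U).
Hypothesis U_unit : unit_field g U.

Section OneChart.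
Variables (i : chart M) (O : set M) (O_open : open O).
Local Notation c := (chart_on i O_open).
Local Notation L := (metric_lc g_metric i O_open).
Local Notation G := (gram g_metric i O_open).

Lemma repr_smooth f (F : smooth_fun c) : repr_fun f F ->
  smooth_coord (lmap c) (linv c) (ldom c) f.
Proof. by move=> fF; apply: smooth_on_eq (sfun_smooth F) => q Dq; rewrite fF. Qed.

Definition field_in (X : chart M -> M -> 'rV[R]_n) (vX : vector_field X) :
    'rV[smooth_fun c]_n :=
  \row_k to_smooth (smooth_in_on (O_open := O_open) (proj1 vX i k)).

Lemma repr_field_in X (vX : vector_field X) : repr_field (X i) (field_in vX).
Proof. by move=> q Dq; apply/rowP => k; rewrite !mxE /eval to_smoothE. Qed.

Local Notation u := (field_in U_field).

Lemma field_in_unit : inn L u u = 1.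
Proof.
apply: eval_eq => p Dp; rewrite eval1 //.
rewrite -(metric_repr_inner g_metric (repr_field_in U_field) (repr_field_in U_field) Dp).
by apply: U_unit; case: Dp.
Qed.

Lemma repr_mu : repr_field (mu g U i) (nab L u u).
Proof.
by move=> q Dq; exact: (metric_repr_nabla g_metric (repr_field_in U_field)
  (repr_field_in U_field) Dq).
Qed.

(** Coordinate fields commute, so the interior product of d theta is made of first derivatives of
    the components of theta, free of Christoffel symbols. *)
Lemma mu_flat_coord b : (nab L u u *m G) 0 b =
  \sum_k u 0 k * (sf_partial k ((u *m G) 0 b) - sf_partial b ((u *m G) 0 k)).
Proof.
have th_delta k : inn L u (delta_mx 0 k) = (u *m G) 0 k by exact: cinn_delta.
have -> : (nab L u u *m G) 0 b = inn L (nab L u u) (delta_mx 0 b).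
  by rewrite [RHS]cinn_delta.
rewrite (mean_curvature_dform field_in_unit).
have [B1 _] := bilinf_dform L (linf_inn_r L u).
rewrite (linf_delta u (B1 _)); apply: eq_bigr => k _; congr (_ * _).
have dd a f : der L (delta_mx 0 a) f = sf_partial a f.
  rewrite metric_derE (bigD1 a) //= big1 => [|d da]; last by rewrite !mxE (negPf da) mul0r.
  by rewrite !mxE !eqxx mul1r addr0.
have br0 : br L (delta_mx 0 k) (delta_mx 0 b) = 0.
  apply/rowP => d; rewrite metric_brE !dd !mxE.
  have p01 a (x : bool) : sf_partial a (x%:R : smooth_fun c) = 0.
    case: x; last exact: raddf0.
    by rewrite -[1%:R]/(sf_cst c 1) sf_partial_cst.
  by rewrite !p01 subrr.
by rewrite /dform br0 !dd !th_delta (linf0 (linf_inn_r L u)) subr0.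
Qed.

End OneChart.

Lemma mu_smooth i k : smooth_in i setT (fun q => mu g U i q 0 k).
Proof.
have /(repr_coord k) := @repr_mu i setT openT.
exact: repr_smooth.
Qed.

Section TwoCharts.
Variables (i j : chart M).
Local Notation c := (chart_on i (chart_dom_open j)).
Local Notation c' := (chart_on j (chart_dom_open i)).
Local Notation L := (metric_lc g_metric i (chart_dom_open j)).
Local Notation L' := (metric_lc g_metric j (chart_dom_open i)).
Local Notation G := (gram g_metric i (chart_dom_open j)).
Local Notation G' := (gram g_metric j (chart_dom_open i)).

(** A change of coordinates is treated as the pull-back along the identity from one chart to
    another, both cut down to their overlap. *)
Let id_dom p : ldom c p -> ldom c' (id p).
Proof. by case. Qed.
Let id_cont p : ldom c p -> {for p, continuous (@id M)}.
Proof. by move=> _; exact: cvg_id. Qed.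
Let id_smooth b : smooth_coord (lmap c) (linv c) (ldom c)
  (fun q => lmap c' (id q) 0 b).
Proof. exact: transition_smooth. Qed.

Local Notation pull := (sf_pullback id_dom id_cont id_smooth).
Local Notation pullm := (map_mx pull).
Local Notation u := (field_in i (chart_dom_open j) U_field).
Local Notation u' := (field_in j (chart_dom_open i) U_field).

Let T : 'M[smooth_fun c]_n := \matrix_(a, b) sf_jacobian id_smooth a b.

Let TE p : ldom c p -> evalv p T = transition i j p.
Proof. by move=> Dp; apply/matrixP => a b; rewrite !mxE /eval to_smoothE. Qed.

Let eval_pullm p m k (A : 'M[smooth_fun c']_(m, k)) : ldom c p ->
  evalv p (pullm A) = evalv p A.
Proof. by move=> Dp; apply/matrixP => a b; rewrite !mxE eval_pullback. Qed.

Let pull_u : pullm u' = u *m T.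
Proof.
apply: evalv_ext => p Dp; have [Di Dj] := Dp.
rewrite eval_pullm // evalv_mul TE // -(repr_field_in _ Dp) -(repr_field_in _ (id_dom Dp)).
exact: U_field.2.
Qed.

Let pull_G : G = T *m pullm G' *m T^T.
Proof.
apply: evalv_ext => p Dp; have [Di Dj] := Dp.
rewrite !evalv_mul evalv_tr eval_pullm // TE // (gramE g_metric Dp).
rewrite (gramE g_metric (id_dom Dp)).
by case: g_metric => _ gT _ _; exact: gT.
Qed.

Let pull_theta : u *m G = pullm (u' *m G') *m T^T.
Proof. by rewrite pull_G map_mxM pull_u !mulmxA. Qed.

(** Naturality of the exterior derivative: the derivatives of the transition matrix are symmetric by
    [DT] and cancel. *)
Lemma mu_flat_pullback :
  nab L u u *m G = pullm (nab L' u' u' *m G') *m T^T.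
Proof.
apply/rowP => l; rewrite mu_flat_coord pull_theta.
set t := u' *m G'.
have D1 k m : sf_partial k ((pullm t *m T^T) 0 m) =
    \sum_a \sum_b T m a * T k b * pull (sf_partial b (t 0 a))
    + \sum_a pull (t 0 a) * sf_partial k (T m a).
  rewrite mxE raddf_sum -big_split; apply: eq_bigr => a _.
  rewrite /= [(map_mx _ t) _ _]mxE [T^T _ _]mxE sf_partialM sf_partial_pullback.
  congr (_ + _); rewrite big_distrl; apply: eq_bigr => b _ /=.
  by rewrite [T k b]mxE; ring.
have DT k m a : sf_partial k (T m a) = sf_partial m (T k a).
  by rewrite !mxE sf_jacobianC.
have D2 k : sf_partial k ((pullm t *m T^T) 0 l) - sf_partial l ((pullm t *m T^T) 0 k) =
    \sum_a \sum_b T l a * T k b *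
      (pull (sf_partial b (t 0 a)) - pull (sf_partial a (t 0 b))).
  rewrite !D1; under [X in _ + X - _]eq_bigr => a _ do rewrite DT.
  rewrite opprD addrACA subrr addr0.
  rewrite [X in _ - X]exchange_big -sumrB; apply: eq_bigr => a _ /=.
  by rewrite -sumrB; apply: eq_bigr => b _; ring.
under eq_bigr => k _ do rewrite D2 big_distrr.
rewrite exchange_big [RHS]mxE; apply: eq_bigr => a _.
have -> : (pullm (nab L' u' u' *m G')) 0 a = pull ((nab L' u' u' *m G') 0 a).
  by rewrite mxE.
rewrite mu_flat_coord rmorph_sum big_distrl /=.
under eq_bigr => k _ do rewrite big_distrr.
rewrite exchange_big; apply: eq_bigr => b _ /=.
have pu : pull (u' 0 b) = \sum_k u 0 k * T k b.
  by have /rowP/(_ b) := pull_u; rewrite mxE => ->; rewrite mxE.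
rewrite rmorphM rmorphB /= pu !big_distrl; apply: eq_bigr => k _ /=.
by rewrite [T^T _ _]mxE; ring.
Qed.

(** The law for the covector becomes one for the vector after cancelling the metric and the
    transposed transition matrix, both invertible by positive definiteness. *)
Lemma mu_transition p : chart_dom i p -> chart_dom j p ->
  mu g U j p = mu g U i p *m transition i j p.
Proof.
move=> Di Dj; have Dp : ldom c p by []. have D'p : ldom c' p by [].
have := congr1 (@evalv _ _ _ c p _ _) mu_flat_pullback.
rewrite !evalv_mul eval_pullm // !evalv_mul evalv_tr TE //.
rewrite (gramE g_metric Dp) (gramE g_metric D'p).
rewrite -(repr_mu Dp) -(repr_mu D'p).
have [_ gT _ gpos] := g_metric; rewrite (gT i j p) // => E.
have gu k : chart_dom k p -> g k p \in unitmx.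
  by move=> Dk; rewrite unitmxE unitfE; apply: posdef_det => w w0; exact: gpos.
have Tu : transition i j p \in unitmx.
  have := gu i Di; rewrite (gT i j p) // !unitmx_mul => /andP[/andP[]] //.
have TTu : (transition i j p)^T \in unitmx by rewrite unitmx_tr.
apply: (can_inj (mulmxK (gu j Dj))); apply: (can_inj (mulmxK TTu)).
by rewrite -E !mulmxA.
Qed.

End TwoCharts.

Lemma mu_field : vector_field (mu g U).
Proof. by split; [exact: mu_smooth|move=> i j p; exact: mu_transition]. Qed.

End MeanCurvature.

(** * Operations on global vector fields *)

Section VectorFields.
Variables (R : realType) (n : nat) (M : manifold R n).
Implicit Types (X Y : chart M -> M -> 'rV[R]_n) (f : M -> R).

Lemma vector_fieldD X Y : vector_field X -> vector_field Y ->
  vector_field (fun i p => X i p + Y i p).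
Proof.
move=> [sX tX] [sY tY]; split=> [i k|i j p Di Dj].
  apply: (smooth_on_eq (c := chart_on i openT)
    (f := fun q => X i q 0 k + Y i q 0 k)) => [q _|]; first by rewrite mxE.
  exact: (smoothD (c := chart_on i openT) (sX i k) (sY i k)).
by rewrite (tX i) // (tY i) // mulmxDl.
Qed.

Lemma vector_fieldZ f X : smooth f -> vector_field X ->
  vector_field (fun i p => f p *: X i p).
Proof.
move=> sf [sX tX]; split=> [i k|i j p Di Dj].
  apply: (smooth_on_eq (c := chart_on i openT)
    (f := fun q => f q * X i q 0 k)) => [q _|]; first by rewrite mxE.
  exact: (smoothM (c := chart_on i openT) (sf i) (sX i k)).
by rewrite (tX i) // scalemxAl.
Qed.

Lemma vector_fieldN X : vector_field X -> vector_field (fun i p => - X i p).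
Proof.
move=> [sX tX]; split=> [i k|i j p Di Dj].
  apply: (smooth_on_eq (c := chart_on i openT)
    (f := fun q => - X i q 0 k)) => [q _|]; first by rewrite mxE.
  exact: (smoothN (c := chart_on i openT) (sX i k)).
by rewrite (tX i) // mulNmx.
Qed.

Variables (g : chart M -> M -> 'M[R]_n) (g_metric : riemannian_metric g).

Lemma inner_chart_independent X Y i j p : vector_field X -> vector_field Y ->
  chart_dom i p -> chart_dom j p ->
  inner (g i p) (X i p) (Y i p) = inner (g j p) (X j p) (Y j p).
Proof.
move=> [_ tX] [_ tY] Di Dj; have [_ gT _ _] := g_metric.
by rewrite (tX i j) // (tY i j) // (gT i j) // /inner trmx_mul !mulmxA.
Qed.

Definition chart_at (p : M) : chart M := proj1_sig (cid (chart_dom_cover p)).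

Lemma chart_atP p : chart_dom (chart_at p) p.
Proof. exact: (proj2_sig (cid (chart_dom_cover p))). Qed.

(** A function on all of [M] needs one value per point, so a chart is chosen around each; [pairingE]
    shows that the choice is immaterial. *)
Definition pairing X Y (p : M) : R :=
  inner (g (chart_at p) p) (X (chart_at p) p) (Y (chart_at p) p).

Lemma pairingE X Y i p : vector_field X -> vector_field Y -> chart_dom i p ->
  pairing X Y p = inner (g i p) (X i p) (Y i p).
Proof. by move=> vX vY Di; apply: inner_chart_independent => //; exact: chart_atP. Qed.

Lemma pairing_smooth X Y : vector_field X -> vector_field Y -> smooth (pairing X Y).
Proof.
move=> vX vY i; apply: (@repr_smooth _ _ _ i setT openT _
  (inn (metric_lc g_metric i openT) (field_in i openT vX) (field_in i openT vY))).
move=> q Dq; rewrite (pairingE vX vY (proj1 Dq)).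
exact: (metric_repr_inner g_metric (repr_field_in (O_open := openT) vX)
  (repr_field_in (O_open := openT) vY) Dq).
Qed.

End VectorFields.

Lemma inner_symmetric (R : realType) (n : nat) (A : 'M[R]_n) x y : A^T = A ->
  inner A x y = inner A y x.
Proof.
move=> As; rewrite /inner.
suff -> : x *m A *m y^T = (y *m A *m x^T)^T by rewrite [LHS]mxE.
by rewrite !trmx_mul trmxK As mulmxA.
Qed.

Lemma innerD_l (R : realType) (n : nat) (A : 'M[R]_n) x y z :
  inner A (x + y) z = inner A x z + inner A y z.
Proof. by rewrite /inner !mulmxDl mxE. Qed.

Lemma innerN_l (R : realType) (n : nat) (A : 'M[R]_n) x z :
  inner A (- x) z = - inner A x z.
Proof. by rewrite /inner !mulNmx mxE. Qed.

Lemma innerZ_l (R : realType) (n : nat) (A : 'M[R]_n) a x z :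
  inner A (a *: x) z = a * inner A x z.
Proof. by rewrite /inner -!scalemxAl mxE. Qed.

(** * Vertical and horizontal vectors *)

Section Fibre.
Variables (R : realType) (M : manifold R 3) (N : manifold R 2).
Variables (g : chart M -> M -> 'M[R]_3) (phi : M -> N).
Variable U : chart M -> M -> 'rV[R]_3.
Hypotheses (g_metric : riemannian_metric g) (phi_submersion : submersion phi).
Hypotheses (U_vertical : vertical_field phi U) (U_unit : unit_field g U).

(** The differential has rank 2 on a space of dimension 3, so its kernel is a line, and [U] is a
    nonzero vector in it. *)
Lemma vertical_multiple i p v : chart_dom i p -> vertical phi i p v ->
  exists a, v = a *: U i p.
Proof.
move=> Di vv; have [j Dj] := chart_dom_cover (phi p).
set J := dmap phi i j p.
have rkJ : \rank J = 2%N by apply/eqP; have := phi_submersion.2 i j p Di Dj.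
have Uker : (U i p <= kermx J)%MS.
  by apply/sub_kermxP; exact: (U_vertical.2 i p Di j Dj).
have vker : (v <= kermx J)%MS by apply/sub_kermxP; exact: vv.
have U0 : U i p != 0.
  apply/eqP => U0; have := U_unit Di; rewrite U0 /inner !mul0mx mxE => /eqP.
  by rewrite eq_sym oner_eq0.
have kU : (kermx J <= U i p)%MS.
  have := mxrank_leqif_sup Uker; rewrite mxrank_ker rkJ rank_rV U0 /= => H.
  by have [_ <-] := H.
have /submxP[w ->] : (v <= U i p)%MS by exact: submx_trans kU.
exists (w 0 0); apply/rowP => k; rewrite !mxE big_ord1.
by rewrite ord1.
Qed.

Lemma horizontal_orth i p x : chart_dom i p ->
  horizontal g phi i p x <-> inner (g i p) x (U i p) = 0.
Proof.
move=> Di; split=> [H|xU v /(vertical_multiple Di)[a ->]].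
  by apply: H; exact: U_vertical.2.
by rewrite /inner linearZ -scalemxAr mxE -/(inner _ _ _) xU mulr0.
Qed.

Lemma mu_orth i p : chart_dom i p -> inner (g i p) (mu g U i p) (U i p) = 0.
Proof.
move=> Di; have Dp : ldom (chart_on i openT) p by [].
rewrite (metric_repr_inner g_metric (repr_mu g_metric (proj1 U_vertical) (O_open := openT))
  (repr_field_in (O_open := openT) (proj1 U_vertical)) Dp).
by rewrite (inn_nab_unit (field_in_unit g_metric (proj1 U_vertical) U_unit i openT)) eval0.
Qed.

End Fibre.

Theorem proposition2p9 (R : realType) (M : manifold R 3) (N : manifold R 2)
    (g : chart M -> M -> 'M[R]_3) (h : chart N -> N -> 'M[R]_2)
    (phi : M -> N) (lambda : M -> R) (U : chart M -> M -> 'rV[R]_3)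
    (g_metric : riemannian_metric g) (h_metric : riemannian_metric h)
    (phi_submersion : submersion phi)
    (phi_semi_conformal : semi_conformal g h phi lambda)
    (U_vertical : vertical_field phi U) (U_unit : unit_field g U) :
  let lnl := fun q : M => ln (lambda q) in
  ricci_soliton g <->
  exists (f : M -> R) (X : chart M -> M -> 'rV[R]_3) (A : R),
    [/\ smooth f, horizontal_field g phi X &
      forall i j p, chart_dom i p -> chart_dom j (phi p) -> forall y z : 'rV[R]_3,
        let th := theta g U i p in
        let dvl := dvert g U i lnl p in
        0 = (lambda p ^+ 2 * gauss_curvature h j (phi p)
             + laplacian g i lnl p + deriv_along i (mu g U i) lnl p
             - f p * deriv_along i (U i) lnl p)
              * (inner (g i p) y z - tsquare th y z)
            - 4^-1 * integrability_norm2 g phi U i p * inner (g i p) y z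
            + 2^-1 * lie_metric g i (X i) p y z
            + A * inner (g i p) y z
            - tsquare (fun v => mu_flat g U i p v + dvl v) y z
            - tsquare dvl y z
            + symprod (fun v => differential i f p v
                                + f p * mu_flat g U i p v
                                + 2 * differential i
                                        (deriv_along i (U i) lnl) p v
                                + codiff g i (Omega g U i) p v)
                      th y z].
Proof.
move=> lnl; have U_field := proj1 U_vertical.
have mu_vf := mu_field g_metric U_field U_unit.
have key f X E A i j p y z : smooth f -> vector_field X ->
    (forall q, chart_dom i q -> E i q = X i q + f q *: U i q - mu g U i q) ->
    chart_dom i p -> chart_dom j (phi p) -> _ :=
  fun sf vX EE Di Dj => semi_conformal_identity g_metric h_metric phi_submersion
    phi_semi_conformal U_vertical U_unit A y z sf vX EE Di Dj.
split=> [[E [A [E_field E_soliton]]]|[f [X [A [f_smooth [X_field X_horizontal] H]]]]].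
- pose f := pairing g U E.
  have f_smooth : smooth f by exact: pairing_smooth.
  pose X i p := E i p + mu g U i p + - (f p *: U i p).
  have X_field : vector_field X.
    apply: vector_fieldD; first exact: vector_fieldD.
    by apply: vector_fieldN; exact: vector_fieldZ.
  exists f, X, A; split=> //.
    split=> // i p Di; apply/(horizontal_orth phi_submersion U_vertical U_unit) => //.
    have gs : (g i p)^T = g i p by case: g_metric => _ _ gs _; exact: gs.
    (* The component of [X] along [U] is g(E, U) + 0 - f, and [f] was chosen as g(U, E). *)
    rewrite /X !innerD_l innerN_l innerZ_l (mu_orth g_metric U_vertical) // U_unit //.
    by rewrite /f (pairingE g_metric U_field E_field Di) (inner_symmetric _ _ gs); ring.
  move=> i j p Di Dj y z th dvl.
  have EE q : chart_dom i q -> E i q = X i q + f q *: U i q - mu g U i q.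
    by move=> _; rewrite /X addrNK addrK.
  rewrite -[RHS]/(soliton_form g h phi lambda U i j f (X i) A p y z).
  rewrite -(key f X E A i j p y z f_smooth X_field EE Di Dj).
  (* The soliton equation is -2 times the vanishing of the left side of [key]. *)
  have := E_soliton i p Di y z; lra.
- pose E i p := X i p + f p *: U i p + - mu g U i p.
  exists E, A; split.
    apply: vector_fieldD; last exact: vector_fieldN.
    by apply: vector_fieldD => //; exact: vector_fieldZ.
  (* The soliton equation does not mention the base; any chart around [phi p] gives access to the
     hypothesis. *)
  move=> i p Di y z; have [j Dj] := chart_dom_cover (phi p).
  have : 0 = soliton_form g h phi lambda U i j f (X i) A p y z := H i j p Di Dj y z.
  rewrite -(key f X E A i j p y z f_smooth X_field (fun q _ => erefl) Di Dj).
  lra.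
Qed.
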